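(* Suppose the weight sequence $\mathbf{w}$ has type II or III and let $v_0$ be a uniformly random vertex of $\mathcal{T}_n$. For any finite set of vertices $x_1,\dots,x_r$ of $\mathcal{U}^\bullet_\infty$, $$d_{\mathrm{TV}}\Big(\big(d^+_{H(\mathcal{T}_n,v_0,\Omega_n)}(x_i)\big)_{1\le i\le r},\ \big(d^+_{\bar{\mathcal{T}}^*_n}(x_i)\big)_{1\le i\le r}\Big)\to0 .$$ Equivalently, there is a coupling of $(\mathcal{T}_n,v_0)$ and $\bar{\mathcal{T}}^*_n$ such that $d_{\mathrm{lf}}\big(H(\mathcal{T}_n,v_0,\Omega_n),\bar{\mathcal{T}}^*_n\big)\to0$ in probability.
   Context: A weight sequence $\mathbf{w}=(\omega_k)_{k\ge0}$ consists of non-negative reals with $\omega_0>0$ and $\omega_k>0$ for some $k\ge2$; $\mathcal{T}_n$ is the random plane tree with $n$ vertices drawn with probability proportional to $\prod_v\omega_{d^+(v)}$ ($n\equiv1\bmod\gcd\{i:\omega_i>0\}$); its root is $o$. Let $\phi(z)=\sum_k\omega_kz^k$ with radius $\rho_\phi$, $\psi(t)=t\phi'(t)/\phi(t)$, $\nu=\lim_{t\nearrow\rho_\phi}\psi(t)$ when $\rho_\phi>0$. Type II: $\rho_\phi>0$, $0<\nu<1$, $\tau:=\rho_\phi$. Type III: $\rho_\phi=0$, $\tau:=\nu:=0$. $\xi$ has law $\Pr{\xi=k}=\tau^k\omega_k/\phi(\tau)$, $\mu=\mathbb{E}\xi=\min(\nu,1)$, $\mathcal{T}$ is a Galton–Watson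 tree with offspring $\xi$, $\hat\xi\in\mathbb{N}\cup\{\infty\}$ has $\Pr{\hat\xi=k}=k\Pr{\xi=k}$, $\Pr{\hat\xi=\infty}=1-\mu$. Let $N_k$ be the number of vertices of $\mathcal{T}_n$ with outdegree $k$. $(\Omega_n)$ is a fixed deterministic sequence with $\Omega_n\to\infty$, $\Omega_n=o(n)$, such that for every $K_n\to\infty$ with $K_n\le\Omega_n$: $\sum_{k\le K_n}kN_k=\mu n+o_p(n)$ and $\sum_{k>K_n}kN_k=(1-\mu)n+o_p(n)$. $\tilde D_n$ is a random integer independent of everything else with law of $d^+_{\mathcal{T}_n}(o)$ conditioned on $d^+_{\mathcal{T}_n}(o)>\Omega_n$. Universal tree $\mathcal{U}^\bullet_\infty$: a backward spine $u_0,u_1,\dots$ ($u_i$ parent of $u_{i-1}$), each $u_i$ ($i\ge1$) with infinitely many ordered children left and right of $u_{i-1}$, each non-spine child and $u_0$ the root of a copy of the Ulam–Harris tree. Pointed trees are encoded by outdegrees $d^+(x)\in\overline{\mathbb{N}}_0=\mathbb{N}_0\cup\{\infty\}$ for non-spine $x$ (0 if $x$ not a vertex) and $d^+(u_i)\in\{*\}\sqcup(\overline{\mathbb{N}}_0\times\overline{\mathbb{N}}_0)$ for $i\ge1$ (numbers of children left/right of $u_{i-1}$, $*$ if $u_i$ absent); the pointed vertex sits at $u_0$, its $i$-th ancestor at $u_i$. $H(\mathcal{T}_n,v_0,\Omega_n)$ is the subtree of $\mathcal{T}_n$ consisting of the youngest ancestor of $v_0$ with outdegree $>\Omega_n$ and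 all its descendants, pointed at $v_0$ (a placeholder $\diamond$ if no such ancestor exists). $\bar{\mathcal{T}}^*_n$: $u_0$ is the root of an independent copy of $\mathcal{T}$; for $i=1,2,\dots$ let $\hat\xi_i$ be independent copies of $\hat\xi$; while $\hat\xi_i<\infty$, $u_i$ gets $\hat\xi_i$ children, a uniformly chosen one is $u_{i-1}$, the others roots of independent copies of $\mathcal{T}$. At the first $i$ with $\hat\xi_i=\infty$, $u_i$ instead gets $\tilde D_n$ children, a uniformly chosen one being $u_{i-1}$ and the others roots of independent copies of $\mathcal{T}$, and $u_i$ is the root (construction stops). For $m\ge0$ let $\bar V^{[m]}$ be the set of vertices of $\mathcal{U}^\bullet_\infty$ at graph distance $\le m$ from $u_0$, where each $u_i$ ($1\le i\le m$) keeps only the $m$ nearest children on each side of $u_{i-1}$ and every other vertex keeps only its first $m$ children. For locally finite pointed trees, $d_{\mathrm{lf}}(T_1,T_2)=1/\sup\{m\ge0: d^+_{T_1}(v)=d^+_{T_2}(v)\ \forall v\in\bar V^{[m]}\}$. *)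

(* Defs.v *)
From Stdlib Require Import Reals Lra Lia ZArith Arith List ClassicalEpsilon.
Import ListNotations.
Open Scope R_scope.

Definition weight_seq (w : nat -> R) : Prop :=
  (forall k, 0 <= w k) /\ 0 < w O /\ exists k, (2 <= k)%nat /\ 0 < w k.

Definition is_gcd_support (w : nat -> R) (g : nat) : Prop :=
  (forall i, 0 < w i -> Nat.divide g i) /\
  (forall d, (forall i, 0 < w i -> Nat.divide d i) -> Nat.divide d g).

(** value of a convergent series (chosen classically; only used where the
    series converges) *)
Definition series_val (a : nat -> R) : R :=
  epsilon (inhabits 0) (fun l => infinite_sum a l).

Definition phi_conv (w : nat -> R) (t : R) : Prop :=
  exists l, infinite_sum (fun k => w k * t ^ k) l.

Definition is_radius (w : nat -> R) (rho : R) : Prop :=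
  (forall t, 0 <= t < rho -> phi_conv w t) /\
  (forall t, rho < t -> ~ phi_conv w t).

Definition radius_zero (w : nat -> R) : Prop :=
  forall t, 0 < t -> ~ phi_conv w t.

Definition phi (w : nat -> R) (t : R) : R := series_val (fun k => w k * t ^ k).

(** psi(t) = t phi'(t) / phi(t), with t phi'(t) = sum_k k w_k t^k *)
Definition psi (w : nat -> R) (t : R) : R :=
  series_val (fun k => INR k * w k * t ^ k) / phi w t.

Definition nu_limit (w : nat -> R) (rho nu : R) : Prop :=
  forall eps, 0 < eps -> exists delta, 0 < delta /\
    forall t, 0 < t -> rho - delta < t < rho -> Rabs (psi w t - nu) < eps.

(** type II (rho > 0, 0 < nu < 1, tau = rho, mu = nu) or
    type III (rho = 0, tau = nu = mu = 0) *)
Definition type_II_III (w : nat -> R) (tau mu : R) : Prop :=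
  (is_radius w tau /\ 0 < tau /\ nu_limit w tau mu /\ 0 < mu < 1) \/
  (radius_zero w /\ tau = 0 /\ mu = 0).

Inductive tree : Type := Node : list tree -> tree.

Fixpoint words {A : Type} (b : nat) (L : list A) : list (list A) :=
  match b with
  | O => [[]]
  | S b' => [] :: flat_map (fun x => map (cons x) (words b' L)) L
  end.

(** all plane trees of height <= h and outdegrees <= b (without repetition) *)
Fixpoint bounded (h b : nat) : list tree :=
  match h with
  | O => [Node []]
  | S h' => map Node (words b (bounded h' b))
  end.

Fixpoint verts (t : tree) : list (list nat) :=
  match t with
  | Node ts =>
      let fix go (j : nat) (l : list tree) : list (list nat) :=
        match l with
        | [] => []
        | c :: r => map (cons j) (verts c) ++ go (S j) r
        end in
      [] :: go O ts
  end.

Definition trees_n (n : nat) : list tree :=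
  filter (fun t => Nat.eqb (length (verts t)) n) (bounded n n).

Fixpoint subtree (t : tree) (a : list nat) : option tree :=
  match a with
  | [] => Some t
  | j :: a' => match t with
               | Node ts => match nth_error ts j with
                            | Some c => subtree c a'
                            | None => None
                            end
               end
  end.

Definition deg (t : tree) (a : list nat) : nat :=
  match subtree t a with
  | Some (Node ts) => length ts
  | None => O
  end.

Fixpoint tweight (w : nat -> R) (t : tree) : R :=
  match t with
  | Node ts =>
      let fix go (l : list tree) : R :=
        match l with [] => 1 | c :: r => tweight w c * go r end in
      w (length ts) * go ts
  end.

Definition lsum (l : list R) : R := fold_right Rplus 0 l.

Definition Zn (w : nat -> R) (n : nat) : R :=
  lsum (map (tweight w) (trees_n n)).

Definition Tprob (w : nat -> R) (n : nat) (E : tree -> bool) : R :=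
  lsum (map (fun t => if E t then tweight w t else 0) (trees_n n)) / Zn w n.

(** P( (T_n, v0) satisfies E ), v0 uniform among the n vertices *)
Definition TVprob (w : nat -> R) (n : nat) (E : tree -> list nat -> bool) : R :=
  lsum (map (fun t => lsum (map (fun a => if E t a then tweight w t else 0)
                               (verts t))) (trees_n n)) / (Zn w n * INR n).

Definition Rltb (x y : R) : bool := if Rlt_dec x y then true else false.

Definition low_sum (t : tree) (K : nat) : R :=
  lsum (map (fun a => if Nat.leb (deg t a) K then INR (deg t a) else 0) (verts t)).
Definition high_sum (t : tree) (K : nat) : R :=
  lsum (map (fun a => if Nat.leb (deg t a) K then 0 else INR (deg t a)) (verts t)).

Definition to_infinity (K : nat -> nat) : Prop :=
  forall M, exists N, forall n, (N <= n)%nat -> (M <= K n)%nat.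

Definition op_n (w : nat -> R) (g : nat) (X : nat -> tree -> R) (c : R) : Prop :=
  forall eps delta, 0 < eps -> 0 < delta -> exists N, forall n, (N <= n)%nat ->
    n mod g = 1 mod g ->
    Tprob w n (fun t => Rltb (eps * INR n) (Rabs (X n t - c * INR n))) < delta.

Definition Omega_ok (w : nat -> R) (g : nat) (mu : R) (Om : nat -> nat) : Prop :=
  to_infinity Om /\
  (forall eps, 0 < eps -> exists N, forall n, (N <= n)%nat -> INR (Om n) <= eps * INR n) /\
  (forall K : nat -> nat, to_infinity K -> (forall n, (K n <= Om n)%nat) ->
     op_n w g (fun n t => low_sum t (K n)) mu /\
     op_n w g (fun n t => high_sum t (K n)) (1 - mu)).

(** vertices of U^bullet_infty:
    - [UDesc w]       : the vertex u_0 w (word w in the Ulam-Harris tree at u_0;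
                        [UDesc []] = u_0);
    - [USpine i]      : the spine vertex u_(i+1);
    - [USide i b z w] : the vertex x w where x is the (z+1)-th nearest child of
                        u_(i+1) to the left (b = true) or to the right
                        (b = false) of u_i. *)
Inductive Uvert : Type :=
| UDesc : list nat -> Uvert
| USpine : nat -> Uvert
| USide : nat -> bool -> nat -> list nat -> Uvert.

(** extended naturals: [None] = infinity *)
Definition natbar := option nat.

(** values of d^+ : an element of N-bar (non-spine vertices), or [*], or
    a pair in N-bar x N-bar (spine vertices u_i, i >= 1) *)
Inductive degval : Type :=
| DNum : natbar -> degval
| DStar : degval
| DPair : natbar -> natbar -> degval.

(** k such that the youngest strict ancestor of v0 (address a) with outdegree
    > Om is the k-th ancestor; None if there is none (H = diamond) *)
Definition H_k (Om : nat) (t : tree) (a : list nat) : option nat :=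
  find (fun i => Nat.ltb Om (deg t (firstn (length a - i) a))) (seq 1 (length a)).

(** d^+_{H(t, a, Om)}(x), given that H's root is the k-th ancestor of a *)
Definition H_deg (t : tree) (a : list nat) (k : nat) (x : Uvert) : degval :=
  match x with
  | UDesc u => DNum (Some (deg t (a ++ u)))
  | USpine i =>
      if Nat.leb (S i) k then
        let anc := firstn (length a - S i) a in
        let pos := nth (length a - S i) a O in
        DPair (Some pos) (Some (deg t anc - pos - 1)%nat)
      else DStar
  | USide i b z u =>
      if Nat.leb (S i) k then
        let anc := firstn (length a - S i) a in
        let pos := nth (length a - S i) a O in
        if b then
          (if Nat.leb (S z) pos then DNum (Some (deg t (anc ++ (pos - S z)%nat :: u)))
           else DNum (Some O))
        else DNum (Some (deg t (anc ++ (pos + S z)%nat :: u)))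
      else DNum (Some O)
  end.

(** the random vector (d^+_H(x_i))_i, with [None] standing for H = diamond *)
Definition H_vec (Om : nat) (xs : list Uvert) (t : tree) (a : list nat)
  : option (list degval) :=
  match H_k Om t a with
  | None => None
  | Some k => Some (map (H_deg t a k) xs)
  end.

Definition H_prob (w : nat -> R) (Om : nat -> nat) (n : nat) (xs : list Uvert)
  (E : option (list degval) -> bool) : R :=
  TVprob w n (fun t a => E (H_vec (Om n) xs t a)).

(** a discrete law: an enumeration i |-> (P-mass, outcome); the law of the
    outcome is sum_i mass_i * delta_{outcome_i} *)
Definition dist (A : Type) : Type := nat -> R * A.

Definition dret {A : Type} (a : A) : dist A :=
  fun i => match i with O => (1, a) | S _ => (0, a) end.

(** bijection nat -> nat * nat (diagonal enumeration) *)
Fixpoint unpair (k : nat) : nat * nat :=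
  match k with
  | O => (O, O)
  | S k' => let (i, j) := unpair k' in
            match i with O => (S j, O) | S i' => (i', S j) end
  end.

Definition dbind {A B : Type} (d : dist A) (f : A -> dist B) : dist B :=
  fun k => let (i, j) := unpair k in
           let (p, a) := d i in
           let (q, b) := f a j in (p * q, b).

Definition dmap {A B : Type} (f : A -> B) (d : dist A) : dist B :=
  fun i => let (p, a) := d i in (p, f a).

Definition uniform (k : nat) : dist nat :=
  fun i => if Nat.ltb i k then (/ INR k, i) else (0, O).

Definition dprob_is {A : Type} (d : dist A) (E : A -> bool) (p : R) : Prop :=
  infinite_sum (fun i => let (q, a) := d i in if E a then q else 0) p.

Definition xi_law (w : nat -> R) (tau : R) : dist nat :=
  fun k => (w k * tau ^ k / phi w tau, k).

Definition xihat_law (w : nat -> R) (tau mu : R) : dist natbar :=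
  fun k => match k with
           | O => (1 - mu, None)
           | S k' => (INR (S k') * (w (S k') * tau ^ (S k') / phi w tau), Some (S k'))
           end.

Definition Dtilde_law (w : nat -> R) (n Om : nat) : dist nat :=
  fun k => (if Nat.ltb Om k then
              Tprob w n (fun t => Nat.eqb (deg t []) k) /
              Tprob w n (fun t => Nat.ltb Om (deg t []))
            else 0, k).

(** a Galton-Watson tree observed in a finite window: each node stores its
    (full) outdegree and the subtrees of its first (at most M) children *)
Inductive ptree : Type := PNode : nat -> list ptree -> ptree.

Fixpoint dlist {A : Type} (n : nat) (d : dist A) : dist (list A) :=
  match n with
  | O => dret []
  | S n' => dbind d (fun a => dbind (dlist n' d) (fun l => dret (a :: l)))
  end.

Fixpoint gw (xi : dist nat) (M depth : nat) : dist ptree :=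
  match depth with
  | O => dbind xi (fun k => dret (PNode k []))
  | S d => dbind xi (fun k => dbind (dlist (Nat.min k M) (gw xi M d))
                                    (fun kids => dret (PNode k kids)))
  end.

Fixpoint pdeg (p : ptree) (u : list nat) : nat :=
  match u with
  | [] => match p with PNode k _ => k end
  | j :: u' => match p with
               | PNode k kids =>
                   if Nat.ltb j k then
                     match nth_error kids j with Some c => pdeg c u' | None => O end
                   else O
               end
  end.

Fixpoint dopts (g : dist ptree) (bs : list bool) : dist (list (option ptree)) :=
  match bs with
  | [] => dret []
  | b :: r => dbind (if b then dmap Some g else dret None)
                    (fun o => dbind (dopts g r) (fun l => dret (o :: l)))
  end.

(** a spine vertex u_i (i >= 1): absent, or present with k children, u_(i-1)
    being child number p, and the GW trees of the M nearest children on each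
    side of u_(i-1) (None if there is no such child) *)
Inductive level : Type :=
| Absent : level
| Present : nat -> nat -> list (option ptree) -> list (option ptree) -> level.

Definition level_law (g : dist ptree) (M k : nat) : dist level :=
  dbind (uniform k) (fun p =>
  dbind (dopts g (map (fun z => Nat.leb (S z) p) (seq O M))) (fun ls =>
  dbind (dopts g (map (fun z => Nat.ltb (p + S z) k) (seq O M))) (fun rs =>
  dret (Present k p ls rs)))).

Fixpoint spine (xihat : dist natbar) (D : dist nat) (g : dist ptree)
  (M L : nat) (stopped : bool) : dist (list level) :=
  match L with
  | O => dret []
  | S L' =>
      if stopped then dmap (cons Absent) (spine xihat D g M L' true)
      else dbind xihat (fun h =>
             match h with
             | Some k => dbind (level_law g M k) (fun lv =>
                           dmap (cons lv) (spine xihat D g M L' false))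
             | None => dbind D (fun d => dbind (level_law g M d) (fun lv =>
                           dmap (cons lv) (spine xihat D g M L' true)))
             end)
  end.

Definition star_deg (t0 : ptree) (sp : list level) (x : Uvert) : degval :=
  match x with
  | UDesc u => DNum (Some (pdeg t0 u))
  | USpine i => match nth i sp Absent with
                | Present k p _ _ => DPair (Some p) (Some (k - p - 1)%nat)
                | Absent => DStar
                end
  | USide i b z u => match nth i sp Absent with
                     | Present _ _ ls rs =>
                         match nth z (if b then ls else rs) None with
                         | Some c => DNum (Some (pdeg c u))
                         | None => DNum (Some O)
                         end
                     | Absent => DNum (Some O)
                     end
  end.

Definition ubound (x : Uvert) : nat :=
  match x with
  | UDesc u => (length u + list_max u)%nat
  | USpine i => i
  | USide i _ z u => (i + z + length u + list_max u)%nat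
  end.

Definition Tstar_law (w : nat -> R) (tau mu : R) (Om : nat -> nat) (n : nat)
  (xs : list Uvert) : dist (option (list degval)) :=
  let M := S (list_max (map ubound xs)) in
  let g := gw (xi_law w tau) M M in
  dbind g (fun t0 =>
  dbind (spine (xihat_law w tau mu) (Dtilde_law w n (Om n)) g M M false) (fun sp =>
  dret (Some (map (star_deg t0 sp) xs)))).

(* Main.v *)
(** By the cycle lemma the outdegree sequence of [T_n] is, up to rotation, a
    sequence of [n] outdegrees of sum [n - 1] weighted by the product of the
    weights.  Hence the expected number of occurrences in [T_n] of a pattern
    prescribing the outdegrees [l] at [length l] connected vertices is [n]
    times the probability that this exchangeable sequence starts with [l].

    Exchanging [m] vertices of outdegree [k] and [k] leaves against [k] vertices
    of outdegree [m] and [m] leaves preserves the number of edges, so a second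
    moment computation shows that the empirical outdegree distribution is
    asymptotically of the form [a w_k lam^k].  Its mean is [mu] by the hypothesis
    on [Om], which forces [lam = tau]: the empirical distribution converges to
    the law of [xi].  The degree of a big vertex seen from [v0] has the
    size-biased law of the outdegrees above [Om n], which by the cycle lemma is
    also the law of the root degree given that it is big, that is of [D~_n].

    Thus the probabilities of window patterns around [v0] converge, in total
    variation since the limiting masses add up to one. *)
Require Import Defs.
From Stdlib Require Import Reals Lra Lia Arith List Permutation Classical ClassicalEpsilon.
Import ListNotations.
Open Scope R_scope.

(** Only lower bounds are transferred from the limit to the random tree: one for an event and one
    for its complement fix both probabilities, because the limiting masses are nearly one. Even the
    existence of a big ancestor is obtained so, since spines that meet a big vertex carry almost all
    mass. The obstacle is the big vertex. Its degree ranges up to n - 1 and the pointed child may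
    have any position, so the family of patterns grows with n and pointwise limits do not suffice.
    Errors are summed over its degree k with weight k, which pays for the k positions; size biasing
    turns such a sum into one expectation, whatever the size of k. Leaves take part in the exchange
    because the number of vertices must be kept as well as that of edges; the two lists of degrees
    then have the same conditional probability up to their weights. The tilt is pinned by three
    facts: beyond tau the partial sums of the weight series are unbounded, below tau the mean falls
    short by an amount independent of the window, and the total mass is one. This covers tau = 0
    too. *)

(** * Finite sums over lists *)

Definition sumf {A : Type} (f : A -> R) (l : list A) : R := lsum (map f l).

Lemma sumf_cons {A} (f : A -> R) x l : sumf f (x :: l) = f x + sumf f l.
Proof. reflexivity. Qed.

Lemma sumf_app {A} (f : A -> R) l1 l2 : sumf f (l1 ++ l2) = sumf f l1 + sumf f l2.
Proof.
  induction l1 as [|x l1 IH]; simpl; [unfold sumf at 2; simpl; lra|].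
  rewrite !sumf_cons, IH; lra.
Qed.

Lemma sumf_ext {A} (f g : A -> R) l : (forall x, In x l -> f x = g x) -> sumf f l = sumf g l.
Proof.
  induction l as [|x l IH]; intros H; [reflexivity|].
  rewrite !sumf_cons, (H x), IH; auto with datatypes.
Qed.

Lemma sumf_le {A} (f g : A -> R) l : (forall x, In x l -> f x <= g x) -> sumf f l <= sumf g l.
Proof.
  induction l as [|x l IH]; intros H; [right; reflexivity|].
  rewrite !sumf_cons. apply Rplus_le_compat; auto with datatypes.
Qed.

Lemma sumf_0 {A} (f : A -> R) l : (forall x, In x l -> f x = 0) -> sumf f l = 0.
Proof.
  induction l as [|x l IH]; intros H; [reflexivity|].
  rewrite sumf_cons, H, IH; auto with datatypes; lra.
Qed.

Lemma sumf_nonneg {A} (f : A -> R) l : (forall x, In x l -> 0 <= f x) -> 0 <= sumf f l.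
Proof. intros H. rewrite <- (sumf_0 (fun _ : A => 0) l); auto. apply sumf_le; auto. Qed.

Lemma sumf_scal {A} c (f : A -> R) l : sumf (fun x => c * f x) l = c * sumf f l.
Proof. induction l as [|x l IH]; [unfold sumf; simpl; lra|]. rewrite !sumf_cons, IH; lra. Qed.

Lemma sumf_plus {A} (f g : A -> R) l : sumf (fun x => f x + g x) l = sumf f l + sumf g l.
Proof. induction l as [|x l IH]; [unfold sumf; simpl; lra|]. rewrite !sumf_cons, IH; lra. Qed.

Lemma sumf_minus {A} (f g : A -> R) l : sumf (fun x => f x - g x) l = sumf f l - sumf g l.
Proof. induction l as [|x l IH]; [unfold sumf; simpl; lra|]. rewrite !sumf_cons, IH; lra. Qed.

Lemma sumf_abs {A} (f : A -> R) l : Rabs (sumf f l) <= sumf (fun x => Rabs (f x)) l.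
Proof.
  induction l as [|x l IH]; [unfold sumf; simpl; rewrite Rabs_R0; lra|].
  rewrite !sumf_cons. eapply Rle_trans; [apply Rabs_triang|lra].
Qed.

Lemma sumf_const {A} c (l : list A) : sumf (fun _ => c) l = INR (length l) * c.
Proof.
  induction l as [|x l IH]; [unfold sumf; simpl; lra|].
  rewrite sumf_cons, IH. change (length (x :: l)) with (S (length l)). rewrite S_INR; lra.
Qed.

Lemma sumf_map {A B} (f : B -> R) (h : A -> B) l : sumf f (map h l) = sumf (fun x => f (h x)) l.
Proof. unfold sumf. now rewrite map_map. Qed.

Lemma sumf_flat_map {A B} (f : B -> R) (h : A -> list B) l :
  sumf f (flat_map h l) = sumf (fun x => sumf f (h x)) l.
Proof. induction l as [|x l IH]; [reflexivity|]. simpl. now rewrite sumf_app, sumf_cons, IH. Qed.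

Lemma sumf_exchange {A B} (f : A -> B -> R) l1 l2 :
  sumf (fun x => sumf (f x) l2) l1 = sumf (fun y => sumf (fun x => f x y) l1) l2.
Proof.
  induction l1 as [|x l1 IH].
  - symmetry. apply sumf_0. reflexivity.
  - rewrite sumf_cons, IH, <- sumf_plus. apply sumf_ext. intros. now rewrite sumf_cons.
Qed.

Lemma sumf_perm {A} (f : A -> R) l l' : Permutation l l' -> sumf f l = sumf f l'.
Proof. induction 1; rewrite ?sumf_cons in *; try lra. Qed.

Lemma sumf_filter {A} (f : A -> R) (b : A -> bool) l :
  sumf f (filter b l) = sumf (fun x => if b x then f x else 0) l.
Proof.
  induction l as [|x l IH]; [reflexivity|]. simpl. rewrite sumf_cons, <- IH.
  destruct (b x); rewrite ?sumf_cons; lra.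
Qed.

Lemma sumf_incl {A} (f : A -> R) l l' :
  NoDup l -> incl l l' -> (forall x, In x l' -> 0 <= f x) -> sumf f l <= sumf f l'.
Proof.
  revert l'. induction l as [|x l IH]; intros l' Hn Hi Hf.
  - now apply sumf_nonneg.
  - inversion_clear Hn as [|? ? Hx Hn'].
    destruct (in_split x l') as [l1 [l2 ->]]; [apply Hi; left; auto|].
    rewrite (sumf_perm f (l1 ++ x :: l2) (x :: l1 ++ l2))
      by (symmetry; apply Permutation_middle).
    rewrite !sumf_cons. apply Rplus_le_compat_l. apply IH; auto.
    + intros y Hy. assert (Hy' : In y (l1 ++ x :: l2)) by (apply Hi; now right).
      apply in_app_or in Hy'. apply in_or_app. destruct Hy' as [|[->|]]; auto. contradiction.
    + intros y Hy. apply Hf. apply in_app_or in Hy. apply in_or_app. simpl. tauto.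
Qed.

Lemma sumf_single {A} (f : A -> R) x l :
  NoDup l -> In x l -> (forall y, In y l -> y <> x -> f y = 0) -> sumf f l = f x.
Proof.
  intros Hn Hx Hf. destruct (in_split x l Hx) as [l1 [l2 ->]].
  rewrite (sumf_perm f _ (x :: l1 ++ l2)) by (symmetry; apply Permutation_middle).
  rewrite sumf_cons, (sumf_0 f (l1 ++ l2)); [lra|].
  intros y Hy. apply Hf; [apply in_app_or in Hy; apply in_or_app; simpl; tauto|].
  intros ->. exact (NoDup_remove_2 _ _ _ Hn Hy).
Qed.

Lemma NoDup_map_inj {A B} (h : A -> B) l :
  NoDup l -> (forall x y, In x l -> In y l -> h x = h y -> x = y) -> NoDup (map h l).
Proof.
  induction l as [|x l IH]; intros Hn Hi; simpl; constructor; inversion_clear Hn.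
  - intros Hin. apply in_map_iff in Hin. destruct Hin as [y [Hy Hy']].
    apply Hi in Hy; simpl; auto. now subst.
  - apply IH; auto. intros; apply Hi; simpl; auto.
Qed.

Lemma sumf_bij {A} (h : A -> A) (f : A -> R) l :
  NoDup l -> (forall x, In x l -> In (h x) l) ->
  (forall x y, In x l -> In y l -> h x = h y -> x = y) ->
  sumf f l = sumf (fun x => f (h x)) l.
Proof.
  intros Hn Hm Hi. rewrite <- (sumf_map f h). apply sumf_perm, Permutation_sym.
  apply NoDup_Permutation_bis; [apply NoDup_map_inj; auto|now rewrite length_map|].
  intros y Hy. apply in_map_iff in Hy. destruct Hy as [x [<- Hx]]; auto.
Qed.

Lemma NoDup_flat_map {A B} (h : A -> list B) l :
  NoDup l -> (forall x, In x l -> NoDup (h x)) ->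
  (forall x y z, In x l -> In y l -> In z (h x) -> In z (h y) -> x = y) ->
  NoDup (flat_map h l).
Proof.
  induction l as [|x l IH]; intros Hn Hh Hd; simpl; [constructor|].
  inversion_clear Hn. apply NoDup_app; auto with datatypes.
  - apply IH; auto with datatypes. intros ? ? ? ? ?; apply Hd; simpl; auto.
  - intros z Hz Hz'. apply in_flat_map in Hz'. destruct Hz' as [y [Hy Hz']].
    rewrite (Hd x y z) in H; simpl; auto.
Qed.

(** * Exchangeable sequences with a given sum *)

Fixpoint comps (N S : nat) : list (list nat) :=
  match N with
  | O => if Nat.eqb S 0 then [[]] else []
  | Datatypes.S N' => flat_map (fun k => map (cons k) (comps N' (S - k))) (seq 0 (Datatypes.S S))
  end.

Lemma in_comps N S d : In d (comps N S) <-> length d = N /\ list_sum d = S.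
Proof.
  revert S d. induction N as [|N IH]; intros S d; cbn [comps].
  - destruct (Nat.eqb_spec S 0) as [->|HS]; destruct d; simpl.
    + tauto.
    + split; [intros [H|[]]; discriminate | intros [H _]; discriminate].
    + split; [intros [] | intros [_ H]; congruence].
    + split; [intros [] | intros [H _]; discriminate].
  - rewrite in_flat_map. split.
    + intros [k [Hk Hd]]. apply in_seq in Hk. apply in_map_iff in Hd.
      destruct Hd as [d' [<- Hd']]. apply IH in Hd'. cbn [length list_sum fold_right].
      unfold list_sum in *. simpl. lia.
    + destruct d as [|k d]; intros [H1 H2]; [discriminate|].
      injection H1 as H1. change (k + list_sum d = S)%nat in H2.
      exists k. split; [apply in_seq; lia|]. apply in_map, IH. lia.
Qed.

Lemma NoDup_comps N S : NoDup (comps N S).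
Proof.
  revert S. induction N as [|N IH]; intros S; cbn [comps].
  - destruct (Nat.eqb S 0); repeat constructor; auto.
  - apply NoDup_flat_map; [apply seq_NoDup| |].
    + intros k _. apply NoDup_map_inj; auto. intros; congruence.
    + intros j k d _ _ Hj Hk. apply in_map_iff in Hj, Hk.
      destruct Hj as [? [<- _]], Hk as [? [Hk _]]. congruence.
Qed.

Definition wprod (w : nat -> R) (d : list nat) : R := fold_right (fun k r => w k * r) 1 d.

Lemma wprod_app w d e : wprod w (d ++ e) = wprod w d * wprod w e.
Proof. induction d as [|k d IH]; simpl; rewrite ?IH; lra. Qed.

Lemma wprod_perm w d e : Permutation d e -> wprod w d = wprod w e.
Proof. induction 1; simpl; nra. Qed.

Lemma wprod_nonneg w d : (forall k, 0 <= w k) -> 0 <= wprod w d.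
Proof. intros H. induction d; simpl; [lra|]. now apply Rmult_le_pos. Qed.

Lemma list_sum_perm d e : Permutation d e -> list_sum d = list_sum e.
Proof. induction 1; simpl; lia. Qed.

(** For [N = n] and [S = n - 1], and up to the normalisation [comp_sum w n (n - 1) (fun _ => 1)],
    this is the expectation of [f] over the exchangeable sequence that the cycle lemma attaches to
    the tree. *)
Definition comp_sum (w : nat -> R) (N S : nat) (f : list nat -> R) : R :=
  sumf (fun d => wprod w d * f d) (comps N S).

Definition symm (f : list nat -> R) : Prop := forall d e, Permutation d e -> f d = f e.

Lemma comp_sum_S w N S f :
  comp_sum w (Datatypes.S N) S f =
  sumf (fun k => w k * comp_sum w N (S - k) (fun d => f (k :: d))) (seq 0 (Datatypes.S S)).
Proof.
  unfold comp_sum. cbn [comps]. rewrite sumf_flat_map. apply sumf_ext. intros k _.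
  rewrite sumf_map, <- sumf_scal. apply sumf_ext. intros d _. simpl. lra.
Qed.

Lemma comp_sum_ext w N S f g :
  (forall d, length d = N -> list_sum d = S -> f d = g d) -> comp_sum w N S f = comp_sum w N S g.
Proof.
  intros H. apply sumf_ext. intros d Hd. apply in_comps in Hd. rewrite H; tauto.
Qed.

Lemma comp_sum_le w N S f g : (forall k, 0 <= w k) ->
  (forall d, length d = N -> list_sum d = S -> f d <= g d) -> comp_sum w N S f <= comp_sum w N S g.
Proof.
  intros Hw H. apply sumf_le. intros d Hd. apply in_comps in Hd.
  apply Rmult_le_compat_l; [now apply wprod_nonneg|]. apply H; tauto.
Qed.

Lemma comp_sum_nonneg w N S f : (forall k, 0 <= w k) ->
  (forall d, length d = N -> list_sum d = S -> 0 <= f d) -> 0 <= comp_sum w N S f.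
Proof.
  intros Hw H. apply sumf_nonneg. intros d Hd. apply in_comps in Hd.
  apply Rmult_le_pos; [now apply wprod_nonneg|]. apply H; tauto.
Qed.

Lemma comp_sum_plus w N S f g : comp_sum w N S (fun d => f d + g d) = comp_sum w N S f + comp_sum w N S g.
Proof. unfold comp_sum. rewrite <- sumf_plus. apply sumf_ext; intros; lra. Qed.

Lemma comp_sum_minus w N S f g : comp_sum w N S (fun d => f d - g d) = comp_sum w N S f - comp_sum w N S g.
Proof. unfold comp_sum. rewrite <- sumf_minus. apply sumf_ext; intros; lra. Qed.

Lemma comp_sum_scal w N S c f : comp_sum w N S (fun d => c * f d) = c * comp_sum w N S f.
Proof. unfold comp_sum. rewrite <- sumf_scal. apply sumf_ext; intros; lra. Qed.

Lemma comp_sum_abs w N S f : (forall k, 0 <= w k) -> Rabs (comp_sum w N S f) <= comp_sum w N S (fun d => Rabs (f d)).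
Proof.
  intros Hw. unfold comp_sum. eapply Rle_trans; [apply sumf_abs|]. right. apply sumf_ext. intros d _.
  rewrite Rabs_mult, (Rabs_pos_eq (wprod w d)); auto. now apply wprod_nonneg.
Qed.

Lemma comp_sum_sumf {A} w N S (f : A -> list nat -> R) l :
  comp_sum w N S (fun d => sumf (fun x => f x d) l) = sumf (fun x => comp_sum w N S (f x)) l.
Proof.
  unfold comp_sum. rewrite sumf_exchange. apply sumf_ext. intros d _. now rewrite <- sumf_scal.
Qed.

(** Moving coordinate [i] to the front keeps weight, length and sum, and for fixed [i] it can be
    undone; hence it permutes the compositions. This is the exchangeability behind [size_bias]. *)
Definition mvfront (i : nat) (d : list nat) : list nat :=
  nth i d O :: firstn i d ++ skipn (S i) d.

Lemma firstn_nth_skipn {A} (x : A) i d : (i < length d)%nat ->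
  d = firstn i d ++ nth i d x :: skipn (S i) d.
Proof.
  revert i. induction d as [|k d IH]; intros [|i] H; simpl in *; try lia; auto.
  f_equal. rewrite (IH i) at 1; auto with arith.
Qed.

Lemma mvfront_perm i d : (i < length d)%nat -> Permutation d (mvfront i d).
Proof.
  intros H. rewrite (firstn_nth_skipn O i d H) at 1. symmetry. apply Permutation_middle.
Qed.

Lemma mvfront_inj i d e : (i < length d)%nat -> length d = length e ->
  mvfront i d = mvfront i e -> d = e.
Proof.
  intros Hi He H. unfold mvfront in H.
  assert (H1 : nth i d O = nth i e O) by congruence.
  assert (H2 : firstn i d ++ skipn (S i) d = firstn i e ++ skipn (S i) e) by congruence.
  clear H.
  assert (Hl : length (firstn i d) = length (firstn i e)) by (rewrite !length_firstn; lia).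
  rewrite (firstn_nth_skipn O i d Hi), (firstn_nth_skipn O i e ltac:(lia)), H1.
  revert H2 Hl. generalize (firstn i d), (firstn i e), (skipn (S i) d), (skipn (S i) e).
  induction l as [|x l IH]; intros [|y l'] u v H Hl; simpl in *; try discriminate.
  - now rewrite H.
  - injection H as -> H. f_equal. apply IH; auto.
Qed.

Lemma comp_sum_mvfront w N S f i : (i < N)%nat -> comp_sum w N S f = comp_sum w N S (fun d => f (mvfront i d)).
Proof.
  intros Hi. unfold comp_sum. rewrite (sumf_bij (mvfront i)).
  - apply sumf_ext. intros d Hd. apply in_comps in Hd.
    rewrite <- (wprod_perm w d (mvfront i d)); auto. apply mvfront_perm; lia.
  - apply NoDup_comps.
  - intros d Hd. apply in_comps in Hd. destruct Hd as [H1 H2]. apply in_comps.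
    assert (P : Permutation d (mvfront i d)) by (apply mvfront_perm; lia).
    rewrite <- (Permutation_length P), <- (list_sum_perm _ _ P). auto.
  - intros d e Hd He. apply in_comps in Hd, He. apply mvfront_inj; lia.
Qed.

Lemma sumf_nth (h : nat -> R) d :
  sumf h d = sumf (fun i => h (nth i d O)) (seq 0 (length d)).
Proof.
  induction d as [|k d IH]; [reflexivity|]. simpl. rewrite !sumf_cons, IH.
  rewrite <- seq_shift, sumf_map. reflexivity.
Qed.

(** By exchangeability each of the [N] coordinates contributes as much as the first one; the
    symmetry of [f] hides the move. *)
Lemma size_bias w N S (h : nat -> R) f : symm f ->
  comp_sum w N S (fun d => sumf h d * f d) = INR N * comp_sum w N S (fun d => h (hd O d) * f d).
Proof.
  intros Hf.
  rewrite (comp_sum_ext w N S _ (fun d => sumf (fun i => h (nth i d O) * f d) (seq 0 N))).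
  - rewrite comp_sum_sumf.
    rewrite (sumf_ext _ (fun _ => comp_sum w N S (fun d => h (hd O d) * f d))).
    + rewrite sumf_const, length_seq; auto.
    + intros i Hi. apply in_seq in Hi.
      rewrite (comp_sum_mvfront w N S (fun d => h (hd O d) * f d) i) by lia.
      apply comp_sum_ext. intros d Hd _. simpl. f_equal. apply Hf, mvfront_perm. lia.
  - intros d Hd _. rewrite sumf_nth, Hd. rewrite Rmult_comm, <- sumf_scal.
    apply sumf_ext; intros; lra.
Qed.

Lemma sumf_INR d : sumf INR d = INR (list_sum d).
Proof. induction d as [|k d IH]; [reflexivity|]. simpl. rewrite sumf_cons, IH, plus_INR. lra. Qed.

(** The total is the constant [S], so it can be taken out of the sum. *)
Lemma size_bias_sum w N S f : symm f ->
  INR S * comp_sum w N S f = INR N * comp_sum w N S (fun d => INR (hd O d) * f d).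
Proof.
  intros Hf. rewrite <- (size_bias w N S INR f Hf), <- comp_sum_scal. apply comp_sum_ext.
  intros d _ Hd. now rewrite sumf_INR, Hd.
Qed.

Definition cnt (a : nat) (d : list nat) : R := sumf (fun k => if Nat.eqb k a then 1 else 0) d.

Lemma cnt_perm a d e : Permutation d e -> cnt a d = cnt a e.
Proof. apply sumf_perm. Qed.

Lemma cnt_bounds a d : 0 <= cnt a d <= INR (length d).
Proof.
  split; [apply sumf_nonneg; intros; destruct (Nat.eqb _ _); lra|].
  rewrite <- (Rmult_1_r (INR _)), <- (sumf_const 1). apply sumf_le.
  intros; destruct (Nat.eqb _ _); lra.
Qed.

(** * Sequences with a prescribed prefix; sampling with and without replacement *)

(** The part of [comp_sum] carried by the sequences that begin with [l]. The guard keeps truncated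
    subtraction from turning an impossible prefix into a spurious term. *)
Definition prew (w : nat -> R) (l : list nat) (N S : nat) (f : list nat -> R) : R :=
  if (Nat.leb (length l) N && Nat.leb (list_sum l) S)%bool
  then wprod w l * comp_sum w (N - length l) (S - list_sum l) (fun d => f (l ++ d)) else 0.

Section Prefix.
Context (w : nat -> R) (Hw : forall k, 0 <= w k).

Lemma pre_nil N S f : prew w [] N S f = comp_sum w N S f.
Proof. unfold prew. simpl. rewrite !Nat.sub_0_r. apply Rmult_1_l. Qed.

Lemma pre_cases l N S f (P : R -> Prop) :
  P 0 -> ((length l <= N)%nat -> (list_sum l <= S)%nat ->
    P (wprod w l * comp_sum w (N - length l) (S - list_sum l) (fun d => f (l ++ d)))) ->
  P (prew w l N S f).
Proof.
  intros H0 H1. unfold prew.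
  destruct (Nat.leb_spec (length l) N), (Nat.leb_spec (list_sum l) S); simpl; auto.
Qed.

Lemma pre_le l N S f g : (forall d, length d = N -> list_sum d = S -> f d <= g d) ->
  prew w l N S f <= prew w l N S g.
Proof.
  intros H. unfold prew.
  destruct (Nat.leb_spec (length l) N), (Nat.leb_spec (list_sum l) S); simpl; try lra.
  apply Rmult_le_compat_l; [now apply wprod_nonneg|]. apply comp_sum_le; auto.
  intros d Hd1 Hd2. apply H; [rewrite length_app; lia|rewrite list_sum_app; lia].
Qed.

Lemma pre_nonneg l N S f : (forall d, length d = N -> 0 <= f d) -> 0 <= prew w l N S f.
Proof.
  intros H. apply pre_cases; [lra|]. intros.
  apply Rmult_le_pos; [now apply wprod_nonneg|]. apply comp_sum_nonneg; auto.
  intros d Hd _. apply H. rewrite length_app; lia.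
Qed.

Lemma pre_ext l N S f g : (forall d, length d = N -> list_sum d = S -> f d = g d) ->
  prew w l N S f = prew w l N S g.
Proof.
  intros H. apply Rle_antisym; apply pre_le; intros; rewrite H; auto; lra.
Qed.

Lemma pre_minus l N S f g : prew w l N S (fun d => f d - g d) = prew w l N S f - prew w l N S g.
Proof. unfold prew. destruct (_ && _)%bool; [rewrite comp_sum_minus|]; lra. Qed.

Lemma pre_scal l N S c f : prew w l N S (fun d => c * f d) = c * prew w l N S f.
Proof. unfold prew. destruct (_ && _)%bool; [rewrite comp_sum_scal|]; lra. Qed.

Lemma pre_abs l N S f : Rabs (prew w l N S f) <= prew w l N S (fun d => Rabs (f d)).
Proof.
  unfold prew. destruct (_ && _)%bool; [|rewrite Rabs_R0; lra].
  rewrite Rabs_mult, Rabs_pos_eq by (now apply wprod_nonneg).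
  apply Rmult_le_compat_l; [now apply wprod_nonneg|]. now apply comp_sum_abs.
Qed.

Lemma pre_perm l l' N S f : symm f -> Permutation l l' -> prew w l N S f = prew w l' N S f.
Proof.
  intros Hf P. unfold prew.
  rewrite (Permutation_length P), (list_sum_perm _ _ P), (wprod_perm w _ _ P).
  destruct (_ && _)%bool; auto. f_equal. apply comp_sum_ext. intros d _ _.
  apply Hf. now apply Permutation_app_tail.
Qed.

(** The factor [INR N] on both sides covers [N = 0], where [hd] of the empty list takes its default
    value [0] and the two sums may differ. *)
Lemma comp_sum_head N S a f :
  comp_sum w N S (fun d => (if Nat.eqb (hd O d) a then 1 else 0) * f d) * INR N =
  prew w [a] N S f * INR N.
Proof.
  destruct N as [|N]; [simpl; lra|]. f_equal. unfold prew. cbn [length list_sum fold_right].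
  rewrite Nat.add_0_r. rewrite comp_sum_S. simpl hd. simpl app. simpl Nat.leb. cbn [andb].
  destruct (Nat.leb_spec a S).
  - rewrite (sumf_single _ a).
    + simpl wprod. rewrite Nat.eqb_refl. simpl. rewrite Nat.sub_0_r, Rmult_1_r.
      f_equal. apply comp_sum_ext. intros; lra.
    + apply seq_NoDup.
    + apply in_seq; lia.
    + intros y _ Hy. apply Nat.eqb_neq in Hy. rewrite Hy, comp_sum_scal. lra.
  - apply sumf_0. intros y Hy. apply in_seq in Hy.
    replace (Nat.eqb y a) with false by (symmetry; apply Nat.eqb_neq; lia). rewrite comp_sum_scal; lra.
Qed.

Lemma pre_pre l a N S f : (length l <= N)%nat -> (list_sum l <= S)%nat ->
  wprod w l * prew w [a] (N - length l) (S - list_sum l) (fun d => f (l ++ d)) =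
  prew w (l ++ [a]) N S f.
Proof.
  intros H1 H2. unfold prew. rewrite length_app, list_sum_app, wprod_app.
  cbn [length list_sum fold_right]. rewrite !Nat.add_0_r.
  destruct (Nat.leb_spec 1 (N - length l)), (Nat.leb_spec a (S - list_sum l)),
    (Nat.leb_spec (length l + 1) N), (Nat.leb_spec (list_sum l + a) S); try lia; simpl; try lra.
  rewrite !Nat.sub_add_distr, <- Rmult_assoc. f_equal.
  apply comp_sum_ext. intros. now rewrite <- app_assoc.
Qed.

Lemma pre_snoc_le l a N S f : (forall d, length d = N -> 0 <= f d) ->
  prew w (l ++ [a]) N S f <= prew w l N S f.
Proof.
  intros Hf. destruct (Nat.leb_spec (length l) N); [destruct (Nat.leb_spec (list_sum l) S)|].
  - rewrite <- pre_pre by auto. unfold prew at 2.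
    destruct (Nat.leb_spec (length l) N), (Nat.leb_spec (list_sum l) S); try lia; simpl andb.
    apply Rmult_le_compat_l; [now apply wprod_nonneg|].
    destruct (N - length l)%nat as [|N'] eqn:HN.
    + unfold prew. simpl. apply comp_sum_nonneg; auto. intros d Hd _. apply Hf. rewrite length_app; lia.
    + apply Rmult_le_reg_r with (INR (Datatypes.S N')); [apply lt_0_INR; lia|].
      rewrite <- comp_sum_head. apply Rmult_le_compat_r; [apply pos_INR|].
      apply comp_sum_le; auto. intros d Hd _.
      assert (0 <= f (l ++ d)) by (apply Hf; rewrite length_app; lia).
      destruct (Nat.eqb _ _); lra.
  - replace (prew w (l ++ [a]) N S f) with 0; [now apply pre_nonneg|].
    unfold prew. rewrite list_sum_app. simpl list_sum.
    destruct (Nat.leb_spec (list_sum l + (a + 0)) S); [lia|]. now rewrite Bool.andb_false_r.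
  - replace (prew w (l ++ [a]) N S f) with 0; [now apply pre_nonneg|].
    unfold prew. rewrite length_app. simpl length.
    destruct (Nat.leb_spec (length l + 1) N); [lia|]. reflexivity.
Qed.

(** Occurrences of [a] inside the prefix are known; each of the other [N - length l] coordinates is
    exchangeable and may be taken as the next one. *)
Lemma pre_cnt l a N S f : symm f ->
  prew w l N S (fun d => cnt a d * f d) =
  cnt a l * prew w l N S f + (INR N - INR (length l)) * prew w (l ++ [a]) N S f.
Proof.
  intros Hf. destruct (Nat.leb_spec (length l) N); [destruct (Nat.leb_spec (list_sum l) S)|].
  - rewrite <- pre_pre, <- minus_INR by auto. unfold prew at 1 2.
    destruct (Nat.leb_spec (length l) N), (Nat.leb_spec (list_sum l) S); try lia; simpl andb.
    cbn [andb].
    rewrite (comp_sum_ext w _ _ _ (fun d => cnt a l * f (l ++ d) + cnt a d * f (l ++ d))).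
    2: { intros. unfold cnt. rewrite sumf_app. lra. }
    rewrite comp_sum_plus, comp_sum_scal. unfold cnt at 2. rewrite size_bias.
    + rewrite (Rmult_comm (INR _)), comp_sum_head. lra.
    + intros d e P. apply Hf. now apply Permutation_app_head.
  - unfold prew. rewrite list_sum_app. simpl list_sum.
    destruct (Nat.leb_spec (list_sum l) S); [lia|].
    destruct (Nat.leb_spec (list_sum l + (a + 0)) S); [lia|]. rewrite !Bool.andb_false_r. lra.
  - unfold prew. rewrite length_app. simpl length.
    destruct (Nat.leb_spec (length l) N); [lia|].
    destruct (Nat.leb_spec (length l + 1) N); [lia|]. simpl. lra.
Qed.

(** Probability that independent uniform draws with replacement from the entries of [d] produce [l],
    when [length d = N]. *)
Definition prodf (N : nat) (l d : list nat) : R :=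
  fold_right (fun a r => cnt a d / INR N * r) 1 l.

Lemma prodf_symm N l : symm (prodf N l).
Proof.
  intros d e P. induction l as [|a l IH]; simpl; [reflexivity|].
  now rewrite IH, (cnt_perm a _ _ P).
Qed.

Lemma freq_bounds N a d : (0 < N)%nat -> length d = N -> 0 <= cnt a d / INR N <= 1.
Proof.
  intros HN Hd. pose proof (cnt_bounds a d) as H. rewrite Hd in H.
  apply lt_0_INR in HN. split.
  - apply Rmult_le_pos; [tauto|]. left. now apply Rinv_0_lt_compat.
  - apply Rmult_le_reg_r with (INR N); auto. unfold Rdiv.
    rewrite Rmult_assoc, Rinv_l; lra.
Qed.

Lemma prodf_bounds N l d : (0 < N)%nat -> length d = N -> 0 <= prodf N l d <= 1.
Proof.
  intros HN Hd. induction l as [|a l IH]; simpl; [lra|].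
  pose proof (freq_bounds N a d HN Hd). nra.
Qed.

(** Sampling coordinates without and with replacement differ by [O(1/N)]. *)
Lemma sampling l : forall b N S f, (0 < N)%nat -> symm f ->
  (forall d, length d = N -> 0 <= f d <= 1) ->
  Rabs (prew w (b ++ l) N S f - prew w b N S (fun d => prodf N l d * f d)) <=
  INR ((length b + length l) * length l) / INR N * prew w b N S (fun _ => 1).
Proof.
  (* [b] is general because each draw moves one value from [l] to the prefix. *)
  induction l as [|a l IH]; intros b N S f HN Hf Hb.
  - rewrite app_nil_r, Nat.mul_0_r. simpl.
    rewrite (pre_ext b N S (fun d => 1 * f d) f) by (intros; lra).
    rewrite Rminus_diag, Rabs_R0. lra.
  - change (a :: l) with ([a] ++ l). rewrite app_assoc. simpl app.
    assert (HN' : 0 < INR N) by (now apply lt_0_INR).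
    specialize (IH (b ++ [a]) N S f HN Hf Hb).
    set (g := fun d => prodf N l d * f d) in *.
    assert (Hg : symm g).
    { intros d e P. unfold g. now rewrite (prodf_symm N l d e P), (Hf d e P). }
    assert (Hgb : forall d, length d = N -> 0 <= g d <= 1).
    { intros d Hd. unfold g. pose proof (prodf_bounds N l d HN Hd). specialize (Hb d Hd). nra. }
    assert (E1 : prew w b N S (fun d => prodf N (a :: l) d * f d) =
      / INR N * prew w b N S (fun d => cnt a d * g d)).
    { rewrite <- pre_scal. apply pre_ext. intros. unfold g. simpl. unfold Rdiv. ring. }
    rewrite E1, pre_cnt by auto.
    pose proof (pre_snoc_le b a N S g (fun d Hd => proj1 (Hgb d Hd))) as H1.
    pose proof (pre_nonneg (b ++ [a]) N S g (fun d Hd => proj1 (Hgb d Hd))) as H2.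
    assert (H3 : prew w b N S g <= prew w b N S (fun _ => 1))
      by (apply pre_le; intros; apply Hgb; auto).
    pose proof (pre_snoc_le b a N S (fun _ => 1) (fun d Hd => Rle_0_1)) as H4.
    pose proof (pre_nonneg (b ++ [a]) N S (fun _ => 1) (fun d Hd => Rle_0_1)) as H4'.
    pose proof (cnt_bounds a b) as H5.
    rewrite length_app in IH. simpl length in *.
    set (X := prew w ((b ++ [a]) ++ l) N S f) in *.
    set (Y := prew w (b ++ [a]) N S g) in *.
    set (Z := prew w b N S g) in *.
    set (T := prew w b N S (fun _ => 1)) in *.
    set (T' := prew w (b ++ [a]) N S (fun _ => 1)) in *.
    (* The first difference is the induction hypothesis. The second is the cost of one draw: the
       matches inside [b], and the [length b] coordinates that are no longer available. *)
    replace (X - / INR N * (cnt a b * Z + (INR N - INR (length b)) * Y)) with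
      ((X - Y) + / INR N * (INR (length b) * Y - cnt a b * Z)) by (field; lra).
    eapply Rle_trans; [apply Rabs_triang|].
    assert (H6 : Rabs (/ INR N * (INR (length b) * Y - cnt a b * Z)) <= INR (length b) / INR N * T).
    { rewrite Rabs_mult, Rabs_pos_eq by (left; now apply Rinv_0_lt_compat).
      replace (INR (length b) / INR N * T) with (/ INR N * (INR (length b) * T))
        by (unfold Rdiv; ring).
      apply Rmult_le_compat_l; [left; now apply Rinv_0_lt_compat|].
      apply Rabs_le. split; nra. }
    assert (H7 : INR ((length b + 1 + length l) * length l) / INR N * T' <=
                 INR ((length b + 1 + length l) * length l) / INR N * T).
    { apply Rmult_le_compat_l; auto. apply Rmult_le_pos; [apply pos_INR|].
      left; now apply Rinv_0_lt_compat. }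
    (* The bound is shaped so that each draw uses up the length of the prefix plus the number of
       values still to be drawn, the present one included. *)
    assert (H8 : INR ((length b + Datatypes.S (length l)) * Datatypes.S (length l)) / INR N * T =
       INR ((length b + 1 + length l) * length l) / INR N * T
       + INR (length b + 1 + length l) / INR N * T).
    { replace ((length b + Datatypes.S (length l)) * Datatypes.S (length l))%nat with
       ((length b + 1 + length l) * length l + (length b + 1 + length l))%nat by lia.
      rewrite plus_INR. unfold Rdiv. ring. }
    assert (H9 : INR (length b) / INR N * T <= INR (length b + 1 + length l) / INR N * T).
    { apply Rmult_le_compat_r; [lra|]. apply Rmult_le_compat_r;
      [left; now apply Rinv_0_lt_compat|]. apply le_INR; lia. }
    lra.
Qed.

End Prefix.

(** * Plane trees and forests *)

Lemma tree_nested_ind (P : tree -> Prop) :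
  (forall ts, Forall P ts -> P (Node ts)) -> forall t, P t.
Proof.
  intros H. fix IH 1. intros [ts]. apply H.
  induction ts as [|t ts IHts]; constructor; [apply IH|apply IHts].
Qed.

(** Named copy of the local fixpoint of [verts]; the starting index is a parameter so that induction
    on the list of children is possible. *)
Fixpoint fverts (j : nat) (fs : list tree) : list (list nat) :=
  match fs with
  | [] => []
  | c :: r => map (cons j) (verts c) ++ fverts (S j) r
  end.

Lemma verts_Node ts : verts (Node ts) = [] :: fverts O ts.
Proof.
  reflexivity.
Qed.

Definition tsize (t : tree) : nat := length (verts t).
Definition fsize (fs : list tree) : nat := list_sum (map tsize fs).

Lemma tsize_Node ts : tsize (Node ts) = S (fsize ts).
Proof.
  unfold tsize. rewrite verts_Node. simpl. f_equal. generalize O. unfold fsize.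
  induction ts as [|t ts IH]; intros j; simpl; [reflexivity|].
  rewrite length_app, length_map, IH. reflexivity.
Qed.

Lemma fsize_app f1 f2 : fsize (f1 ++ f2) = (fsize f1 + fsize f2)%nat.
Proof. unfold fsize. now rewrite map_app, list_sum_app. Qed.

Lemma fsize_cons t fs : fsize (t :: fs) = (tsize t + fsize fs)%nat.
Proof. reflexivity. Qed.

Lemma tsize_pos t : (0 < tsize t)%nat.
Proof. destruct t. rewrite tsize_Node. lia. Qed.

Lemma length_le_fsize fs : (length fs <= fsize fs)%nat.
Proof.
  induction fs as [|t fs IH]; [auto|]. rewrite fsize_cons. pose proof (tsize_pos t). simpl; lia.
Qed.

Lemma subtree_app t a b :
  subtree t (a ++ b) = match subtree t a with Some s => subtree s b | None => None end.
Proof.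
  revert t. induction a as [|j a IH]; intros [ts]; [reflexivity|].
  simpl. destruct (nth_error ts j); auto.
Qed.

Lemma in_fverts j fs a : In a (fverts j fs) <->
  exists i c b, a = (j + i)%nat :: b /\ nth_error fs i = Some c /\ In b (verts c).
Proof.
  revert j. induction fs as [|t fs IH]; intros j; simpl.
  - split; [tauto|]. intros [[|i] [c [b [_ [H _]]]]]; discriminate.
  - rewrite in_app_iff, in_map_iff, IH. split.
    + intros [[b [<- Hb]]|[i [c [b [-> [H1 H2]]]]]].
      * exists O, t, b. rewrite Nat.add_0_r. auto.
      * exists (S i), c, b. rewrite <- Nat.add_succ_comm. auto.
    + intros [[|i] [c [b [-> [H1 H2]]]]].
      * injection H1 as ->. left. exists b. rewrite Nat.add_0_r. auto.
      * right. exists i, c, b. rewrite <- Nat.add_succ_comm. auto.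
Qed.

Lemma in_verts t a : In a (verts t) <-> subtree t a <> None.
Proof.
  revert a. induction t as [ts IH] using tree_nested_ind. intros a.
  rewrite verts_Node. simpl In. rewrite in_fverts. destruct a as [|j a]; simpl.
  - split; [discriminate|auto].
  - split.
    + intros [H|[i [c [b [H1 [H2 H3]]]]]]; [discriminate|]. injection H1 as -> ->.
      rewrite H2. rewrite Forall_forall in IH. apply IH; auto. now apply nth_error_In in H2.
    + destruct (nth_error ts j) as [c|] eqn:Hc; [|tauto]. intros H. right.
      exists j, c, a. repeat split; auto. rewrite Forall_forall in IH.
      apply IH; auto. now apply nth_error_In in Hc.
Qed.

Lemma NoDup_verts t : NoDup (verts t).
Proof.
  induction t as [ts IH] using tree_nested_ind. rewrite verts_Node. constructor.
  - rewrite in_fverts. intros [i [c [b [H _]]]]. discriminate.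
  - generalize O. induction ts as [|t ts IHts]; intros j; simpl; [constructor|].
    inversion_clear IH. apply NoDup_app.
    + apply NoDup_map_inj; auto. intros; congruence.
    + now apply IHts.
    + intros a Ha Hb. apply in_map_iff in Ha. destruct Ha as [b [<- _]].
      apply in_fverts in Hb. destruct Hb as [i [c [b' [Hb _]]]]. injection Hb. lia.
Qed.

Definition degs (t : tree) : list nat := map (deg t) (verts t).
Definition fdegs (fs : list tree) : list nat := flat_map degs fs.

(** The siblings [l] already passed stay in the tree, because an address counts positions among all
    children. *)
Lemma map_deg_fverts l ts j : (j = length l)%nat ->
  map (deg (Node (l ++ ts))) (fverts j ts) = fdegs ts.
Proof.
  revert l j. induction ts as [|t ts IH]; intros l j ->; [reflexivity|].
  simpl. rewrite map_app. unfold fdegs; simpl. f_equal.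
  - rewrite map_map. apply map_ext. intros a. unfold deg. simpl.
    rewrite nth_error_app2, Nat.sub_diag; auto.
  - replace (l ++ t :: ts) with ((l ++ [t]) ++ ts) by (now rewrite <- app_assoc).
    apply IH. rewrite length_app. simpl. lia.
Qed.

Lemma degs_Node ts : degs (Node ts) = length ts :: fdegs ts.
Proof.
  unfold degs. rewrite verts_Node. simpl. f_equal. exact (map_deg_fverts [] ts O eq_refl).
Qed.

Definition fweight (w : nat -> R) (fs : list tree) : R :=
  fold_right (fun t r => tweight w t * r) 1 fs.

Lemma tweight_Node w ts : tweight w (Node ts) = w (length ts) * fweight w ts.
Proof.
  reflexivity.
Qed.

Lemma fweight_app w f1 f2 : fweight w (f1 ++ f2) = fweight w f1 * fweight w f2.
Proof. induction f1 as [|t f1 IH]; simpl; rewrite ?IH; lra. Qed.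

Lemma tweight_nonneg w t : (forall k, 0 <= w k) -> 0 <= tweight w t.
Proof.
  intros Hw. induction t as [ts IH] using tree_nested_ind. rewrite tweight_Node.
  apply Rmult_le_pos; auto. induction IH; simpl; [lra|]. now apply Rmult_le_pos.
Qed.

(** Inverse of deleting the first root and putting its children in front of the remaining trees, as
    in the depth-first coding of forests. *)
Definition graft (k : nat) (fs : list tree) : list tree := Node (firstn k fs) :: skipn k fs.

(** Forests of [l] trees with [N] vertices: removing the first root, of degree [k], from such a
    forest with [l+1] trees leaves [l+k] trees. *)
Fixpoint forests (N l : nat) : list (list tree) :=
  match N, l with
  | O, O => [[]]
  | O, S _ => []
  | S _, O => []
  | S N', S l' => flat_map (fun k => map (graft k) (forests N' (l' + k))) (seq 0 (S N'))
  end.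

Lemma in_forests N l fs : In fs (forests N l) <-> length fs = l /\ fsize fs = N.
Proof.
  revert l fs. induction N as [|N IH]; intros [|l] fs; cbn [forests].
  - split; [intros [<-|[]]; auto|]. destruct fs; simpl; [auto|]. intros []; discriminate.
  - split; [intros []|]. intros [H1 H2]. pose proof (length_le_fsize fs). lia.
  - split; [intros []|]. intros [H1 H2]. destruct fs; discriminate.
  - rewrite in_flat_map. split.
    + intros [k [Hk H]]. apply in_map_iff in H. destruct H as [gs [<- H]].
      apply IH in H. destruct H as [H1 H2]. unfold graft. rewrite fsize_cons, tsize_Node.
      simpl length. rewrite length_skipn. split; [lia|].
      rewrite <- (firstn_skipn k gs), fsize_app in H2. lia.
    + intros [H1 H2]. destruct fs as [|[ts] fs]; [discriminate|].
      rewrite fsize_cons, tsize_Node in H2. simpl in H1.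
      exists (length ts). pose proof (length_le_fsize ts). split; [apply in_seq; lia|].
      apply in_map_iff. exists (ts ++ fs). split.
      * unfold graft. rewrite firstn_app, Nat.sub_diag, firstn_all, skipn_app, Nat.sub_diag, skipn_all.
        simpl. now rewrite app_nil_r.
      * apply IH. rewrite length_app, fsize_app. lia.
Qed.

Lemma NoDup_forests N l : NoDup (forests N l).
Proof.
  revert l. induction N as [|N IH]; intros [|l]; cbn [forests]; try (repeat constructor; auto; fail).
  apply NoDup_flat_map; [apply seq_NoDup| |].
  - intros k _. apply NoDup_map_inj; auto. intros fs gs _ _ H. unfold graft in H.
    injection H as H1 H2. now rewrite <- (firstn_skipn k fs), H1, H2, firstn_skipn.
  - intros j k fs _ _ Hj Hk. apply in_map_iff in Hj, Hk.
    destruct Hj as [f1 [<- Hj]], Hk as [f2 [Hk Hk']].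
    apply in_forests in Hj, Hk'. unfold graft in Hk. injection Hk as H1 H2.
    apply (f_equal (@length _)) in H1. rewrite !length_firstn in H1. lia.
Qed.

Lemma fdegs_graft k fs : (k <= length fs)%nat -> fdegs (graft k fs) = k :: fdegs fs.
Proof.
  intros H. unfold graft. change (fdegs (Node (firstn k fs) :: skipn k fs)) with
    (degs (Node (firstn k fs)) ++ fdegs (skipn k fs)).
  rewrite degs_Node, length_firstn, Nat.min_l by auto.
  simpl. f_equal. unfold fdegs. now rewrite <- flat_map_app, firstn_skipn.
Qed.

Lemma fweight_graft w k fs : (k <= length fs)%nat -> fweight w (graft k fs) = w k * fweight w fs.
Proof.
  intros H. unfold graft. cbn [fweight fold_right]. rewrite tweight_Node, length_firstn, Nat.min_l by auto.
  fold (fweight w (skipn k fs)). now rewrite Rmult_assoc, <- fweight_app, firstn_skipn.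
Qed.

Definition forest_sum (w : nat -> R) (N l : nat) (h : list tree -> R) : R :=
  sumf (fun fs => fweight w fs * h fs) (forests N l).

Lemma forest_sum_S w N l h :
  forest_sum w (S N) (S l) h =
  sumf (fun k => w k * forest_sum w N (l + k) (fun fs => h (graft k fs))) (seq 0 (S N)).
Proof.
  unfold forest_sum. cbn [forests]. rewrite sumf_flat_map. apply sumf_ext. intros k _.
  rewrite sumf_map, <- sumf_scal. apply sumf_ext. intros fs Hfs. apply in_forests in Hfs.
  rewrite fweight_graft by lia. lra.
Qed.

Lemma forest_sum_ext w N l h h' :
  (forall fs, length fs = l -> fsize fs = N -> h fs = h' fs) -> forest_sum w N l h = forest_sum w N l h'.
Proof.
  intros H. apply sumf_ext. intros fs Hfs. apply in_forests in Hfs. rewrite H; tauto.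
Qed.

Lemma forest_sum_plus w N l h h' : forest_sum w N l (fun fs => h fs + h' fs) = forest_sum w N l h + forest_sum w N l h'.
Proof. unfold forest_sum. rewrite <- sumf_plus. apply sumf_ext; intros; lra. Qed.

Lemma forest_sum_gt w N l h : (N < l)%nat -> forest_sum w N l h = 0.
Proof.
  intros H. apply sumf_0. intros fs Hfs. apply in_forests in Hfs.
  pose proof (length_le_fsize fs). lia.
Qed.

Lemma seq_split a n m : (m <= n)%nat -> seq a n = seq a m ++ seq (a + m) (n - m).
Proof. intros H. rewrite <- seq_app. f_equal. lia. Qed.

Lemma sumf_seq_cut f a n m : (m <= n)%nat ->
  (forall k, (a + m <= k < a + n)%nat -> f k = 0) -> sumf f (seq a n) = sumf f (seq a m).
Proof.
  intros H H0. rewrite (seq_split a n m H), sumf_app, (sumf_0 f (seq (a + m) _)); [lra|].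
  intros k Hk. apply in_seq in Hk. apply H0. lia.
Qed.

(** The inductive step of the cycle lemma: a root of degree [k] turns [l+1] trees into [l+k]. *)
Lemma comp_sum_shift w N l f : (l <= N)%nat -> symm f ->
  sumf (fun k => w k * (INR (l + k) * comp_sum w N (N - l - k) (fun d => f (k :: d))))
    (seq 0 (S (N - l))) * INR (S N) = INR (S l) * INR N * comp_sum w (S N) (N - l) f.
Proof.
  intros Hl Hf.
  assert (E : sumf (fun k => w k * (INR (l + k) * comp_sum w N (N - l - k) (fun d => f (k :: d))))
    (seq 0 (S (N - l))) = INR l * comp_sum w (S N) (N - l) f
      + comp_sum w (S N) (N - l) (fun d => INR (hd O d) * f d)).
  { rewrite !comp_sum_S, <- sumf_scal, <- sumf_plus. apply sumf_ext. intros k _.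
    simpl hd. rewrite comp_sum_scal, plus_INR. ring. }
  pose proof (size_bias_sum w (S N) (N - l) f Hf) as H.
  rewrite E, Rmult_plus_distr_r, (Rmult_comm _ (INR (S N))), (Rmult_comm _ (INR (S N))).
  rewrite <- H. rewrite minus_INR, !S_INR by auto. ring.
Qed.

(** Proved by deleting the first root instead of rotating sequences: [comp_sum_shift] is the
    recursion that the factor [l / N] satisfies. Symmetry of [f] matters because only the multiset
    of degrees is compared. *)
Lemma cycle_lemma w N : forall l f, symm f ->
  INR N * forest_sum w N l (fun fs => f (fdegs fs)) =
  if Nat.leb l N then INR l * comp_sum w N (N - l) f else 0.
Proof.
  induction N as [|N IH]; intros l f Hf.
  - destruct l; simpl; lra.
  - destruct (Nat.leb_spec l (S N)) as [Hl|Hl]; [|rewrite forest_sum_gt; auto; lra].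
    destruct l as [|l]; [change (INR (S N) * 0 = 0 * comp_sum w (S N) (S N - 0) f); ring|]. simpl minus.
    rewrite forest_sum_S.
    rewrite (sumf_ext _ (fun k => w k * forest_sum w N (l + k) (fun fs => f (k :: fdegs fs)))).
    2: { intros k _. f_equal. apply forest_sum_ext. intros fs H _. rewrite fdegs_graft; auto. lia. }
    rewrite (sumf_seq_cut _ 0 (S N) (S (N - l))) by
      (lia || (intros k Hk; rewrite forest_sum_gt by lia; lra)).
    destruct N as [|N].
    (* A single vertex is treated directly: the induction hypothesis for zero vertices has the
       factor [INR 0] and says nothing. *)
    + assert (l = O) by lia; subst. unfold forest_sum, comp_sum, sumf. simpl. lra.
    + apply Rmult_eq_reg_l with (INR (S N)); [|apply not_0_INR; lia].
      transitivity (INR (S (S N)) * sumf (fun k => w k * (INR (S N) *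
         forest_sum w (S N) (l + k) (fun fs => f (k :: fdegs fs)))) (seq 0 (S (S N - l)))).
      * rewrite (Rmult_comm (INR (S N))), Rmult_assoc. f_equal.
        rewrite Rmult_comm, <- sumf_scal. apply sumf_ext. intros; ring.
      * rewrite (sumf_ext _ (fun k => w k * (INR (l + k) * comp_sum w (S N) (S N - l - k)
           (fun d => f (k :: d))))).
        { rewrite Rmult_comm, comp_sum_shift by (auto; lia). ring. }
        intros k Hk. apply in_seq in Hk. f_equal.
        rewrite (IH (l + k)%nat (fun d => f (k :: d))).
        { destruct (Nat.leb_spec (l + k) (S N)); [|lia]. now rewrite Nat.sub_add_distr. }
        intros d e P. apply Hf. now constructor.
Qed.

(** * The trees of size n *)

Lemma in_words {A} (L : list A) b u :
  In u (words b L) <-> (length u <= b)%nat /\ Forall (fun x => In x L) u.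
Proof.
  revert u. induction b as [|b IH]; intros u; simpl.
  - destruct u; simpl; split; intros H; auto; [destruct H as [H|[]]; discriminate|lia].
  - rewrite in_flat_map. split.
    + intros [<-|[x [Hx H]]]; [split; [simpl; lia|constructor]|].
      apply in_map_iff in H. destruct H as [v [<- H]]. apply IH in H.
      simpl. split; [lia|]. constructor; tauto.
    + intros [H1 H2]. destruct u as [|x u]; [auto|]. right. inversion_clear H2.
      exists x. split; auto. apply in_map, IH. simpl in H1. split; [lia|auto].
Qed.

Lemma NoDup_words {A} (L : list A) b : NoDup L -> NoDup (words b L).
Proof.
  intros HL. induction b as [|b IH]; simpl; [repeat constructor; auto|]. constructor.
  - intros H. apply in_flat_map in H. destruct H as [x [_ H]]. apply in_map_iff in H.
    destruct H as [v [H _]]. discriminate.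
  - apply NoDup_flat_map; auto.
    + intros x _. apply NoDup_map_inj; auto. intros; congruence.
    + intros x y z _ _ Hx Hy. apply in_map_iff in Hx, Hy.
      destruct Hx as [u [<- _]], Hy as [v [Hy _]]. congruence.
Qed.

Lemma NoDup_bounded h b : NoDup (Defs.bounded h b).
Proof.
  induction h as [|h IH]; simpl; [repeat constructor; auto|].
  apply NoDup_map_inj; [now apply NoDup_words|]. intros; congruence.
Qed.

Lemma in_bounded h b t : (tsize t <= S h)%nat -> (tsize t <= S b)%nat -> In t (Defs.bounded h b).
Proof.
  revert t. induction h as [|h IH]; intros [ts] H1 H2; rewrite tsize_Node in *; simpl.
  - destruct ts; auto. exfalso. pose proof (tsize_pos t). rewrite fsize_cons in H1. lia.
  - apply in_map, in_words. pose proof (length_le_fsize ts). split; [lia|].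
    apply Forall_forall. intros t Ht. apply in_split in Ht. destruct Ht as [l1 [l2 ->]].
    rewrite fsize_app, fsize_cons in *. apply IH; lia.
Qed.

Lemma in_trees_n n t : In t (trees_n n) <-> tsize t = n.
Proof.
  unfold trees_n. rewrite filter_In, Nat.eqb_eq. split; [tauto|].
  intros <-. split; auto. apply in_bounded; lia.
Qed.

Lemma trees_forests n : Permutation (map (fun t => [t]) (trees_n n)) (forests n 1).
Proof.
  apply NoDup_Permutation.
  - apply NoDup_map_inj; [apply NoDup_filter, NoDup_bounded|]. intros; congruence.
  - apply NoDup_forests.
  - intros fs. rewrite in_map_iff, in_forests. split.
    + intros [t [<- H]]. apply in_trees_n in H. rewrite fsize_cons, H. simpl.
      unfold fsize; simpl. lia.
    + destruct fs as [|t [|]]; simpl; intros [H1 H2]; try discriminate.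
      exists t. split; auto. apply in_trees_n. rewrite fsize_cons in H2.
      unfold fsize in H2; simpl in H2. lia.
Qed.

Lemma sumf_trees w n h :
  sumf (fun t => tweight w t * h t) (trees_n n) =
  forest_sum w n 1 (fun fs => h (hd (Node []) fs)).
Proof.
  unfold forest_sum. rewrite <- (sumf_perm _ _ _ (trees_forests n)), sumf_map.
  apply sumf_ext. intros t _. simpl. lra.
Qed.

Lemma sumf_trees_symm w n f : symm f -> (0 < n)%nat ->
  INR n * sumf (fun t => tweight w t * f (degs t)) (trees_n n) = comp_sum w n (n - 1) f.
Proof.
  intros Hf Hn. rewrite (sumf_trees w n (fun t => f (degs t))).
  rewrite (forest_sum_ext w n 1 _ (fun fs => f (fdegs fs))).
  - rewrite cycle_lemma by auto. destruct (Nat.leb_spec 1 n); [|lia]. simpl; lra.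
  - intros [|t [|]]; intros H _; try discriminate. unfold fdegs. simpl. now rewrite app_nil_r.
Qed.

(** * Counting occurrences of a pattern *)

Definition indic (b : bool) : R := if b then 1 else 0.

Lemma indic_bounds b : 0 <= indic b <= 1.
Proof. destruct b; simpl; lra. Qed.

(** [Any] is an unconstrained subtree; [PN ps] prescribes the outdegree [length ps]. *)
Inductive pat : Type := Any : pat | PN : list pat -> pat.

Lemma pat_nested_ind (Q : pat -> Prop) :
  Q Any -> (forall ps, Forall Q ps -> Q (PN ps)) -> forall p, Q p.
Proof.
  intros H0 H. fix IH 1. intros [|ps]; [exact H0|]. apply H.
  induction ps as [|p ps IHps]; constructor; [apply IH|apply IHps].
Qed.

Fixpoint pm (P : pat) (t : tree) : bool :=
  match P with
  | Any => true
  | PN ps => match t with Node ts =>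
      (fix go (ps : list pat) (ts : list tree) : bool :=
        match ps, ts with
        | [], [] => true
        | p :: ps', c :: ts' => (pm p c && go ps' ts')%bool
        | _, _ => false
        end) ps ts end
  end.

Fixpoint fpm (ps : list pat) (ts : list tree) : bool :=
  match ps, ts with
  | [], [] => true
  | p :: ps', c :: ts' => (pm p c && fpm ps' ts')%bool
  | _, _ => false
  end.

Lemma pm_PN ps ts : pm (PN ps) (Node ts) = fpm ps ts.
Proof. reflexivity. Qed.

Lemma fpm_length ps ts : fpm ps ts = true -> length ps = length ts.
Proof.
  revert ts. induction ps as [|p ps IH]; intros [|t ts]; simpl; try discriminate; auto.
  intros H. apply andb_prop in H. f_equal. now apply IH.
Qed.

Lemma fpm_app ps qs ts us : length ps = length ts ->
  fpm (ps ++ qs) (ts ++ us) = (fpm ps ts && fpm qs us)%bool.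
Proof.
  revert ts. induction ps as [|p ps IH]; intros [|t ts] H; simpl in *; try discriminate; auto.
  rewrite IH by lia. now rewrite Bool.andb_assoc.
Qed.

Lemma fpm_repeat ts : fpm (repeat Any (length ts)) ts = true.
Proof. induction ts; simpl; auto. Qed.

Fixpoint pdegs (P : pat) : list nat :=
  match P with Any => [] | PN ps => length ps :: flat_map pdegs ps end.

Fixpoint pdang (P : pat) : nat :=
  match P with Any => 1%nat | PN ps => list_sum (map pdang ps) end.

(** Measure for the induction in [forest_sum_match]. It counts [Any] as well, since rotating an
    unconstrained tree to the end must also decrease it. *)
Fixpoint psize (P : pat) : nat :=
  match P with Any => 1%nat | PN ps => S (list_sum (map psize ps)) end.

(** Every node of the pattern, constrained or not, is a child of a constrained node, except the
    root. *)
Lemma pdegs_pdang P : (length (pdegs P) + pdang P = 1 + list_sum (pdegs P))%nat.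
Proof.
  induction P as [|ps IH] using pat_nested_ind; [reflexivity|].
  cbn [pdegs pdang length]. change (list_sum (length ps :: flat_map pdegs ps)) with
    (length ps + list_sum (flat_map pdegs ps))%nat.
  enough (length (flat_map pdegs ps) + list_sum (map pdang ps) =
    length ps + list_sum (flat_map pdegs ps))%nat by lia.
  induction IH as [|p ps Hp _ IHps]; [reflexivity|]. simpl.
  rewrite length_app, list_sum_app. unfold list_sum in *. simpl in *. lia.
Qed.

Lemma forest_sum_rot w N l h :
  forest_sum w N (S l) h = forest_sum w N (S l) (fun fs => h (tl fs ++ [hd (Node []) fs])).
Proof.
  unfold forest_sum. rewrite (sumf_bij (fun fs => tl fs ++ [hd (Node []) fs])).
  - apply sumf_ext. intros fs Hfs. apply in_forests in Hfs. destruct fs as [|t fs]; [easy|].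
    simpl tl. simpl hd. f_equal. rewrite fweight_app. simpl. lra.
  - apply NoDup_forests.
  - intros fs Hfs. apply in_forests in Hfs. apply in_forests. destruct fs as [|t fs]; [easy|].
    simpl tl. simpl hd. rewrite length_app, fsize_app, !fsize_cons in *. simpl in *.
    unfold fsize at 2. simpl. lia.
  - intros fs gs Hf Hg. apply in_forests in Hf, Hg.
    destruct fs as [|t fs], gs as [|u gs]; try easy. simpl. intros H.
    apply app_inj_tail in H. destruct H; congruence.
Qed.

(** Unconstrained subtrees are rotated to the end until only constrained roots are in front. *)
Lemma forest_sum_match w m : forall Ps j N, (list_sum (map psize Ps) <= m)%nat ->
  forest_sum w N (length Ps + j) (fun fs => indic (fpm (Ps ++ repeat Any j) fs)) =
  if Nat.leb (length (flat_map pdegs Ps)) N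
  then wprod w (flat_map pdegs Ps) *
    forest_sum w (N - length (flat_map pdegs Ps)) (list_sum (map pdang Ps) + j) (fun _ => 1)
  else 0.
Proof.
  induction m as [|m IH]; intros Ps j N Hm.
  all: destruct Ps as [|[|qs] Ps].
  1, 4: simpl; rewrite Nat.sub_0_r, Rmult_1_l; apply forest_sum_ext; intros fs <- _;
    now rewrite fpm_repeat.
  1, 2: simpl in Hm; lia.
  - assert (E : forest_sum w N (length (Any :: Ps) + j)
      (fun fs => indic (fpm ((Any :: Ps) ++ repeat Any j) fs)) =
      forest_sum w N (length Ps + S j) (fun fs => indic (fpm (Ps ++ repeat Any (S j)) fs))).
    { simpl length. rewrite Nat.add_succ_r. simpl plus. symmetry. rewrite forest_sum_rot.
      apply forest_sum_ext. intros [|t fs] Hl _; [easy|]. simpl in Hl. simpl tl. simpl hd.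
      change (repeat Any (S j)) with (Any :: repeat Any j). rewrite repeat_cons, app_assoc.
      rewrite fpm_app by (rewrite length_app, repeat_length; lia).
      simpl. now rewrite Bool.andb_true_r. }
    rewrite E, IH by (simpl in Hm; lia). simpl. now rewrite Nat.add_succ_r.
  - simpl length. simpl plus. cbn [map list_sum fold_right psize] in Hm.
    change (fold_right Nat.add 0%nat (map psize Ps)) with (list_sum (map psize Ps)) in Hm.
    destruct N as [|N]; [reflexivity|]. rewrite forest_sum_S.
    transitivity (w (length qs) * forest_sum w N (length (qs ++ Ps) + j)
      (fun fs => indic (fpm ((qs ++ Ps) ++ repeat Any j) fs))).
    (* Once the first root is deleted, its child patterns [qs] and the later patterns [Ps] form one
       list again; only root degree [length qs] survives. *)
    + assert (E : forall k, forest_sum w N (length Ps + j + k)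
        (fun fs => indic (fpm (PN qs :: Ps ++ repeat Any j) (graft k fs))) =
        if Nat.eqb k (length qs) then forest_sum w N (length (qs ++ Ps) + j)
          (fun fs => indic (fpm ((qs ++ Ps) ++ repeat Any j) fs)) else 0).
      { intros k. destruct (Nat.eqb_spec k (length qs)) as [->|Hk].
        - rewrite length_app. replace (length qs + length Ps + j)%nat with
            (length Ps + j + length qs)%nat by lia.
          apply forest_sum_ext. intros fs Hl _. unfold graft. cbn [fpm]. rewrite pm_PN.
          rewrite <- (firstn_skipn (length qs) fs) at 3. rewrite <- app_assoc.
          rewrite (fpm_app qs) by (rewrite length_firstn; lia). reflexivity.
        - rewrite (forest_sum_ext w N _ _ (fun _ => 0)).
          + apply sumf_0. intros; lra.
          + intros fs Hl _. unfold graft. cbn [fpm]. rewrite pm_PN.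
            destruct (fpm qs (firstn k fs)) eqn:H; [|reflexivity].
            apply fpm_length in H. rewrite length_firstn in H. lia. }
      rewrite (sumf_ext _ (fun k => w k * (if Nat.eqb k (length qs) then
        forest_sum w N (length (qs ++ Ps) + j)
          (fun fs => indic (fpm ((qs ++ Ps) ++ repeat Any j) fs)) else 0)))
        by (intros; now rewrite E).
      destruct (Nat.leb_spec (length qs) N).
      * rewrite (sumf_single _ (length qs)).
        -- now rewrite Nat.eqb_refl.
        -- apply seq_NoDup.
        -- apply in_seq; lia.
        -- intros y _ Hy. apply Nat.eqb_neq in Hy. rewrite Hy. lra.
      * rewrite sumf_0, forest_sum_gt; [lra|rewrite length_app; lia|].
        intros y Hy. apply in_seq in Hy.
        replace (Nat.eqb y (length qs)) with false by (symmetry; apply Nat.eqb_neq; lia). lra.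
    + rewrite IH by (rewrite map_app, list_sum_app; lia).
      rewrite flat_map_app, map_app, list_sum_app.
      change (flat_map pdegs (PN qs :: Ps)) with (length qs :: flat_map pdegs qs ++ flat_map pdegs Ps).
      change (list_sum (map pdang (PN qs :: Ps))) with
        (list_sum (map pdang qs) + list_sum (map pdang Ps))%nat.
      cbn [length Nat.leb wprod fold_right Nat.sub]. fold (wprod w (flat_map pdegs qs ++ flat_map pdegs Ps)).
      destruct (Nat.leb _ _); lra.
Qed.

Definition pm_at (P : pat) (t : tree) (a : list nat) : bool :=
  match subtree t a with Some s => pm P s | None => false end.

Definition occ (P : pat) (t : tree) : R := sumf (fun a => indic (pm_at P t a)) (verts t).

Lemma occ_fverts P l ts j : (j = length l)%nat ->
  sumf (fun a => indic (pm_at P (Node (l ++ ts)) a)) (fverts j ts) = sumf (occ P) ts.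
Proof.
  revert l j. induction ts as [|t ts IH]; intros l j ->; [reflexivity|].
  simpl. rewrite sumf_app, sumf_cons. f_equal.
  - rewrite sumf_map. apply sumf_ext. intros a _. unfold pm_at. simpl.
    rewrite nth_error_app2, Nat.sub_diag; auto.
  - replace (l ++ t :: ts) with ((l ++ [t]) ++ ts) by (now rewrite <- app_assoc).
    apply IH. rewrite length_app. simpl. lia.
Qed.

Lemma occ_Node P ts : occ P (Node ts) = indic (pm P (Node ts)) + sumf (occ P) ts.
Proof.
  unfold occ at 1. rewrite verts_Node, sumf_cons. f_equal. exact (occ_fverts P [] ts O eq_refl).
Qed.

Lemma occ_graft P k fs :
  sumf (occ P) (graft k fs) = indic (pm P (Node (firstn k fs))) + sumf (occ P) fs.
Proof.
  unfold graft. rewrite sumf_cons, occ_Node. 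
  replace (sumf (occ P) fs) with (sumf (occ P) (firstn k fs) + sumf (occ P) (skipn k fs))
    by (now rewrite <- sumf_app, firstn_skipn). lra.
Qed.

(** The cycle lemma gives a factor [l / N] per vertex and there are [N] vertices, so no [N] remains.
    The induction separates an occurrence at the first root from those in the forest left after its
    deletion. *)
Lemma occ_forests w qs N : forall l,
  forest_sum w N l (sumf (occ (PN qs))) =
  if Nat.leb l N then INR l * prew w (pdegs (PN qs)) N (N - l) (fun _ => 1) else 0.
Proof.
  pose proof (pdegs_pdang (PN qs)) as Hd.
  set (P := PN qs) in *.
  assert (Hs : (1 <= length (pdegs P))%nat) by (simpl; lia).
  induction N as [|N IH]; intros l.
  - destruct l; simpl; [|reflexivity]. unfold forest_sum, sumf; simpl; lra.
  - destruct (Nat.leb_spec l (S N)) as [Hl|Hl]; [|rewrite forest_sum_gt; auto; lra].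
    destruct l as [|l]; [change (0 = 0 * prew w (pdegs P) (S N) (S N - 0) (fun _ => 1)); ring|].
    simpl minus.
    assert (E : forest_sum w (S N) (S l) (sumf (occ P)) =
      forest_sum w (S N) (S l) (fun fs => indic (fpm ([P] ++ repeat Any l) fs)) +
      sumf (fun k => w k * forest_sum w N (l + k) (sumf (occ P))) (seq 0 (S N))).
    { rewrite !forest_sum_S, <- sumf_plus. apply sumf_ext. intros k Hk.
      rewrite <- Rmult_plus_distr_l, <- forest_sum_plus. f_equal. apply forest_sum_ext. intros fs Hfs _.
      rewrite occ_graft. unfold graft. f_equal. simpl app. cbn [fpm].
      assert (HR : fpm (repeat Any l) (skipn k fs) = true).
      { replace l with (length (skipn k fs)) by (rewrite length_skipn; lia). apply fpm_repeat. }
      now rewrite HR, Bool.andb_true_r. }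
    rewrite E. clear E.
    change (forest_sum w (S N) (S l)) with (forest_sum w (S N) (length [P] + l)).
    rewrite (forest_sum_match w (psize P) [P] l (S N)) by (simpl; lia).
    rewrite (sumf_seq_cut _ 0 (S N) (S (N - l))) by
      (lia || (intros k Hk; rewrite forest_sum_gt by lia; lra)).
    rewrite (sumf_ext _ (fun k => w k * (INR (l + k) * prew w (pdegs P) N (N - l - k) (fun _ => 1)))).
    2: { intros k Hk. apply in_seq in Hk. rewrite IH.
         destruct (Nat.leb_spec (l + k) N); [|lia]. now rewrite Nat.sub_add_distr. }
    cbn [flat_map map list_sum fold_right]. rewrite app_nil_r, Nat.add_0_r.
    set (ll := pdegs P) in *. set (L := pdang P) in *.
    destruct (Nat.leb_spec (length ll) (S N)) as [H1|H1].
    2: { rewrite sumf_0.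
         - unfold prew. destruct (Nat.leb_spec (length ll) (S N)); [lia|]. simpl; lra.
         - intros k _. unfold prew. destruct (Nat.leb_spec (length ll) N); [lia|]. simpl; lra. }
    (* The pattern uses all vertices: nothing is left outside it, and the cycle lemma for zero
       vertices would give no information. *)
    destruct (Nat.eq_dec (length ll) (S N)) as [H2|H2].
    { rewrite sumf_0.
      2: { intros k _. unfold prew. destruct (Nat.leb_spec (length ll) N); [lia|]. simpl; lra. }
      unfold prew. rewrite H2, Nat.leb_refl, Nat.sub_diag. cbn [andb].
      destruct (Nat.leb_spec (list_sum ll) (N - l)).
      - assert (L = O /\ l = O) as [HL Hl0] by lia. subst l. rewrite HL.
        replace (N - 0 - list_sum ll)%nat with O by lia.
        unfold forest_sum, comp_sum, sumf. simpl. lra.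
      - replace (forest_sum w 0 (L + l) (fun _ => 1)) with 0; [lra|].
        symmetry. apply forest_sum_gt. lia. }
    destruct (S N - length ll)%nat as [|n'] eqn:Hn; [lia|].
    pose proof (cycle_lemma w (S n') (L + l) (fun _ => 1) (fun _ _ _ => eq_refl)) as HC.
    destruct (Nat.leb_spec (list_sum ll) (N - l)) as [H3|H3].
    + destruct (Nat.leb_spec (L + l) (S n')); [|lia].
      set (T := (N - l - list_sum ll)%nat).
      replace (S n' - (L + l))%nat with T in HC by lia.
      assert (E : sumf (fun k => w k * (INR (l + k) * prew w ll N (N - l - k) (fun _ => 1)))
          (seq 0 (S (N - l))) = wprod w ll * (INR l * comp_sum w (S n') T (fun _ => 1)
            + comp_sum w (S n') T (fun d => INR (hd O d) * 1))).
      { rewrite (sumf_seq_cut _ 0 (S (N - l)) (S T)).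
        - rewrite !comp_sum_S, <- sumf_scal, <- sumf_plus, <- sumf_scal. apply sumf_ext.
          intros k Hk. apply in_seq in Hk. simpl hd. rewrite comp_sum_scal, plus_INR.
          unfold prew. destruct (Nat.leb_spec (length ll) N), (Nat.leb_spec (list_sum ll) (N - l - k));
            try lia. cbn [andb]. replace (N - length ll)%nat with n' by lia.
          replace (N - l - k - list_sum ll)%nat with (T - k)%nat by lia. ring.
        - lia.
        - intros k Hk. unfold prew. destruct (Nat.leb_spec (list_sum ll) (N - l - k)); [lia|].
          rewrite Bool.andb_false_r. lra. }
      rewrite E.
      pose proof (size_bias_sum w (S n') T (fun _ => 1) (fun _ _ _ => eq_refl)) as HB.
      unfold prew. destruct (Nat.leb_spec (length ll) (S N)), (Nat.leb_spec (list_sum ll) (N - l));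
        try lia. cbn [andb]. rewrite Hn. fold T.
      set (B := comp_sum w (S n') T (fun _ => 1)) in *.
      change (comp_sum w (S n') T (fun d => 1)) with B in HB.
      apply Rmult_eq_reg_l with (INR (S n')); [|apply not_0_INR; lia].
      (* Outside the pattern there remain [S n'] vertices with [T] edges in [L + l] trees; this
         count merges the occurrence at the first root with the others. *)
      assert (HT : INR (L + l) + INR T = INR (S n')).
      { rewrite <- plus_INR. f_equal. lia. }
      transitivity (wprod w ll * (INR (S n') * forest_sum w (S n') (L + l) (fun _ => 1)
         + INR (S n') * INR l * B + INR (S n') * comp_sum w (S n') T (fun d => INR (hd O d) * 1))); [ring|].
      rewrite HC, <- HB. rewrite (S_INR l).
      replace (INR (S n') * ((INR l + 1) * (wprod w ll * B))) with
        (wprod w ll * (INR (S n') * INR l * B + (INR (L + l) + INR T) * B)) by (rewrite HT; ring).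
      ring.
    + rewrite sumf_0.
      2: { intros k _. unfold prew. destruct (Nat.leb_spec (list_sum ll) (N - l - k)); [lia|].
           rewrite Bool.andb_false_r. lra. }
      rewrite (forest_sum_gt w (S n')) by lia.
      unfold prew. destruct (Nat.leb_spec (list_sum ll) (N - l)); [lia|].
      rewrite Bool.andb_false_r. lra.
Qed.

Lemma occ_trees w qs n : (0 < n)%nat ->
  sumf (fun t => tweight w t * occ (PN qs) t) (trees_n n) =
  prew w (pdegs (PN qs)) n (n - 1) (fun _ => 1).
Proof.
  intros Hn. rewrite sumf_trees.
  rewrite (forest_sum_ext w n 1 _ (sumf (occ (PN qs)))).
  - rewrite occ_forests. destruct (Nat.leb_spec 1 n); [|lia]. simpl INR. lra.
  - intros [|t [|]] H _; try discriminate. unfold sumf. simpl. lra.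
Qed.

(** Deleting the root leaves [k] trees on [n - 1] vertices, and the factor [k / (n - 1)] of the
    cycle lemma is the size biasing of the root degree. *)
Lemma root_degree w n k : (2 <= n)%nat ->
  INR (n - 1) * sumf (fun t => tweight w t * indic (Nat.eqb (deg t []) k)) (trees_n n) =
  INR k * prew w [k] n (n - 1) (fun _ => 1).
Proof.
  intros Hn. rewrite sumf_trees. destruct n as [|n]; [lia|]. rewrite forest_sum_S.
  simpl minus. rewrite Nat.sub_0_r.
  assert (E : forall j, (j <= n)%nat -> forest_sum w n (0 + j)
     (fun fs => indic (Nat.eqb (deg (hd (Node []) (graft j fs)) []) k)) =
     if Nat.eqb j k then forest_sum w n k (fun _ => 1) else 0).
  { intros j Hj. simpl plus.
    rewrite (forest_sum_ext w n j _ (fun _ => indic (Nat.eqb j k))).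
    - destruct (Nat.eqb_spec j k) as [->|]; simpl; [reflexivity|].
      apply sumf_0. intros; lra.
    - intros fs Hl _. unfold graft, deg. simpl. now rewrite length_firstn, Nat.min_l by lia. }
  rewrite (sumf_ext _ (fun j => w j * (if Nat.eqb j k then forest_sum w n k (fun _ => 1) else 0))).
  2: { intros j Hj. apply in_seq in Hj. rewrite E by lia. reflexivity. }
  unfold prew. cbn [length list_sum fold_right]. rewrite Nat.add_0_r. simpl Nat.leb. cbn [andb].
  destruct (Nat.leb_spec k n).
  - rewrite (sumf_single _ k).
    + rewrite Nat.eqb_refl. pose proof (cycle_lemma w n k (fun _ => 1) (fun _ _ _ => eq_refl)) as HC.
      destruct (Nat.leb_spec k n); [|lia]. simpl minus. rewrite Nat.sub_0_r. simpl wprod.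
      rewrite (Rmult_comm (w k)), <- Rmult_assoc, HC. ring.
    + apply seq_NoDup.
    + apply in_seq; lia.
    + intros y _ Hy. apply Nat.eqb_neq in Hy. rewrite Hy. lra.
  - rewrite sumf_0; [lra|]. intros y Hy. apply in_seq in Hy.
    replace (Nat.eqb y k) with false by (symmetry; apply Nat.eqb_neq; lia). lra.
Qed.

(** * Pinning down the empirical degree distribution *)

Lemma Rabs_le_inv a b : Rabs a <= b -> - b <= a <= b.
Proof. intros H. pose proof (Rle_abs a). pose proof (Rle_abs (- a)). rewrite Rabs_Ropp in *. lra. Qed.

(** * Partial sums, series and powers *)

Definition psum (f : nat -> R) (K : nat) : R := sumf f (seq 0 (S K)).

Lemma psum_S f K : psum f (S K) = psum f K + f (S K).
Proof. unfold psum. rewrite (seq_S (S K)), sumf_app, sumf_cons. unfold sumf at 2. simpl. lra. Qed.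

Lemma psum_0 f : psum f 0 = f O.
Proof. unfold psum, sumf. simpl. lra. Qed.

Lemma sum_f_R0_psum f K : sum_f_R0 f K = psum f K.
Proof. induction K; simpl; [now rewrite psum_0|]. now rewrite psum_S, IHK. Qed.

Lemma psum_le f g K : (forall k, (k <= K)%nat -> f k <= g k) -> psum f K <= psum g K.
Proof. intros H. apply sumf_le. intros k Hk. apply in_seq in Hk. apply H. lia. Qed.

Lemma psum_mono f K K' : (forall k, (0 < k)%nat -> 0 <= f k) -> (K <= K')%nat ->
  psum f K <= psum f K'.
Proof.
  intros H. induction 1 as [|m _ IH]; [lra|]. rewrite psum_S.
  specialize (H (S m) ltac:(lia)). lra.
Qed.

Lemma psum_close f g K d : (forall k, (k <= K)%nat -> Rabs (f k - g k) <= d) ->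
  Rabs (psum f K - psum g K) <= INR (S K) * d.
Proof.
  intros H. unfold psum. rewrite <- sumf_minus. eapply Rle_trans; [apply sumf_abs|].
  rewrite <- (length_seq (S K) 0) at 2. rewrite <- sumf_const. apply sumf_le.
  intros k Hk. apply in_seq in Hk. apply H. lia.
Qed.

Lemma infinite_sum_le_bound f l C : infinite_sum f l -> (forall K, psum f K <= C) -> l <= C.
Proof.
  intros H HC. apply Rnot_lt_le. intros Hlt. destruct (H (l - C)) as [N HN]; [lra|].
  specialize (HN N (Nat.le_refl N)). rewrite sum_f_R0_psum in HN. specialize (HC N).
  unfold Rdist in HN. apply Rabs_def2 in HN. lra.
Qed.

(** The sign condition starts after [K], because series with the factor [INR k - mu] may have a
    negative first term. *)
Lemma psum_le_infinite f l K : (forall k, (K < k)%nat -> 0 <= f k) -> infinite_sum f l -> psum f K <= l.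
Proof.
  intros Hf H. apply Rnot_lt_le. intros Hlt. destruct (H (psum f K - l)) as [N HN]; [lra|].
  specialize (HN (N + K)%nat ltac:(lia)). rewrite sum_f_R0_psum in HN.
  assert (psum f K <= psum f (N + K)).
  { clear HN. induction N; simpl; [lra|]. rewrite psum_S.
    specialize (Hf (S (N + K)) ltac:(lia)). lra. }
  unfold Rdist in HN. apply Rabs_def2 in HN. lra.
Qed.

Lemma infinite_sum_tail f l e : 0 < e -> infinite_sum f l ->
  exists K0, forall K, (K0 <= K)%nat -> Rabs (psum f K - l) < e.
Proof.
  intros He H. destruct (H e He) as [N HN]. exists N. intros K HK.
  rewrite <- sum_f_R0_psum. now apply HN.
Qed.

Lemma infinite_sum_bounded f C : (forall k, 0 <= f k) -> (forall K, psum f K <= C) ->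
  exists l, infinite_sum f l.
Proof.
  intros Hf HC. destruct (growing_cv (sum_f_R0 f)) as [l Hl].
  - intros n. rewrite !sum_f_R0_psum, psum_S. specialize (Hf (S n)). lra.
  - exists C. intros x [n ->]. rewrite sum_f_R0_psum. apply HC.
  - exists l. intros e He. destruct (Hl e He) as [N HN]. exists N. apply HN.
Qed.

Lemma infinite_sum_ext f g l : (forall k, f k = g k) -> infinite_sum f l -> infinite_sum g l.
Proof.
  intros H Hf e He. destruct (Hf e He) as [N HN]. exists N. intros n Hn.
  rewrite <- (sum_eq f g); auto.
Qed.

Lemma infinite_sum_scal c f l : infinite_sum f l -> infinite_sum (fun k => c * f k) (c * l).
Proof.
  intros Hf e He. destruct (Req_dec c 0) as [->|Hc].
  - exists O. intros n _. rewrite sum_f_R0_psum. unfold psum. rewrite sumf_scal.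
    unfold Rdist. rewrite !Rmult_0_l, Rminus_diag, Rabs_R0. lra.
  - assert (Hc' : 0 < Rabs c) by now apply Rabs_pos_lt.
    destruct (Hf (e / Rabs c)) as [N HN]; [now apply Rdiv_lt_0_compat|].
    exists N. intros n Hn. specialize (HN n Hn). rewrite sum_f_R0_psum in *.
    unfold psum in *. rewrite sumf_scal. unfold Rdist in *.
    rewrite <- Rmult_minus_distr_l, Rabs_mult.
    apply Rmult_lt_compat_l with (r := Rabs c) in HN; auto.
    replace (Rabs c * (e / Rabs c)) with e in HN by (field; lra). exact HN.
Qed.

Lemma pow_root m y : (0 < m)%nat -> 0 <= y -> exists x, 0 <= x /\ x ^ m = y.
Proof.
  intros Hm Hy. destruct (Req_dec y 0) as [->|Hy0].
  - exists 0. split; [lra|]. apply pow_i. lia.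
  - exists (Rpower y (/ INR m)). split; [left; apply exp_pos|].
    rewrite <- Rpower_pow by apply exp_pos. rewrite Rpower_mult, Rinv_l, Rpower_1; auto; [lra|].
    apply not_0_INR. lia.
Qed.

Lemma pow_strict_incr k x y : (0 < k)%nat -> 0 <= x < y -> x ^ k < y ^ k.
Proof.
  intros Hk Hxy. induction k as [|[|k] IH]; [lia|simpl; lra|].
  specialize (IH ltac:(lia)). change (x * x ^ S k < y * y ^ S k).
  apply Rmult_le_0_lt_compat; try lra. apply pow_le; lra.
Qed.

(** Superadditivity of [x ^ m] on nonnegative reals; it turns closeness of [m]-th powers into
    closeness of the bases. *)
Lemma pow_diff_abs m a b : 0 <= a -> 0 <= b -> (0 < m)%nat -> Rabs (a - b) ^ m <= Rabs (a ^ m - b ^ m).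
Proof.
  intros Ha Hb Hm.
  assert (H : forall x y, 0 <= x -> 0 <= y -> (x + y) ^ m >= x ^ m + y ^ m).
  { intros x y Hx Hy. destruct m as [|m]; [lia|]. clear Hm. induction m as [|m IH]; [simpl; lra|].
    change ((x + y) ^ S (S m)) with ((x + y) * (x + y) ^ S m).
    change (x ^ S (S m)) with (x * x ^ S m). change (y ^ S (S m)) with (y * y ^ S m).
    pose proof (pow_le x (S m) Hx). pose proof (pow_le y (S m) Hy). nra. }
  destruct (Rle_dec a b) as [Hab|Hab].
  - rewrite Rabs_left1, Rabs_left1 by (pose proof (pow_incr a b m); lra).
    specialize (H a (b - a) Ha ltac:(lra)). replace (a + (b - a)) with b in H by ring.
    replace (- (a - b)) with (b - a) by ring. lra.
  - rewrite Rabs_pos_eq, Rabs_pos_eq by (pose proof (pow_incr b a m); lra).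
    specialize (H b (a - b) Hb ltac:(lra)). replace (b + (a - b)) with a in H by ring. lra.
Qed.

Lemma pow_continuous k t e : 0 < e -> exists d, 0 < d /\
  forall x, Rabs (x - t) <= d -> Rabs (x ^ k - t ^ k) <= e.
Proof.
  intros He.
  assert (C : continuity_pt (fun x => x ^ k) t)
    by (apply derivable_continuous_pt, derivable_pt_pow).
  destruct (C e He) as [d [Hd H]]. exists (d / 2). split; [lra|].
  intros x Hx. destruct (Req_dec x t) as [->|Hn].
  - rewrite Rminus_diag, Rabs_R0. lra.
  - left. apply (H x). split; [split; [exact I|auto]|]. simpl. unfold Rdist. lra.
Qed.

Lemma poly_continuous (w : nat -> R) K t e : 0 < e -> exists d, 0 < d /\
  forall x, Rabs (x - t) <= d ->
    Rabs (psum (fun k => w k * x ^ k) K - psum (fun k => w k * t ^ k) K) <= e.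
Proof.
  revert e. induction K as [|K IH]; intros e He.
  - exists 1. split; [lra|]. intros x _. rewrite !psum_0. simpl. rewrite Rminus_diag, Rabs_R0. lra.
  - destruct (IH (e / 2)) as [d1 [Hd1 H1]]; [lra|].
    destruct (pow_continuous (S K) t (e / 2 / (Rabs (w (S K)) + 1))) as [d2 [Hd2 H2]].
    { pose proof (Rabs_pos (w (S K))). apply Rdiv_lt_0_compat; lra. }
    exists (Rmin d1 d2). split; [now apply Rmin_pos|]. intros x Hx.
    pose proof (Rmin_l d1 d2). pose proof (Rmin_r d1 d2).
    specialize (H1 x ltac:(lra)). specialize (H2 x ltac:(lra)). rewrite !psum_S.
    set (A := psum (fun k => w k * x ^ k) K) in *. set (B := psum (fun k => w k * t ^ k) K) in *.
    replace (A + w (S K) * x ^ S K - (B + w (S K) * t ^ S K)) with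
      ((A - B) + w (S K) * (x ^ S K - t ^ S K)) by ring.
    eapply Rle_trans; [apply Rabs_triang|]. rewrite Rabs_mult.
    assert (Rabs (w (S K)) * Rabs (x ^ S K - t ^ S K) <= e / 2); [|lra].
    pose proof (Rabs_pos (w (S K))).
    apply Rle_trans with (Rabs (w (S K)) * (e / 2 / (Rabs (w (S K)) + 1))).
    + now apply Rmult_le_compat_l.
    + apply Rmult_le_reg_r with (Rabs (w (S K)) + 1); [lra|]. field_simplify; [|lra]. nra.
Qed.

(** * Determination of the tilt *)

Section Pin.
Context (w : nat -> R) (tau mu Phi : R) (m : nat).
Context (Hw : forall k, 0 <= w k) (Hw0 : 0 < w O) (Hm : (0 < m)%nat) (Hwm : 0 < w m).
Context (Htau : 0 <= tau) (Hmu : 0 <= mu < 1).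
Context (HPhi : infinite_sum (fun k => w k * tau ^ k) Phi).
Context (Hmean : infinite_sum (fun k => INR k * (w k * tau ^ k)) (mu * Phi)).
Context (Hdiv : forall t C, tau < t -> exists K, C < psum (fun k => w k * t ^ k) K).

Lemma Phi_pos : 0 < Phi.
Proof.
  apply Rlt_le_trans with (psum (fun k => w k * tau ^ k) 0); [rewrite psum_0; simpl; lra|].
  apply psum_le_infinite; auto. intros. apply Rmult_le_pos; auto. now apply pow_le.
Qed.

(** The full series vanishes, and since [mu < 1] only its first term can be negative; so every
    partial sum lies below the limit [0]. *)
Lemma shifted_nonpos K : psum (fun k => (INR k - mu) * (w k * tau ^ k)) K <= 0.
Proof.
  apply psum_le_infinite.
  - intros k Hk. apply Rmult_le_pos; [|apply Rmult_le_pos; auto; now apply pow_le].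
    assert (1 <= INR k) by (apply (le_INR 1); lia). lra.
  - apply infinite_sum_ext with
      (fun k => INR k * (w k * tau ^ k) + (- mu) * (w k * tau ^ k)); [intros; ring|].
    intros e He. destruct (Hmean (e / 2)) as [N1 H1]; [lra|].
    destruct (infinite_sum_scal (- mu) _ _ HPhi (e / 2)) as [N2 H2]; [lra|].
    exists (N1 + N2)%nat. intros n Hn. rewrite sum_f_R0_psum.
    specialize (H1 n ltac:(lia)). specialize (H2 n ltac:(lia)). rewrite sum_f_R0_psum in *.
    unfold psum, Rdist in *. rewrite sumf_plus. apply Rabs_def2 in H1, H2. apply Rabs_def1; lra.
Qed.

(** Below [tau] no term with [k >= 1] exceeds its value at [tau], and the term [m] alone loses a
    fixed amount. Hence [c] depends neither on [K] nor on [l]. For [tau = 0] the range of [l] is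
    empty. *)
Lemma shifted_gap e : 0 < e -> exists c, 0 < c /\ forall K l, (m <= K)%nat -> 0 <= l < tau - e ->
  psum (fun k => (INR k - mu) * (w k * l ^ k)) K <= - c.
Proof.
  intros He. destruct (Rle_or_lt (tau - e) 0) as [H0|H0].
  { exists 1. split; [lra|]. intros. lra. }
  assert (H1 : 1 <= INR m) by (apply (le_INR 1); lia).
  assert (Hp : (tau - e) ^ m < tau ^ m).
  { apply pow_strict_incr; auto; lra. }
  exists ((INR m - mu) * (w m * (tau ^ m - (tau - e) ^ m))). split.
  { apply Rmult_lt_0_compat; [lra|]. apply Rmult_lt_0_compat; lra. }
  intros K l HK Hl.
  assert (E : psum (fun k => (INR k - mu) * (w k * tau ^ k)) K -
     psum (fun k => (INR k - mu) * (w k * l ^ k)) K >=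
     (INR m - mu) * (w m * (tau ^ m - (tau - e) ^ m))).
  { unfold psum. rewrite <- sumf_minus.
    destruct (in_split m (seq 0 (S K))) as [l1 [l2 Hs]]; [apply in_seq; lia|].
    rewrite Hs, sumf_app, sumf_cons.
    assert (Hpos : forall k, 0 <= (INR k - mu) * (w k * tau ^ k) - (INR k - mu) * (w k * l ^ k)).
    { intros k. replace (_ - _) with ((INR k - mu) * (w k * (tau ^ k - l ^ k))) by ring.
      destruct k as [|k]; [simpl; lra|]. apply Rmult_le_pos.
      - assert (1 <= INR (S k)) by (apply (le_INR 1); lia). lra.
      - apply Rmult_le_pos; auto. assert (l ^ S k <= tau ^ S k) by (apply pow_incr; lra). lra. }
    pose proof (sumf_nonneg _ l1 (fun k _ => Hpos k)).
    pose proof (sumf_nonneg _ l2 (fun k _ => Hpos k)).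
    assert (l ^ m <= (tau - e) ^ m) by (apply pow_incr; lra).
    assert ((INR m - mu) * (w m * (tau ^ m - (tau - e) ^ m)) <=
      (INR m - mu) * (w m * tau ^ m) - (INR m - mu) * (w m * l ^ m)); [|lra].
    replace ((INR m - mu) * (w m * tau ^ m) - (INR m - mu) * (w m * l ^ m)) with
      ((INR m - mu) * (w m * (tau ^ m - l ^ m))) by ring.
    apply Rmult_le_compat_l; [lra|]. apply Rmult_le_compat_l; lra. }
  pose proof (shifted_nonpos K). lra.
Qed.

(** The exchange relation up to [d]. For [p k = a * w k * lam ^ k] both products equal
    [a ^ (m + k) * lam ^ (m * k)]; divisions and roots are avoided by raising to powers. *)
Definition balanced (p : nat -> R) (K : nat) (d : R) : Prop :=
  forall k, (k <= K)%nat -> 0 < w k ->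
  Rabs ((p k / w k) ^ m * (p O / w O) ^ k - (p m / w m) ^ k * (p O / w O) ^ m) <= d.

(** Exact balance forces [p k = a * w k * lam ^ k]: a tilted weight sequence. *)
Lemma balanced_tilt K am d3 : 0 < am <= 1 -> 0 < d3 -> exists d2, 0 < d2 /\
  forall p, (forall k, 0 <= p k) -> (forall k, w k = 0 -> p k = 0) ->
  am <= p O / w O <= / w O -> balanced p K d2 ->
  exists lam, 0 <= lam /\
    forall k, (k <= K)%nat -> Rabs (p k - p O / w O * (w k * lam ^ k)) <= d3.
Proof.
  intros Ham Hd3.
  set (W := psum w K + 1).
  assert (HW : forall k, (k <= K)%nat -> w k < W).
  { intros k Hk. unfold W, psum. destruct (in_split k (seq 0 (S K))) as [l1 [l2 Hs]];
      [apply in_seq; lia|].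
    rewrite Hs, sumf_app, sumf_cons.
    pose proof (sumf_nonneg w l1 (fun k _ => Hw k)).
    pose proof (sumf_nonneg w l2 (fun k _ => Hw k)). lra. }
  assert (HWp : 0 < W) by (specialize (HW O ltac:(lia)); lra).
  (* Makes the final error [/ w O * W * th] equal to [d3]. *)
  set (th := d3 * w O / W).
  assert (Hth : 0 < th) by (apply Rdiv_lt_0_compat; auto; now apply Rmult_lt_0_compat).
  (* [th ^ m] allows an [m]-th root to be taken, and [am ^ (m + K)] is a lower bound for the power
     [(p O / w O) ^ (m + k)] that is divided out. *)
  exists (th ^ m * am ^ (m + K)). split.
  { apply Rmult_lt_0_compat; apply pow_lt; lra. }
  intros p Hp Hp0 Ha Hb. set (a := p O / w O) in *.
  set (q := fun k => p k / w k / a).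
  assert (Hq : forall k, (k <= K)%nat -> 0 < w k -> Rabs (q k ^ m - q m ^ k) <= th ^ m).
  { intros k Hk Hwk. specialize (Hb k Hk Hwk). fold a in Hb.
    assert (Hak : 0 < a ^ (m + k)) by (apply pow_lt; lra).
    replace ((p k / w k) ^ m * a ^ k - (p m / w m) ^ k * a ^ m) with
      (a ^ (m + k) * (q k ^ m - q m ^ k)) in Hb.
    2: { unfold q. replace (p k / w k) with ((p k / w k / a) * a) at 2 by (field; lra).
         replace (p m / w m) with ((p m / w m / a) * a) at 2 by (field; lra).
         rewrite !Rpow_mult_distr, pow_add. ring. }
    rewrite Rabs_mult, (Rabs_pos_eq (a ^ (m + k))) in Hb by lra.
    apply Rmult_le_reg_l with (a ^ (m + k)); auto. eapply Rle_trans; [exact Hb|].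
    rewrite Rmult_comm. apply Rmult_le_compat_r; [apply pow_le; lra|].
    apply Rle_trans with (am ^ (m + k)); [|apply pow_incr; lra].
    replace (m + K)%nat with (m + k + (K - k))%nat by lia. rewrite (pow_add am (m + k)).
    rewrite <- (Rmult_1_r (am ^ (m + k))) at 2.
    apply Rmult_le_compat_l; [apply pow_le; lra|].
    rewrite <- (pow1 (K - k)). apply pow_incr; lra. }
  assert (Hqpos : forall k, 0 < w k -> 0 <= q k).
  { intros k Hk. unfold q. apply Rmult_le_pos; [apply Rmult_le_pos; auto|];
      left; apply Rinv_0_lt_compat; lra. }
  (* For an exact tilt [q k = lam ^ k], so [lam] can only be the [m]-th root of [q m]. *)
  destruct (pow_root m (q m) Hm (Hqpos m Hwm)) as [lam [Hl0 Hl]].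
  exists lam. split; auto. intros k Hk.
  destruct (Hw k) as [Hwk|Hwk].
  - specialize (Hq k Hk Hwk). rewrite <- Hl, <- pow_mult, Nat.mul_comm, pow_mult in Hq.
    pose proof (pow_diff_abs m (q k) (lam ^ k) (Hqpos k Hwk) (pow_le lam k Hl0) Hm) as H.
    assert (Hc : Rabs (q k - lam ^ k) <= th).
    { apply Rnot_lt_le. intros Hlt. apply Rle_not_lt in Hq. apply Hq.
      apply Rlt_le_trans with (Rabs (q k - lam ^ k) ^ m); auto.
      apply pow_strict_incr; auto; lra. }
    replace (p k) with (a * (w k * q k)) by (unfold q; field; lra).
    replace (a * (w k * q k) - a * (w k * lam ^ k)) with (a * w k * (q k - lam ^ k)) by ring.
    rewrite Rabs_mult, Rabs_pos_eq by (apply Rmult_le_pos; lra).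
    apply Rle_trans with (/ w O * W * th).
    + apply Rmult_le_compat; auto; [apply Rmult_le_pos; lra|apply Rabs_pos|].
      specialize (HW k Hk). apply Rmult_le_compat; lra.
    + unfold th. right. field. lra.
  - rewrite <- Hwk, (Hp0 k) by auto. rewrite Rmult_0_l, Rmult_0_r, Rminus_diag, Rabs_R0. lra.
Qed.

(** [d1] and [Ks] come before [K], because the mean is controlled at a window that is enlarged
    afterwards, while [d2] may depend on [K]. The lower bound on [psum p j] is the tightness that
    keeps mass from escaping. *)
Lemma pinning k0 eta : 0 < eta ->
  exists d1 Ks, 0 < d1 /\ forall K, (Ks <= K)%nat -> exists d2, 0 < d2 /\
  forall p, (forall k, 0 <= p k) -> (forall k, w k = 0 -> p k = 0) ->
  (forall j, 1 - / INR (S j) <= psum p j <= 1) ->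
  Rabs (psum (fun k => INR k * p k) K - mu) <= d1 ->
  balanced p K d2 ->
  Rabs (p k0 - w k0 * tau ^ k0 / Phi) <= eta.
Proof.
  intros Heta. pose proof Phi_pos as HP.
  set (aM := / w O). assert (HaM : 0 < aM) by (now apply Rinv_0_lt_compat).
  (* Sum of the coefficients of [h] in the last estimate, so that [eta = D * h]. *)
  set (D := 1 + w k0 * (aM + tau ^ k0 * ((2 + 2 * aM) / Phi))).
  assert (Htk : 0 <= tau ^ k0) by (now apply pow_le).
  assert (HPi : 0 < / Phi) by (now apply Rinv_0_lt_compat).
  assert (HD : 1 <= D).
  { unfold D. specialize (Hw k0). assert (0 <= tau ^ k0 * ((2 + 2 * aM) / Phi)).
    { apply Rmult_le_pos; auto. apply Rmult_le_pos; lra. }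
    assert (0 <= w k0 * (aM + tau ^ k0 * ((2 + 2 * aM) / Phi))); [|lra].
    apply Rmult_le_pos; lra. }
  set (h := eta / D). assert (Hh : 0 < h) by (apply Rdiv_lt_0_compat; lra).
  destruct (infinite_sum_tail _ _ h Hh HPhi) as [K1' HK1'].
  destruct (archimed_cor1 h Hh) as [K1'' [HK1'' HK1''0]].
  set (K1 := (K1' + K1'')%nat).
  destruct (poly_continuous w K1 tau h Hh) as [e1 [He1 Hc1]].
  destruct (pow_continuous k0 tau h Hh) as [e2 [He2 Hc2]].
  set (e := Rmin e1 e2). assert (He : 0 < e) by (now apply Rmin_pos).
  (* Lower bound for [p O / w O]: the mass off [0] is at most the mean, which is near [mu < 1]. *)
  set (am' := (1 - mu) / 2 / w O).
  assert (Ham' : 0 < am') by (apply Rdiv_lt_0_compat; lra).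
  set (am := Rmin am' 1).
  assert (Ham : 0 < am <= 1) by (unfold am; split; [apply Rmin_pos; lra|apply Rmin_r]).
  destruct (shifted_gap e He) as [c [Hc Hgap]].
  (* For [lam] beyond [tau + e] the tilted mass would exceed [2], more than the total mass [1] plus
     the error [kap <= 1]. *)
  destruct (Hdiv (tau + e) (2 / am) ltac:(lra)) as [Ke HKe].
  destruct (archimed_cor1 ((1 - mu) / 4)) as [Kb [HKb HKb0]]; [lra|].
  set (d1 := Rmin ((1 - mu) / 4) (am * c / 4)).
  assert (Hamc : 0 < am * c) by (apply Rmult_lt_0_compat; lra).
  assert (Hd1 : 0 < d1) by (apply Rmin_pos; lra).
  exists d1, (K1 + Ke + Kb + m + k0)%nat. split; auto. intros K HK.
  set (kap := Rmin (Rmin h 1) (am * c / 4)).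
  assert (Hkap : 0 < kap) by (unfold kap; repeat apply Rmin_pos; lra).
  assert (HSK : 1 <= INR (S K)) by (apply (le_INR 1); lia).
  (* One factor [INR (S K)] for the number of terms, one for the coefficients [INR k - mu] in the
     mean. *)
  set (d3 := kap / (INR (S K) * INR (S K))).
  assert (Hd3 : 0 < d3) by (apply Rdiv_lt_0_compat; nra).
  destruct (balanced_tilt K am d3 Ham Hd3) as [d2 [Hd2 Htilt]].
  exists d2. split; auto. intros p Hp Hp0 Htot Hmn Hbal.
  assert (Hd3K : INR (S K) * INR (S K) * d3 = kap) by (unfold d3; field; lra).
  assert (Hk1 : kap <= h) by (unfold kap; eapply Rle_trans; [apply Rmin_l|apply Rmin_l]).
  assert (Hk2 : kap <= 1) by (unfold kap; eapply Rle_trans; [apply Rmin_l|apply Rmin_r]).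
  assert (Hk3 : kap <= am * c / 4) by (unfold kap; apply Rmin_r).
  assert (Hd11 : d1 <= (1 - mu) / 4) by apply Rmin_l.
  assert (Hd12 : d1 <= am * c / 4) by apply Rmin_r.
  apply Rabs_le_inv in Hmn.
  assert (HinvS : forall a b, (0 < a)%nat -> (a <= b)%nat -> / INR (S b) <= / INR a).
  { intros a b H1 H2. apply Rinv_le_contravar; [apply lt_0_INR; lia|apply le_INR; lia]. }
  assert (Hp0lb : (1 - mu) / 2 <= p O).
  { pose proof (HinvS Kb K HKb0 ltac:(lia)). pose proof (Htot K) as [H1 _].
    assert (psum p K - p O <= psum (fun k => INR k * p k) K).
    { clear - Hp. induction K as [|K IH]; [rewrite !psum_0; simpl; lra|].
      rewrite !psum_S. specialize (Hp (S K)).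
      assert (1 <= INR (S K)) by (apply (le_INR 1); lia). nra. }
    lra. }
  assert (Ha : am <= p O / w O <= / w O).
  { split.
    - apply Rle_trans with am'; [apply Rmin_l|]. unfold am'.
      apply Rmult_le_compat_r; [left; exact HaM|]. exact Hp0lb.
    - rewrite <- (Rmult_1_l (/ w O)). apply Rmult_le_compat_r; [left; exact HaM|].
      pose proof (Htot O) as [_ H]. now rewrite psum_0 in H. }
  destruct (Htilt p Hp Hp0 Ha Hbal) as [lam [Hlam Htl]]. fold aM in Ha.
  set (a := p O / w O) in *.
  assert (HclK : forall J, (J <= K)%nat ->
     Rabs (psum p J - a * psum (fun k => w k * lam ^ k) J) <= kap).
  { intros J HJ. unfold psum at 2. rewrite <- sumf_scal. fold (psum (fun k => a * (w k * lam ^ k)) J).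
    eapply Rle_trans; [apply psum_close with (d := d3); intros; apply Htl; lia|].
    rewrite <- Hd3K. apply Rmult_le_compat_r; [lra|].
    assert (INR (S J) <= INR (S K)) by (apply le_INR; lia). nra. }
  assert (Hup : lam <= tau + e).
  { apply Rnot_lt_le. intros Hlt.
    pose proof (HclK K (Nat.le_refl K)) as H. apply Rabs_le_inv in H.
    pose proof (Htot K) as [_ H1].
    assert (H2 : psum (fun k => w k * (tau + e) ^ k) K <= psum (fun k => w k * lam ^ k) K).
    { apply psum_le. intros k _. apply Rmult_le_compat_l; auto. apply pow_incr; lra. }
    assert (H3 : psum (fun k => w k * (tau + e) ^ k) Ke <= psum (fun k => w k * (tau + e) ^ k) K).
    { apply psum_mono; [|lia]. intros. apply Rmult_le_pos; auto. apply pow_le; lra. }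
    assert (H4 : a * (2 / am) < a * psum (fun k => w k * lam ^ k) K)
      by (apply Rmult_lt_compat_l; lra).
    assert (H5 : am * (2 / am) <= a * (2 / am)).
    { apply Rmult_le_compat_r; [|lra]. left. apply Rdiv_lt_0_compat; lra. }
    replace (am * (2 / am)) with 2 in H5 by (field; lra). lra. }
  (* For smaller [lam] the shifted mean of the tilt would be at most [- am * c], while the errors of
     the mean and of the tilt are at most [am * c / 4] each. *)
  assert (Hlo : tau - e <= lam).
  { apply Rnot_lt_le. intros Hlt.
    specialize (Hgap K lam ltac:(lia) ltac:(lra)).
    assert (H1 : Rabs (psum (fun k => (INR k - mu) * p k) K -
       psum (fun k => (INR k - mu) * (a * (w k * lam ^ k))) K) <= INR (S K) * (INR (S K) * d3)).
    { apply psum_close. intros k Hk. rewrite <- Rmult_minus_distr_l, Rabs_mult.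
      apply Rmult_le_compat; auto using Rabs_pos.
      pose proof (pos_INR k). apply le_INR in Hk. rewrite S_INR. apply Rabs_le; lra. }
    assert (H2 : psum (fun k => (INR k - mu) * p k) K >= - d1).
    { assert (E : psum (fun k => (INR k - mu) * p k) K =
        psum (fun k => INR k * p k) K - mu * psum p K).
      { unfold psum. rewrite <- sumf_scal, <- sumf_minus. apply sumf_ext; intros; ring. }
      rewrite E. pose proof (Htot K) as [_ H]. nra. }
    assert (H3 : psum (fun k => (INR k - mu) * (a * (w k * lam ^ k))) K =
      a * psum (fun k => (INR k - mu) * (w k * lam ^ k)) K).
    { unfold psum. rewrite <- sumf_scal. apply sumf_ext; intros; ring. }
    rewrite H3 in H1. rewrite <- Rmult_assoc, Hd3K in H1. apply Rabs_le_inv in H1.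
    assert (a * psum (fun k => (INR k - mu) * (w k * lam ^ k)) K <= a * - c)
      by (apply Rmult_le_compat_l; lra).
    assert (am * c <= a * c) by (apply Rmult_le_compat_r; lra).
    lra. }
  assert (Hle : Rabs (lam - tau) <= e) by (apply Rabs_le; lra).
  assert (e <= e1) by apply Rmin_l. assert (e <= e2) by apply Rmin_r.
  specialize (Hc1 lam ltac:(lra)). specialize (Hc2 lam ltac:(lra)).
  (* Normalisation: the window up to [K1] has mass nearly [1], and the tilted weights on it add up
     to nearly [a * Phi]. *)
  assert (HaPhi : Rabs (a * Phi - 1) <= (2 + 2 * aM) * h).
  { pose proof (HclK K1 ltac:(lia)) as H1. pose proof (Htot K1) as H2.
    pose proof (HinvS K1'' K1 HK1''0 ltac:(lia)) as H3.
    specialize (HK1' K1 ltac:(lia)).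
    set (X := psum (fun k => w k * lam ^ k) K1) in *.
    set (Y := psum (fun k => w k * tau ^ k) K1) in *.
    assert (H4 : Rabs (a * (X - Phi)) <= aM * (2 * h)).
    { rewrite Rabs_mult, (Rabs_pos_eq a) by lra. apply Rmult_le_compat; try lra; [apply Rabs_pos|].
      replace (X - Phi) with ((X - Y) + (Y - Phi)) by ring.
      eapply Rle_trans; [apply Rabs_triang|]. lra. }
    apply Rabs_le_inv in H1, H4. apply Rabs_le. nra. }
  specialize (Htl k0 ltac:(lia)).
  replace (p k0 - w k0 * tau ^ k0 / Phi) with
    ((p k0 - a * (w k0 * lam ^ k0)) + w k0 * (a * (lam ^ k0 - tau ^ k0) +
      tau ^ k0 * ((a * Phi - 1) * / Phi))) by (field; lra).
  eapply Rle_trans; [apply Rabs_triang|]. rewrite Rabs_mult, (Rabs_pos_eq (w k0)) by auto.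
  assert (Hfin : Rabs (a * (lam ^ k0 - tau ^ k0) + tau ^ k0 * ((a * Phi - 1) * / Phi)) <=
    (aM + tau ^ k0 * ((2 + 2 * aM) / Phi)) * h).
  { eapply Rle_trans; [apply Rabs_triang|]. rewrite !Rabs_mult, (Rabs_pos_eq a), (Rabs_pos_eq (tau ^ k0)),
      (Rabs_pos_eq (/ Phi)) by lra.
    rewrite Rmult_plus_distr_r. apply Rplus_le_compat.
    - apply Rmult_le_compat; try lra. apply Rabs_pos.
    - rewrite Rmult_assoc. apply Rmult_le_compat_l; auto.
      unfold Rdiv. rewrite (Rmult_comm (_ * / Phi)), <- (Rmult_assoc h), (Rmult_comm h).
      apply Rmult_le_compat_r; lra. }
  assert (Hd3h : d3 <= h).
  { apply Rle_trans with kap; auto. rewrite <- Hd3K.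
    rewrite <- (Rmult_1_l d3) at 1. apply Rmult_le_compat_r; [lra|nra]. }
  apply Rmult_le_compat_l with (r := w k0) in Hfin; auto.
  assert (Heq : eta = D * h) by (unfold h; field; lra).
  rewrite Heq. unfold D. lra.
Qed.

End Pin.

(** * The offspring law *)

Lemma series_val_eq a l : infinite_sum a l -> series_val a = l.
Proof.
  intros H. apply (uniqueness_sum a); auto. unfold series_val.
  apply epsilon_spec. now exists l.
Qed.

Lemma diverges_unbounded w t C : (forall k, 0 <= w k) -> 0 <= t -> ~ phi_conv w t ->
  exists K, C < psum (fun k => w k * t ^ k) K.
Proof.
  intros Hw Ht Hn. apply NNPP. intros H. apply Hn. apply infinite_sum_bounded with C.
  - intros k. apply Rmult_le_pos; auto. now apply pow_le.
  - intros K. apply Rnot_lt_le. intros Hlt. apply H. now exists K.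
Qed.

(** Convexity of the power function; the factor [t] on both sides avoids the exponent [k - 1]. *)
Lemma pow_secant k t s : 0 <= t <= s -> INR k * t ^ k * (s - t) <= t * (s ^ k - t ^ k).
Proof.
  intros H. induction k as [|k IH]; [simpl; lra|].
  rewrite S_INR. cbn [pow].
  assert (H1 : t ^ k <= s ^ k) by (now apply pow_incr).
  assert (H2 : 0 <= t ^ k) by (apply pow_le; lra).
  replace ((INR k + 1) * (t * t ^ k) * (s - t)) with
    (t * (INR k * t ^ k * (s - t)) + t * (t ^ k * (s - t))) by ring.
  apply Rmult_le_compat_l with (r := t) in IH; [|lra].
  assert (t * (t * (s ^ k - t ^ k)) + t * (t ^ k * (s - t)) <= t * (s * s ^ k - t * t ^ k)); [|lra].
  assert (0 <= t * ((s - t) * (s ^ k - t ^ k))); [|nra].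
  apply Rmult_le_pos; [lra|]. apply Rmult_le_pos; lra.
Qed.

Lemma mean_converges w t s l : (forall k, 0 <= w k) -> 0 <= t < s ->
  infinite_sum (fun k => w k * s ^ k) l -> exists l', infinite_sum (fun k => INR k * w k * t ^ k) l'.
Proof.
  intros Hw Ht Hs. apply infinite_sum_bounded with (t / (s - t) * l).
  - intros k. apply Rmult_le_pos; [apply Rmult_le_pos; auto; apply pos_INR|]. apply pow_le; lra.
  - intros K. apply Rle_trans with (t / (s - t) * psum (fun k => w k * s ^ k) K).
    + unfold psum. rewrite <- sumf_scal. apply sumf_le. intros k _.
      pose proof (pow_secant k t s ltac:(lra)) as H.
      assert (0 <= t ^ k) by (apply pow_le; lra).
      apply Rmult_le_reg_r with (s - t); [lra|].
      replace (t / (s - t) * (w k * s ^ k) * (s - t)) with (w k * (t * s ^ k)) by (field; lra).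
      replace (INR k * w k * t ^ k * (s - t)) with (w k * (INR k * t ^ k * (s - t))) by ring.
      apply Rmult_le_compat_l; auto. nra.
    + apply Rmult_le_compat_l.
      * apply Rmult_le_pos; [lra|]. left. apply Rinv_0_lt_compat. lra.
      * apply psum_le_infinite; auto. intros. apply Rmult_le_pos; auto. apply pow_le; lra.
Qed.

(** Abel's theorem for nonnegative coefficients, from the left; [tau] may be the radius of
    convergence. *)
Lemma abel_monotone a tau A e : (forall k, 0 <= a k) -> 0 <= tau -> 0 < e ->
  infinite_sum (fun k => a k * tau ^ k) A ->
  exists d, 0 < d /\ forall t l, 0 <= t -> tau - d <= t <= tau ->
    infinite_sum (fun k => a k * t ^ k) l -> A - e <= l <= A.
Proof.
  intros Ha Htau He HA. destruct (infinite_sum_tail _ _ (e / 2) ltac:(lra) HA) as [K HK].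
  specialize (HK K (Nat.le_refl K)). destruct (poly_continuous a K tau (e / 2) ltac:(lra)) as [d [Hd Hc]].
  exists d. split; auto. intros t l Ht0 Ht Hl. split.
  - specialize (Hc t ltac:(apply Rabs_le; lra)).
    assert (psum (fun k => a k * t ^ k) K <= l).
    { apply psum_le_infinite; auto. intros. apply Rmult_le_pos; auto. now apply pow_le. }
    apply Rabs_def2 in HK. apply Rabs_le_inv in Hc. lra.
  - apply (infinite_sum_le_bound _ _ _ Hl). intros J.
    apply Rle_trans with (psum (fun k => a k * tau ^ k) J).
    + apply psum_le. intros k _. apply Rmult_le_compat_l; auto. apply pow_incr. lra.
    + apply psum_le_infinite; auto. intros. apply Rmult_le_pos; auto. now apply pow_le.
Qed.

(** For [k >= 1] one has [k - c >= (1 - c) k], and in the series with factor [k - c] only the term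
    [0] can be negative. The bound does not depend on [t], so it survives the passage to the radius
    of convergence. *)
Lemma subcritical_mean_bound w t c P M K : (forall k, 0 <= w k) -> 0 <= t -> 0 <= c < 1 ->
  infinite_sum (fun k => w k * t ^ k) P -> infinite_sum (fun k => INR k * w k * t ^ k) M ->
  M <= c * P -> (1 - c) * psum (fun k => INR k * w k * t ^ k) K <= c * w O.
Proof.
  intros Hw Ht Hc HP HM Hle.
  assert (Hs : psum (fun k => INR k * w k * t ^ k + - c * (w k * t ^ k)) K <= M + - c * P).
  { apply psum_le_infinite.
    - intros k Hk. assert (1 <= INR k) by (apply (le_INR 1); lia).
      replace (_ + _) with ((INR k - c) * (w k * t ^ k)) by ring.
      apply Rmult_le_pos; [lra|]. apply Rmult_le_pos; auto. now apply pow_le.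
    - intros e He. destruct (HM (e / 2)) as [N1 H1]; [lra|].
      destruct (infinite_sum_scal (- c) _ _ HP (e / 2)) as [N2 H2]; [lra|].
      exists (N1 + N2)%nat. intros n Hn. rewrite sum_f_R0_psum.
      specialize (H1 n ltac:(lia)). specialize (H2 n ltac:(lia)). rewrite sum_f_R0_psum in *.
      unfold psum, Rdist in *. rewrite sumf_plus. apply Rabs_def2 in H1, H2. apply Rabs_def1; lra. }
  assert (Hc' : forall J, (1 - c) * psum (fun k => INR k * w k * t ^ k) J - c * w O <=
     psum (fun k => INR k * w k * t ^ k + - c * (w k * t ^ k)) J).
  { induction J as [|J IH]; [rewrite !psum_0; simpl; lra|]. rewrite !psum_S.
    assert (1 <= INR (S J)) by (apply (le_INR 1); lia).
    assert (Hx : 0 <= w (S J) * t ^ S J) by (apply Rmult_le_pos; auto; now apply pow_le).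
    rewrite Rmult_assoc. set (x := w (S J) * t ^ S J) in *.
    assert (x <= INR (S J) * x) by nra.
    assert (c * x <= c * (INR (S J) * x)) by (apply Rmult_le_compat_l; lra). lra. }
  specialize (Hc' K). lra.
Qed.

Lemma mean_dominates w t K : (forall k, 0 <= w k) -> 0 <= t ->
  psum (fun k => w k * t ^ k) K <= w O + psum (fun k => INR k * w k * t ^ k) K.
Proof.
  intros Hw Ht. induction K as [|K IH]; [rewrite !psum_0; simpl; lra|]. rewrite !psum_S.
  assert (1 <= INR (S K)) by (apply (le_INR 1); lia).
  assert (Hx : 0 <= w (S K) * t ^ S K) by (apply Rmult_le_pos; auto; now apply pow_le).
  rewrite Rmult_assoc. set (x := w (S K) * t ^ S K) in *. nra.
Qed.

(** Type II is given by a limit of [psi] below [tau], whereas the offspring law lives at [tau]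
    itself. Convergence there follows from [subcritical_mean_bound], and Abel's theorem identifies
    the mean. *)
Lemma offspring_law w tau mu : weight_seq w -> type_II_III w tau mu ->
  0 <= tau /\ 0 <= mu < 1 /\
  infinite_sum (fun k => w k * tau ^ k) (phi w tau) /\
  infinite_sum (fun k => INR k * (w k * tau ^ k)) (mu * phi w tau) /\
  forall t C, tau < t -> exists K, C < psum (fun k => w k * t ^ k) K.
Proof.
  intros [Hw [Hw0 _]] [[Hrad [Htau [Hnu Hmu]]]|[Hrad [-> ->]]].
  - assert (Hconv : forall t, 0 <= t < tau ->
       infinite_sum (fun k => w k * t ^ k) (phi w t) /\
       exists M, infinite_sum (fun k => INR k * w k * t ^ k) M /\ psi w t = M / phi w t).
    { intros t Ht. destruct (proj1 Hrad t Ht) as [P HP].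
      destruct (proj1 Hrad ((t + tau) / 2)) as [Q HQ]; [lra|].
      destruct (mean_converges w t _ Q Hw ltac:(split; [|assert (t < (t + tau) / 2) by lra; eassumption]; lra) HQ)
        as [M HM].
      unfold psi, phi. rewrite (series_val_eq _ P HP), (series_val_eq _ M HM). split; auto.
      exists M. auto. }
    assert (Hpos : forall t, 0 <= t < tau -> w O <= phi w t).
    { intros t Ht. replace (w O) with (psum (fun k => w k * t ^ k) 0) by (rewrite psum_0; simpl; ring).
      apply psum_le_infinite; [|now apply Hconv]. intros. apply Rmult_le_pos; auto. apply pow_le; lra. }
    (* Strictly between [mu] and [1]: close to [tau] the quotient [psi] stays below [c]. *)
    set (c := (1 + mu) / 2).
    destruct (Hnu (c - mu)) as [dl [Hdl Hnear]]; [unfold c; lra|].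
    assert (HM : forall K, psum (fun k => INR k * w k * tau ^ k) K <= c * w O / (1 - c)).
    { intros K. apply Rnot_lt_le. intros Hlt.
      set (S := psum (fun k => INR k * w k * tau ^ k) K) in *.
      destruct (poly_continuous (fun k => INR k * w k) K tau ((S - c * w O / (1 - c)) / 2))
        as [d [Hd Hc]]; [lra|].
      set (h := Rmin (Rmin (d / 2) (dl / 2)) (tau / 2)).
      assert (0 < h) by (unfold h; repeat apply Rmin_pos; lra).
      assert (h <= d / 2) by (unfold h; eapply Rle_trans; [apply Rmin_l|apply Rmin_l]).
      assert (h <= dl / 2) by (unfold h; eapply Rle_trans; [apply Rmin_l|apply Rmin_r]).
      assert (h <= tau / 2) by (unfold h; apply Rmin_r).
      specialize (Hc (tau - h)). specialize (Hnear (tau - h) ltac:(lra) ltac:(lra)).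
      destruct (Hconv (tau - h) ltac:(lra)) as [HP [M [HMs Hpsi]]].
      specialize (Hpos (tau - h) ltac:(lra)). rewrite Hpsi in Hnear. apply Rabs_def2 in Hnear.
      assert (Hb : M <= c * phi w (tau - h)).
      { apply Rmult_le_reg_r with (/ phi w (tau - h)); [apply Rinv_0_lt_compat; lra|].
        rewrite Rmult_assoc, Rinv_r by lra. unfold Rdiv in Hnear. lra. }
      pose proof (subcritical_mean_bound w (tau - h) c _ M K Hw ltac:(lra) ltac:(unfold c; lra) HP HMs Hb) as H3.
      assert (H4 : psum (fun k => INR k * w k * (tau - h) ^ k) K <= c * w O / (1 - c)).
      { apply Rmult_le_reg_r with (1 - c); [unfold c; lra|].
        replace (c * w O / (1 - c) * (1 - c)) with (c * w O) by (field; unfold c; lra). lra. }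
      assert (Habs : Rabs (tau - h - tau) <= d) by (apply Rabs_le; lra).
      specialize (Hc Habs). fold S in Hc. apply Rabs_le_inv in Hc. lra. }
    destruct (infinite_sum_bounded (fun k => INR k * w k * tau ^ k) (c * w O / (1 - c))) as [Mn HMn]; auto.
    { intros k. apply Rmult_le_pos; [apply Rmult_le_pos; auto; apply pos_INR|]. apply pow_le; lra. }
    destruct (infinite_sum_bounded (fun k => w k * tau ^ k) (w O + c * w O / (1 - c))) as [P HP].
    { intros k. apply Rmult_le_pos; auto. apply pow_le; lra. }
    { intros K. pose proof (mean_dominates w tau K Hw ltac:(lra)). specialize (HM K). lra. }
    assert (EP : phi w tau = P) by (apply series_val_eq; auto).
    rewrite EP. repeat split; try lra; auto.
    + assert (E : Mn = mu * P).
      { apply cond_eq. intros e He.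
        (* The Abel errors of mean and mass count [1] and [mu], the error of [psi] counts [P]; one
           unit is spare for the strict inequality. *)
        set (e' := e / (2 + mu + P)).
        assert (HPpos : 0 <= P).
        { apply Rle_trans with (psum (fun k => w k * tau ^ k) 0); [rewrite psum_0; simpl; lra|].
          apply psum_le_infinite; auto. intros. apply Rmult_le_pos; auto. apply pow_le; lra. }
        assert (He' : 0 < e') by (apply Rdiv_lt_0_compat; lra).
        destruct (abel_monotone w tau P e' Hw ltac:(lra) He' HP) as [d1 [Hd1 HH1]].
        destruct (abel_monotone (fun k => INR k * w k) tau Mn e') as [d2 [Hd2 HH2]]; auto; try lra.
        { intros. apply Rmult_le_pos; auto. apply pos_INR. }
        destruct (Hnu e' He') as [d3 [Hd3 HH3]].
        set (h := Rmin (Rmin (d1 / 2) (d2 / 2)) (Rmin (d3 / 2) (tau / 2))).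
        assert (0 < h) by (unfold h; repeat apply Rmin_pos; lra).
        assert (h <= d1 / 2) by (unfold h; eapply Rle_trans; [apply Rmin_l|apply Rmin_l]).
        assert (h <= d2 / 2) by (unfold h; eapply Rle_trans; [apply Rmin_l|apply Rmin_r]).
        assert (h <= d3 / 2) by (unfold h; eapply Rle_trans; [apply Rmin_r|apply Rmin_l]).
        assert (h <= tau / 2) by (unfold h; eapply Rle_trans; [apply Rmin_r|apply Rmin_r]).
        destruct (Hconv (tau - h) ltac:(lra)) as [Hp [M [HMs Hpsi]]].
        specialize (HH1 (tau - h) _ ltac:(lra) ltac:(lra) Hp).
        specialize (HH2 (tau - h) _ ltac:(lra) ltac:(lra) HMs).
        specialize (HH3 (tau - h) ltac:(lra) ltac:(lra)). rewrite Hpsi in HH3.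
        specialize (Hpos (tau - h) ltac:(lra)). set (p := phi w (tau - h)) in *.
        assert (HH4 : Rabs (M - mu * p) <= e' * P).
        { replace (M - mu * p) with ((M / p - mu) * p) by (field; lra).
          rewrite Rabs_mult, (Rabs_pos_eq p) by lra.
          apply Rmult_le_compat; try lra. apply Rabs_pos. }
        apply Rabs_le_inv in HH4.
        assert (HH5 : e = e' * (2 + mu + P)) by (unfold e'; field; lra).
        apply Rabs_def1; nra. }
      rewrite <- E. apply infinite_sum_ext with (fun k => INR k * w k * tau ^ k); auto.
      intros; ring.
    + intros t C Ht. apply diverges_unbounded; auto; [lra|]. now apply (proj2 Hrad).
  (* Type III: at [0] only the first term survives, as [0 ^ 0 = 1], and the offspring number is
     [0]. *)
  - assert (E0 : forall a, infinite_sum (fun k => a k * 0 ^ k) (a O)).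
    { intros a e He. exists O. intros n _. rewrite sum_f_R0_psum.
      replace (psum (fun k => a k * 0 ^ k) n) with (a O).
      - unfold Rdist. rewrite Rminus_diag, Rabs_R0. lra.
      - induction n; [rewrite psum_0; simpl; ring|]. rewrite psum_S, <- IHn. simpl; ring. }
    assert (EP : phi w 0 = w O) by (apply series_val_eq; auto).
    rewrite EP. repeat split; try lra; auto.
    + apply infinite_sum_ext with (fun k => INR k * w k * 0 ^ k); [intros; ring|].
      replace (0 * w O) with ((fun k => INR k * w k) O) by (simpl; ring).
      apply (E0 (fun k => INR k * w k)).
    + intros t C Ht. apply diverges_unbounded; auto. lra.
Qed.

(** * Positivity of the partition function *)

Definition rep (w : nat -> R) (s : nat) : Prop :=
  exists d, Forall (fun k => (0 < k)%nat /\ 0 < w k) d /\ list_sum d = s.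

Lemma rep_add w s t : rep w s -> rep w t -> rep w (s + t).
Proof.
  intros [d [Hd <-]] [e [He <-]]. exists (d ++ e). split; [now apply Forall_app|apply list_sum_app].
Qed.

Lemma rep_mul w s q : rep w s -> rep w (q * s).
Proof.
  intros H. induction q; simpl; [exists []; auto|]. now apply rep_add.
Qed.

(** The least positive difference of two representable numbers is the gcd of the support. *)
Lemma rep_multiples w g : weight_seq w -> is_gcd_support w g ->
  exists M, forall s, (M <= s)%nat -> Nat.divide g s -> rep w s.
Proof.
  intros [_ [_ [i [Hi Hwi]]]] [Hg1 Hg2].
  assert (Hi' : rep w i) by (exists [i]; split; [constructor; [split; [lia|auto]|constructor]|simpl; lia]).
  assert (Hg0 : g <> O).
  { intros ->. destruct (Hg1 i Hwi) as [q Hq]. lia. }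
  set (D := fun e => (0 < e)%nat /\ exists x y, rep w x /\ rep w y /\ x = (y + e)%nat).
  assert (HD : exists e, D e /\ forall e', D e' -> (e <= e')%nat).
  { assert (HDi : D i).
    { split; [lia|]. exists i, O. split; auto. split; [exists []; auto|lia]. }
    clear - HDi. induction i as [i IH] using lt_wf_ind.
    destruct (classic (exists e, (e < i)%nat /\ D e)) as [[e [He HDe]]|Hn].
    - now apply (IH e).
    - exists i. split; auto. intros e He. apply Nat.le_ngt. intros Hlt. apply Hn. eauto. }
  destruct HD as [e [[He [x [y [Hx [Hy Hxy]]]]] Hmin]].
  assert (Hdiv : forall z, rep w z -> Nat.divide e z).
  { intros z Hz. apply Nat.Lcm0.mod_divide.
    destruct (Nat.eq_dec (z mod e) 0) as [H|H]; auto. exfalso.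
    assert (Hlt : (z mod e < e)%nat) by (apply Nat.mod_upper_bound; lia).
    apply (Nat.lt_irrefl e). apply Nat.le_lt_trans with (z mod e)%nat; auto. apply Hmin.
    (* Division with remainder among differences: [z + (z / e) * y] minus [(z / e) * x] is
       [z mod e]. *)
    split; [lia|]. exists (z + (z / e) * y)%nat, ((z / e) * x)%nat.
    repeat split; [apply rep_add; auto; now apply rep_mul|now apply rep_mul|].
    pose proof (Nat.div_mod_eq z e). subst x. nia. }
  assert (Hge : g = e).
  { apply Nat.divide_antisym.
    - assert (H : forall z, rep w z -> Nat.divide g z).
      { intros z [d [Hd <-]]. induction Hd as [|k d [_ Hk] _ IH]; [exists O; auto|].
        simpl. apply Nat.divide_add_r; auto. }
      apply (Nat.divide_add_cancel_r g y e); auto. rewrite <- Hxy. auto.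
    - apply Hg2. intros k Hk. destruct k as [|k]; [exists O; auto|]. apply Hdiv.
      exists [S k]. split; [constructor; [split; [lia|auto]|constructor]|simpl; lia]. }
  subst e. destruct (Hdiv y Hy) as [q Hq].
  (* With [y = q * g] and [x = y + g], the number [k * g] is made of [k mod q] copies of [x] and
     [k / q - k mod q] copies of [y]; for this [k / q >= q] is enough. *)
  exists (g * (q * q))%nat. intros s Hs [k Hk].
  destruct (Nat.eq_dec q 0) as [->|Hq0].
  - assert (y = O) by lia. subst y s. simpl in Hxy. subst x. now apply rep_mul.
  - assert (Hkq : (q * q <= k)%nat) by nia.
    pose proof (Nat.div_mod_eq k q) as Hdm.
    assert (Hr : (k mod q < q)%nat) by (apply Nat.mod_upper_bound; lia).
    assert (Hqd : (q <= k / q)%nat) by (apply Nat.div_le_lower_bound; lia).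
    replace s with ((k / q - k mod q) * y + (k mod q) * x)%nat.
    + apply rep_add; now apply rep_mul.
    + subst s x y. rewrite Nat.mul_sub_distr_r. nia.
Qed.

Lemma rep_length w d : Forall (fun k => (0 < k)%nat /\ 0 < w k) d -> (length d <= list_sum d)%nat.
Proof. induction 1 as [|k d [Hk _] _ IH]; simpl; lia. Qed.

Lemma comp_sum_pos w g : weight_seq w -> is_gcd_support w g -> exists N, forall n, (N <= n)%nat ->
  n mod g = 1 mod g -> 0 < comp_sum w n (n - 1) (fun _ => 1).
Proof.
  intros HW HG. destruct (rep_multiples w g HW HG) as [M HM].
  destruct HW as [Hw [Hw0 [i [Hi Hwi]]]].
  assert (Hg0 : g <> O).
  { intros ->. destruct (proj1 HG i Hwi) as [q Hq]. lia. }
  exists (S M). intros n Hn Hmod.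
  assert (Hd : Nat.divide g (n - 1)).
  { exists (n / g - 1 / g)%nat. pose proof (Nat.div_mod_eq n g). pose proof (Nat.div_mod_eq 1 g).
    assert (1 / g <= n / g)%nat by (apply Nat.Div0.div_le_mono; lia).
    rewrite Nat.mul_sub_distr_r. lia. }
  destruct (HM (n - 1)%nat ltac:(lia) Hd) as [d [Hd1 Hd2]].
  pose proof (rep_length w d Hd1) as Hl.
  (* At most [n - 1] positive parts are padded with leaves to [n] entries; [0 < w O] keeps the
     weight positive. *)
  set (e := d ++ repeat O (n - length d)).
  assert (He : In e (comps n (n - 1))).
  { apply in_comps. unfold e. rewrite length_app, repeat_length, list_sum_app.
    replace (list_sum (repeat 0%nat (n - length d))) with O; [lia|].
    induction (n - length d)%nat; simpl; auto. }
  unfold comp_sum. destruct (in_split _ _ He) as [l1 [l2 ->]]. rewrite sumf_app, sumf_cons.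
  pose proof (sumf_nonneg (fun d => wprod w d * 1) l1
    ltac:(intros; cbv beta; rewrite Rmult_1_r; now apply wprod_nonneg)).
  pose proof (sumf_nonneg (fun d => wprod w d * 1) l2
    ltac:(intros; cbv beta; rewrite Rmult_1_r; now apply wprod_nonneg)).
  assert (0 < wprod w e); [|lra].
  unfold e. rewrite wprod_app. apply Rmult_lt_0_compat.
  - clear - Hd1. induction Hd1 as [|k d [_ Hk] _ IH]; simpl; [lra|]. now apply Rmult_lt_0_compat.
  - generalize (n - length d)%nat. intros r. clear - Hw0.
    induction r as [|r IH]; simpl; [lra|]. now apply Rmult_lt_0_compat.
Qed.

(** * Concentration of the degree frequencies *)

Definition lowl (K : nat) (d : list nat) : R :=
  sumf (fun k => if Nat.leb k K then INR k else 0) d.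
Definition highl (K : nat) (d : list nat) : R :=
  sumf (fun k => if Nat.leb k K then 0 else INR k) d.

Lemma low_sum_degs t K : low_sum t K = lowl K (degs t).
Proof. unfold lowl, degs. now rewrite sumf_map. Qed.

Lemma high_sum_degs t K : high_sum t K = highl K (degs t).
Proof. unfold highl, degs. now rewrite sumf_map. Qed.

Lemma psum_cnt h K d :
  psum (fun k => h k * cnt k d) K = sumf (fun x => if Nat.leb x K then h x else 0) d.
Proof.
  unfold psum, cnt.
  rewrite (sumf_ext _ (fun k => sumf (fun x => h k * (if Nat.eqb x k then 1 else 0)) d))
    by (intros; now rewrite sumf_scal).
  rewrite sumf_exchange. apply sumf_ext. intros x _.
  destruct (Nat.leb_spec x K).
  - rewrite (sumf_single _ x); [rewrite Nat.eqb_refl; lra|apply seq_NoDup|apply in_seq; lia|].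
    intros y _ Hy. replace (Nat.eqb x y) with false; [lra|]. symmetry. apply Nat.eqb_neq. auto.
  - apply sumf_0. intros y Hy. apply in_seq in Hy.
    replace (Nat.eqb x y) with false; [lra|]. symmetry. apply Nat.eqb_neq. lia.
Qed.

(** Markov's inequality: the degrees add up to [n - 1], so at most a fraction [/ INR (S j)] of them
    exceeds [j]. This is the tightness required by [pinning]. *)
Lemma freq_tail_bounds d n j : length d = n -> list_sum d = (n - 1)%nat -> (0 < n)%nat ->
  1 - / INR (S j) <= psum (fun k => cnt k d / INR n) j <= 1.
Proof.
  intros Hl Hs Hn. apply lt_0_INR in Hn as Hn'.
  assert (E : psum (fun k => cnt k d / INR n) j =
    sumf (fun x => if Nat.leb x j then 1 else 0) d / INR n).
  { rewrite <- psum_cnt. unfold Rdiv. rewrite Rmult_comm. unfold psum.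
    rewrite <- sumf_scal. apply sumf_ext; intros; ring. }
  rewrite E.
  assert (Hj : 0 < INR (S j)) by (apply lt_0_INR; lia).
  assert (H1 : INR (S j) * (INR n - sumf (fun x => if Nat.leb x j then 1 else 0) d) <= INR n).
  { rewrite <- Hl at 1. rewrite <- (Rmult_1_r (INR (length d))), <- sumf_const, <- sumf_minus, <- sumf_scal.
    apply Rle_trans with (INR (list_sum d)); [|apply le_INR; lia].
    rewrite <- sumf_INR. apply sumf_le. intros x _. destruct (Nat.leb_spec x j).
    - pose proof (pos_INR x). lra.
    - assert (INR (S j) <= INR x) by (apply le_INR; lia). lra. }
  assert (H2 : sumf (fun x => if Nat.leb x j then 1 else 0) d <= INR n).
  { rewrite <- Hl, <- (Rmult_1_r (INR (length d))), <- sumf_const. apply sumf_le.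
    intros x _. destruct (Nat.leb x j); lra. }
  set (s := sumf _ d) in *. split.
  - apply Rmult_le_reg_r with (INR (S j) * INR n); [now apply Rmult_lt_0_compat|].
    replace (s / INR n * (INR (S j) * INR n)) with (s * INR (S j)) by (field; lra).
    replace ((1 - / INR (S j)) * (INR (S j) * INR n)) with (INR (S j) * INR n - INR n) by (field; lra).
    lra.
  - apply Rmult_le_reg_r with (INR n); auto. replace (s / INR n * INR n) with s by (field; lra). lra.
Qed.

(** Expectation over conditioned sequences, i.e. over degree sequences of the random tree. *)
Definition expect (w : nat -> R) (n : nat) (f : list nat -> R) : R :=
  comp_sum w n (n - 1) f / comp_sum w n (n - 1) (fun _ => 1).

(** Probability that the conditioned sequence starts with [l]. *)
Definition cpre (w : nat -> R) (n : nat) (l : list nat) : R :=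
  prew w l n (n - 1) (fun _ => 1) / comp_sum w n (n - 1) (fun _ => 1).

Section Expect.
Context (w : nat -> R) (n : nat) (Hw : forall k, 0 <= w k).
Context (Hn : (0 < n)%nat) (HB : 0 < comp_sum w n (n - 1) (fun _ => 1)).

(** The condition [wprod w d <> 0] lets sequences with a degree outside the support be ignored. *)
Lemma expect_le f g : (forall d, length d = n -> list_sum d = (n - 1)%nat -> wprod w d <> 0 -> f d <= g d) ->
  expect w n f <= expect w n g.
Proof.
  intros H. apply Rmult_le_compat_r; [left; now apply Rinv_0_lt_compat|].
  apply sumf_le. intros d Hd. apply in_comps in Hd.
  destruct (Req_dec (wprod w d) 0) as [E|E]; [rewrite E; lra|].
  apply Rmult_le_compat_l; [now apply wprod_nonneg|]. apply H; tauto.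
Qed.

Lemma expect_const c : expect w n (fun _ => c) = c.
Proof.
  unfold expect. rewrite (comp_sum_ext w n (n - 1) (fun _ => c) (fun _ => c * 1)) by (intros; ring).
  rewrite comp_sum_scal. field. lra.
Qed.

Lemma expect_plus f g : expect w n (fun d => f d + g d) = expect w n f + expect w n g.
Proof. unfold expect. rewrite comp_sum_plus. field. lra. Qed.

Lemma expect_minus f g : expect w n (fun d => f d - g d) = expect w n f - expect w n g.
Proof. unfold expect. rewrite comp_sum_minus. field. lra. Qed.

Lemma expect_scal c f : expect w n (fun d => c * f d) = c * expect w n f.
Proof. unfold expect. rewrite comp_sum_scal. field. lra. Qed.

Lemma expect_sumf {A} (f : A -> list nat -> R) l :
  expect w n (fun d => sumf (fun x => f x d) l) = sumf (fun x => expect w n (f x)) l.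
Proof.
  unfold expect. rewrite comp_sum_sumf. unfold Rdiv. rewrite Rmult_comm, <- sumf_scal.
  apply sumf_ext. intros; ring.
Qed.

Lemma expect_abs f : Rabs (expect w n f) <= expect w n (fun d => Rabs (f d)).
Proof.
  unfold expect, Rdiv. rewrite Rabs_mult, (Rabs_pos_eq (/ _)) by (left; now apply Rinv_0_lt_compat).
  apply Rmult_le_compat_r; [left; now apply Rinv_0_lt_compat|]. now apply comp_sum_abs.
Qed.

Lemma expect_ext f g : (forall d, length d = n -> list_sum d = (n - 1)%nat -> f d = g d) ->
  expect w n f = expect w n g.
Proof. intros H. unfold expect. now rewrite (comp_sum_ext w n (n - 1) f g H). Qed.

Lemma Zn_comp_sum : INR n * Zn w n = comp_sum w n (n - 1) (fun _ => 1).
Proof.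
  rewrite <- (sumf_trees_symm w n (fun _ => 1)); auto; [|intros ? ? ?; reflexivity].
  f_equal. unfold Zn. apply sumf_ext. intros; ring.
Qed.

Lemma Zn_pos : 0 < Zn w n.
Proof.
  pose proof Zn_comp_sum as H. apply lt_0_INR in Hn as Hn'.
  apply Rmult_lt_reg_l with (INR n); auto. lra.
Qed.

Lemma Tprob_sumf E : Tprob w n E = sumf (fun t => tweight w t * indic (E t)) (trees_n n) / Zn w n.
Proof.
  unfold Tprob. f_equal. apply sumf_ext. intros t _. destruct (E t); simpl; ring.
Qed.

Lemma Tprob_expect E e : (forall t, E t = e (degs t)) -> symm (fun d => indic (e d)) ->
  Tprob w n E = expect w n (fun d => indic (e d)).
Proof.
  intros HE He. rewrite Tprob_sumf. unfold expect. rewrite <- Zn_comp_sum, <- sumf_trees_symm by auto.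
  rewrite (sumf_ext _ (fun t => tweight w t * indic (e (degs t)))) by (intros; now rewrite HE).
  pose proof Zn_pos. apply lt_0_INR in Hn as Hn'. field. lra.
Qed.

Lemma sampling_expect l : Rabs (cpre w n l - expect w n (prodf n l)) <= INR (length l * length l) / INR n.
Proof.
  pose proof (sampling w Hw l [] n (n - 1) (fun _ => 1) Hn (fun _ _ _ => eq_refl)
    ltac:(intros; lra)) as H.
  rewrite !pre_nil in H. simpl app in H. simpl length in H.
  rewrite (comp_sum_ext w n (n - 1) (fun d => prodf n l d * 1) (prodf n l)) in H by (intros; ring).
  unfold cpre, expect. set (B := comp_sum w n (n - 1) (fun _ => 1)) in *.
  replace (prew w l n (n - 1) (fun _ => 1) / B - comp_sum w n (n - 1) (prodf n l) / B) with
    ((prew w l n (n - 1) (fun _ => 1) - comp_sum w n (n - 1) (prodf n l)) * / B) by (field; lra).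
  rewrite Rabs_mult, (Rabs_pos_eq (/ B)) by (left; now apply Rinv_0_lt_compat).
  apply Rmult_le_reg_r with B; auto. rewrite Rmult_assoc, Rinv_l by lra. rewrite Rmult_1_r. exact H.
Qed.

(** The conditioned law only sees [w] through [wprod w l], the length and the sum. *)
Lemma cpre_ratio l l' : length l = length l' -> list_sum l = list_sum l' ->
  wprod w l <> 0 -> wprod w l' <> 0 -> cpre w n l / wprod w l = cpre w n l' / wprod w l'.
Proof.
  intros H1 H2 H3 H4. unfold cpre, prew. rewrite H1, H2. destruct (_ && _)%bool.
  - field. repeat split; auto; lra.
  - field. repeat split; auto; lra.
Qed.

Lemma prodf_app l l' d : prodf n (l ++ l') d = prodf n l d * prodf n l' d.
Proof. induction l as [|a l IH]; simpl; rewrite ?IH; lra. Qed.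

Lemma prodf_repeat a m d : prodf n (repeat a m) d = (cnt a d / INR n) ^ m.
Proof. induction m as [|m IH]; simpl; rewrite ?IH; lra. Qed.

Lemma wprod_repeat a m : wprod w (repeat a m) = w a ^ m.
Proof. induction m as [|m IH]; simpl; rewrite ?IH; lra. Qed.

(** In the expanded square each expectation is, up to sampling error, the probability of a prefix of
    twice the length. After division by weights the three probabilities agree by [cpre_ratio] and
    cancel with coefficients 1, -2, 1. *)
Lemma exchange_variance l l' : length l = length l' -> list_sum l = list_sum l' ->
  0 < wprod w l -> 0 < wprod w l' ->
  expect w n (fun d => (prodf n l d / wprod w l - prodf n l' d / wprod w l') ^ 2) <=
  INR (4 * (length l * length l)) * (/ wprod w l + / wprod w l') ^ 2 / INR n.
Proof.
  intros H1 H2 H3 H4. set (a := wprod w l) in *. set (b := wprod w l') in *.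
  apply lt_0_INR in Hn as Hn'.
  assert (E : expect w n (fun d => (prodf n l d / a - prodf n l' d / b) ^ 2) =
    expect w n (prodf n (l ++ l)) / (a * a) - 2 * (expect w n (prodf n (l ++ l')) / (a * b))
     + expect w n (prodf n (l' ++ l')) / (b * b)).
  { unfold Rdiv. rewrite !(Rmult_comm _ (/ (_ * _))), <- !expect_scal, <- expect_minus, <- expect_plus.
    apply expect_ext. intros d _ _. rewrite !prodf_app. field. lra. }
  rewrite E.
  (* Sampling error for lists of twice the length of [l]. *)
  set (r := INR (4 * (length l * length l)) / INR n).
  assert (Hs : forall u v, length u = length l -> length v = length l ->
    Rabs (cpre w n (u ++ v) - expect w n (prodf n (u ++ v))) <= r).
  { intros u v Hu Hv. eapply Rle_trans; [apply sampling_expect|]. unfold r. right. do 2 f_equal.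
    rewrite length_app. lia. }
  assert (H5 : cpre w n (l ++ l) / (a * a) = cpre w n (l ++ l') / (a * b)).
  { unfold a, b. rewrite <- !wprod_app. apply cpre_ratio;
      rewrite ?length_app, ?list_sum_app, ?wprod_app; try lia; fold a; fold b; nra. }
  assert (H6 : cpre w n (l' ++ l') / (b * b) = cpre w n (l ++ l') / (a * b)).
  { unfold a, b. rewrite <- !wprod_app. apply cpre_ratio;
      rewrite ?length_app, ?list_sum_app, ?wprod_app; try lia; fold a; fold b; nra. }
  pose proof (Hs l l eq_refl eq_refl) as S1.
  pose proof (Hs l l' eq_refl ltac:(lia)) as S2.
  pose proof (Hs l' l' ltac:(lia) ltac:(lia)) as S3.
  apply Rabs_le_inv in S1, S2, S3.
  set (e1 := expect w n (prodf n (l ++ l))) in *. set (e2 := expect w n (prodf n (l ++ l'))) in *.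
  set (e3 := expect w n (prodf n (l' ++ l'))) in *.
  set (c1 := cpre w n (l ++ l)) in *. set (c2 := cpre w n (l ++ l')) in *.
  set (c3 := cpre w n (l' ++ l')) in *.
  assert (Ha : 0 < / a) by (now apply Rinv_0_lt_compat).
  assert (Hb : 0 < / b) by (now apply Rinv_0_lt_compat).
  replace (e1 / (a * a) - 2 * (e2 / (a * b)) + e3 / (b * b)) with
    ((e1 - c1) * (/ a * / a) + 2 * ((c2 - e2) * (/ a * / b)) + (e3 - c3) * (/ b * / b)
     + (c1 / (a * a) - 2 * (c2 / (a * b)) + c3 / (b * b))) by (field; lra).
  rewrite H5, H6.
  replace (INR (4 * (length l * length l)) * (/ a + / b) ^ 2 / INR n) with
    (r * (/ a * / a) + 2 * (r * (/ a * / b)) + r * (/ b * / b)) by (unfold r; field; lra).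
  assert ((e1 - c1) * (/ a * / a) <= r * (/ a * / a)) by (apply Rmult_le_compat_r; nra).
  assert ((c2 - e2) * (/ a * / b) <= r * (/ a * / b)) by (apply Rmult_le_compat_r; nra).
  assert ((e3 - c3) * (/ b * / b) <= r * (/ b * / b)) by (apply Rmult_le_compat_r; nra).
  lra.
Qed.

(** Turns smallness in probability into smallness in mean, for a deviation bounded by [B]. *)
Lemma expect_deviation X c e B : 0 < e ->
  (forall d, length d = n -> list_sum d = (n - 1)%nat -> Rabs (X d / INR n - c) <= B) ->
  expect w n (fun d => Rabs (X d / INR n - c)) <=
  e + B * expect w n (fun d => indic (Rltb (e * INR n) (Rabs (X d - c * INR n)))).
Proof.
  intros He HX. apply lt_0_INR in Hn as Hn'.
  apply Rle_trans with (expect w n (fun d => e +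
    B * indic (Rltb (e * INR n) (Rabs (X d - c * INR n))))); [|rewrite expect_plus, expect_const, expect_scal; lra].
  apply expect_le. intros d H1 H2 _. specialize (HX d H1 H2). unfold Rltb, indic.
  destruct (Rlt_dec _ _) as [H|H].
  - lra.
  - apply Rnot_lt_le in H. rewrite Rmult_0_r, Rplus_0_r.
    replace (X d / INR n - c) with ((X d - c * INR n) * / INR n) by (field; lra).
    rewrite Rabs_mult, (Rabs_pos_eq (/ INR n)) by (left; now apply Rinv_0_lt_compat).
    apply Rmult_le_reg_r with (INR n); auto. rewrite Rmult_assoc, Rinv_l by lra. lra.
Qed.

End Expect.

(** Uniform version of the hypothesis on [Omega]; the sequence [K] is interpolated by [Omega]. *)
Lemma Omega_uniform w g mu Om : Omega_ok w g mu Om -> forall e d, 0 < e -> 0 < d ->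
  exists K0, forall n K, (K0 <= n)%nat -> (K0 <= K <= Om n)%nat -> n mod g = 1 mod g ->
  Tprob w n (fun t => Rltb (e * INR n) (Rabs (low_sum t K - mu * INR n))) < d.
Proof.
  intros [HOm [_ HK]] e d He Hd. apply NNPP. intros Hn.
  set (bad := fun (j : nat) (p : nat * nat) => (j <= fst p)%nat /\ (j <= snd p <= Om (fst p))%nat /\
    fst p mod g = 1 mod g /\
    d <= Tprob w (fst p) (fun t => Rltb (e * INR (fst p)) (Rabs (low_sum t (snd p) - mu * INR (fst p))))).
  assert (Hbad : forall j, exists p, bad j p).
  { intros j. apply NNPP. intros Hj. apply Hn. exists j. intros n K H1 H2 H3.
    apply Rnot_le_lt. intros Hle. apply Hj. exists (n, K). unfold bad; simpl. auto. }
  set (f := fun j => proj1_sig (constructive_indefinite_description _ (Hbad j))).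
  assert (Hf : forall j, bad j (f j))
    by (intros j; exact (proj2_sig (constructive_indefinite_description _ (Hbad j)))).
  (* Each new bad pair lies beyond the previous [n], so no [n] occurs twice and the second component
     is a function of [n]. *)
  set (s := fix s j := match j with O => f O | S j' => f (S (fst (s j'))) end).
  assert (Hs : forall j, bad j (s j) /\ (forall i, (i < j)%nat -> (fst (s i) < fst (s j))%nat)).
  { induction j as [|j [IH1 IH2]]; [split; [apply Hf|lia]|].
    assert (Hj : (j <= fst (s j))%nat) by apply IH1.
    pose proof (Hf (S (fst (s j)))) as H. change (f (S (fst (s j)))) with (s (S j)) in H.
    assert (Hlt : (fst (s j) < fst (s (S j)))%nat) by apply H. split.
    - destruct H as [H1 [H2 H3]]. repeat split; try tauto; lia.
    - intros i Hi. destruct (Nat.eq_dec i j) as [->|]; auto.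
      apply Nat.lt_trans with (fst (s j)); auto. apply IH2. lia. }
  (* Equal to [Om n] off the chosen sizes, which keeps [Kf] below [Om] and divergent, as the
     hypothesis demands. *)
  set (Kf := fun n => match excluded_middle_informative (exists j, fst (s j) = n) with
    | left H => snd (s (proj1_sig (constructive_indefinite_description _ H))) | right _ => Om n end).
  assert (HKs : forall j, Kf (fst (s j)) = snd (s j)).
  { intros j. unfold Kf. destruct (excluded_middle_informative _) as [H|H]; [|exfalso; eauto].
    destruct (constructive_indefinite_description _ H) as [i Hi]. simpl. f_equal. f_equal.
    destruct (Nat.lt_trichotomy i j) as [Hl|[Hl|Hl]]; auto; apply Hs in Hl; lia. }
  assert (Hcase : forall n, (exists j, n = fst (s j)) \/ Kf n = Om n).
  { intros n. unfold Kf. destruct (excluded_middle_informative _) as [[j Hj]|H]; eauto. }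
  destruct (HK Kf) as [Hlow _].
  - intros M. destruct (HOm M) as [N HN]. exists (N + fst (s M))%nat. intros n Hle.
    destruct (Hcase n) as [[j ->]| ->]; [|apply HN; lia].
    rewrite HKs. destruct (Nat.le_gt_cases M j) as [H|H].
    + destruct (Hs j) as [[_ [H1 _]] _]. lia.
    + apply Hs in H. lia.
  - intros n. destruct (Hcase n) as [[j ->]| ->]; auto. rewrite HKs. apply (Hs j).
  - destruct (Hlow e d He Hd) as [N HN].
    destruct (Hs N) as [[H1 [H2 [H3 H4]]] _]. specialize (HN (fst (s N)) H1 H3).
    rewrite HKs in HN. lra.
Qed.

Lemma Rltb_symm X (c : R) n : symm X -> symm (fun d => indic (Rltb c (Rabs (X d - n)))).
Proof. intros H d e P. now rewrite (H d e P). Qed.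

Lemma lowl_symm K : symm (lowl K).
Proof. intros d e P. now apply sumf_perm. Qed.

Lemma highl_symm K : symm (highl K).
Proof. intros d e P. now apply sumf_perm. Qed.

Section Concentration.
Context (w : nat -> R) (g : nat) (tau mu : R) (Om : nat -> nat).
Context (HW : weight_seq w) (HG : is_gcd_support w g) (HT : type_II_III w tau mu).
Context (HOm : Omega_ok w g mu Om).

Definition pik (k : nat) : R := w k * tau ^ k / phi w tau.

Lemma pik_bounds k : 0 <= pik k <= 1.
Proof.
  destruct (offspring_law w tau mu HW HT) as [H1 [_ [H2 _]]]. destruct HW as [Hw [Hw0 _]].
  assert (Hp : forall j, 0 <= w j * tau ^ j) by (intros; apply Rmult_le_pos; auto; now apply pow_le).
  assert (HP : 0 < phi w tau).
  { apply Rlt_le_trans with (psum (fun k => w k * tau ^ k) 0); [rewrite psum_0; simpl; lra|].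
    apply psum_le_infinite; auto. }
  unfold pik. split.
  - apply Rmult_le_pos; auto. left. now apply Rinv_0_lt_compat.
  - apply Rmult_le_reg_r with (phi w tau); auto. unfold Rdiv.
    rewrite Rmult_assoc, Rinv_l, Rmult_1_r, Rmult_1_l by lra.
    apply Rle_trans with (psum (fun k => w k * tau ^ k) k); [|apply psum_le_infinite; auto].
    destruct k; [rewrite psum_0; lra|]. rewrite psum_S.
    assert (0 <= psum (fun k => w k * tau ^ k) k) by (apply sumf_nonneg; auto). lra.
Qed.

(** A Chebyshev argument: the deviation never exceeds [1], and it is at most [e / 3] unless the
    truncated mean is off or a balance relation fails. The first event is rare by [Omega_uniform],
    the second by [exchange_variance]. *)
Lemma concentration k0 e : 0 < e -> exists N, forall n, (N <= n)%nat -> n mod g = 1 mod g ->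
  expect w n (fun d => Rabs (cnt k0 d / INR n - pik k0)) <= e.
Proof.
  intros He.
  destruct (offspring_law w tau mu HW HT) as [Htau [Hmu [HPhi [Hmean Hdiv]]]].
  pose proof HW as [Hw [Hw0 [m [Hm Hwm]]]].
  destruct (pinning w tau mu (phi w tau) m Hw Hw0 ltac:(lia) Hwm Htau Hmu HPhi Hmean Hdiv k0 (e / 3))
    as [d1 [Ks [Hd1 Hpin]]]; [lra|].
  destruct (Omega_uniform w g mu Om HOm d1 (e / 3) Hd1 ltac:(lra)) as [K0 HK0].
  set (K := (Ks + K0)%nat). destruct (Hpin K ltac:(lia)) as [d2 [Hd2 Hp]].
  destruct (comp_sum_pos w g HW HG) as [N1 HN1].
  destruct (proj1 HOm K) as [N2 HN2].
  (* The two sides of the exchange: both lists have length [m + k] and sum [m * k]. *)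
  set (la := fun k => repeat k m ++ repeat O k). set (lb := fun k => repeat m k ++ repeat O m).
  (* Only degrees in the support, since their weights are divided by. *)
  set (good := filter (fun k => if Rlt_dec 0 (w k) then true else false) (seq 0 (S K))).
  set (C := sumf (fun k => / (d2 * d2) * (INR (4 * (length (la k) * length (la k))) *
     (/ wprod w (la k) + / wprod w (lb k)) ^ 2)) good).
  destruct (archimed_cor1 (e / 3 / (Rabs C + 1))) as [N3 [HN3 HN3']].
  { pose proof (Rabs_pos C). apply Rdiv_lt_0_compat; lra. }
  exists (S (N1 + N2 + N3 + K0)). intros n Hn Hmod.
  assert (Hn0 : (0 < n)%nat) by lia. apply lt_0_INR in Hn0 as Hn0'.
  specialize (HN1 n ltac:(lia) Hmod). specialize (HN2 n ltac:(lia)).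
  specialize (HK0 n K ltac:(lia) ltac:(lia) Hmod).
  rewrite (Tprob_expect w n Hn0 HN1 _ (fun d => Rltb (d1 * INR n) (Rabs (lowl K d - mu * INR n)))) in HK0.
  2: { intros t. now rewrite low_sum_degs. }
  2: { apply Rltb_symm, lowl_symm. }
  set (V := fun k d => (prodf n (la k) d / wprod w (la k) - prodf n (lb k) d / wprod w (lb k)) ^ 2).
  assert (Hgood : forall k, In k good -> (k <= K)%nat /\ 0 < w k).
  { intros k Hk. apply filter_In in Hk. destruct Hk as [H1 H2]. apply in_seq in H1.
    destruct (Rlt_dec 0 (w k)); [|discriminate]. split; [lia|auto]. }
  assert (Hmain : expect w n (fun d => Rabs (cnt k0 d / INR n - pik k0)) <=
    expect w n (fun d => e / 3 + (indic (Rltb (d1 * INR n) (Rabs (lowl K d - mu * INR n))) +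
      sumf (fun k => / (d2 * d2) * V k d) good))).
  { apply expect_le; auto. intros d Hl Hs Hwd.
    assert (Hd22 : 0 < / (d2 * d2)) by (apply Rinv_0_lt_compat; nra).
    assert (Hpos : forall k, 0 <= / (d2 * d2) * V k d).
    { intros k. apply Rmult_le_pos; [lra|]. unfold V. apply pow2_ge_0. }
    pose proof (sumf_nonneg _ good (fun k _ => Hpos k)) as Hsum.
    assert (Htriv : Rabs (cnt k0 d / INR n - pik k0) <= 1).
    { pose proof (freq_bounds n k0 d Hn0 Hl). pose proof (pik_bounds k0). apply Rabs_le. lra. }
    unfold Rltb at 1. destruct (Rlt_dec _ _) as [Hbad|Hlow]; [simpl; lra|].
    simpl indic. apply Rnot_lt_le in Hlow.
    destruct (Rle_dec 1 (sumf (fun k => / (d2 * d2) * V k d) good)) as [H1|H1]; [lra|].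
    apply Rnot_le_lt in H1.
    assert (Hfin : Rabs (cnt k0 d / INR n - pik k0) <= e / 3); [|lra].
    apply (Hp (fun k => cnt k d / INR n)).
    - intros k. now apply freq_bounds.
    - intros k Hk. assert (Hc : cnt k d = 0); [|rewrite Hc; unfold Rdiv; ring].
      apply sumf_0. intros x Hx. destruct (Nat.eqb_spec x k) as [->|]; auto. exfalso. apply Hwd.
      destruct (in_split _ _ Hx) as [u [v ->]]. rewrite wprod_app. simpl. rewrite Hk. ring.
    - intros j. now apply freq_tail_bounds.
    - assert (E : psum (fun k => INR k * (cnt k d / INR n)) K = lowl K d / INR n).
      { unfold lowl. rewrite <- psum_cnt. unfold Rdiv. rewrite Rmult_comm. unfold psum.
        rewrite <- sumf_scal. apply sumf_ext; intros; ring. }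
      rewrite E. replace (lowl K d / INR n - mu) with ((lowl K d - mu * INR n) * / INR n) by (field; lra).
      rewrite Rabs_mult, (Rabs_pos_eq (/ INR n)) by (left; now apply Rinv_0_lt_compat).
      apply Rmult_le_reg_r with (INR n); auto. rewrite Rmult_assoc, Rinv_l by lra. lra.
    - intros k Hk Hwk.
      assert (Hin : In k good).
      { apply filter_In. split; [apply in_seq; lia|]. destruct (Rlt_dec 0 (w k)); auto. }
      assert (HV : / (d2 * d2) * V k d <= 1).
      { destruct (in_split _ _ Hin) as [u [v Huv]]. rewrite Huv, sumf_app, sumf_cons in H1.
        pose proof (sumf_nonneg _ u (fun k _ => Hpos k)).
        pose proof (sumf_nonneg _ v (fun k _ => Hpos k)). lra. }
      assert (HV' : V k d <= d2 * d2).
      { apply Rmult_le_reg_l with (/ (d2 * d2)); auto. rewrite Rinv_l; nra. }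
      unfold V, la, lb in HV'. rewrite !prodf_app, !prodf_repeat, !wprod_app, !wprod_repeat in HV'.
      (* [V k d] is the square of the defect that [balanced] bounds. *)
      match type of HV' with ?y ^ 2 <= _ => match goal with |- Rabs ?x <= _ =>
        assert (Exy : y = x) end end.
      { unfold Rdiv. rewrite !Rpow_mult_distr, !pow_inv. field.
        repeat split; try apply pow_nonzero; lra. }
      rewrite Exy in HV'. rewrite <- pow2_abs in HV'.
      match goal with |- Rabs ?x <= _ => pose proof (Rabs_pos x); set (y := Rabs x) in * end.
      nra. }
  eapply Rle_trans; [exact Hmain|]. rewrite !expect_plus, expect_const, expect_sumf by auto.
  assert (Hvar : sumf (fun k => expect w n (fun d => / (d2 * d2) * V k d)) good <= C * / INR n).
  { unfold C. rewrite (Rmult_comm _ (/ INR n)), <- sumf_scal. apply sumf_le. intros k Hk.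
    apply Hgood in Hk. rewrite expect_scal by auto.
    rewrite <- Rmult_assoc, (Rmult_comm (/ INR n)), Rmult_assoc.
    assert (Hd22 : 0 < / (d2 * d2)) by (apply Rinv_0_lt_compat; nra).
    apply Rmult_le_compat_l; [lra|]. rewrite Rmult_comm. unfold V.
    apply exchange_variance; auto; unfold la, lb.
    - rewrite !length_app, !repeat_length. lia.
    - assert (HR : forall a j, list_sum (repeat a j) = (j * a)%nat)
        by (intros a j; induction j; simpl; auto).
      rewrite !list_sum_app, !HR. lia.
    - rewrite wprod_app, !wprod_repeat. apply Rmult_lt_0_compat; apply pow_lt; tauto.
    - rewrite wprod_app, !wprod_repeat. apply Rmult_lt_0_compat; apply pow_lt; tauto. }
  assert (HC : C * / INR n <= e / 3).
  { assert (HinvN : / INR n <= / INR N3)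
      by (apply Rinv_le_contravar; [now apply lt_0_INR|apply le_INR; lia]).
    pose proof (Rle_abs C). pose proof (Rabs_pos C).
    assert (0 < / INR n) by (now apply Rinv_0_lt_compat).
    apply Rle_trans with ((Rabs C + 1) * / INR n); [apply Rmult_le_compat_r; lra|].
    apply Rmult_le_reg_l with (/ (Rabs C + 1)); [apply Rinv_0_lt_compat; lra|].
    rewrite <- Rmult_assoc, Rinv_l, Rmult_1_l by lra. unfold Rdiv at 1 in HN3. lra. }
  lra.
Qed.

End Concentration.

(** * Limits of pattern probabilities *)

Section Limits.
Context (w : nat -> R) (g : nat) (tau mu : R) (Om : nat -> nat).
Context (HW : weight_seq w) (HG : is_gcd_support w g) (HT : type_II_III w tau mu).
Context (HOm : Omega_ok w g mu Om).

Definition ppi (l : list nat) : R := wprod (pik w tau) l.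

Lemma ppi_bounds l : 0 <= ppi l <= 1.
Proof.
  induction l as [|a l IH]; unfold ppi in *; simpl; [lra|].
  pose proof (pik_bounds w tau mu HW HT a). nra.
Qed.

(** Eventually along the admissible sizes; elsewhere the normalising sum may vanish. *)
Definition eventually_mod (P : nat -> Prop) : Prop :=
  exists N, forall n, (N <= n)%nat -> n mod g = 1 mod g -> P n.

Lemma eventually_and P Q : eventually_mod P -> eventually_mod Q -> eventually_mod (fun n => P n /\ Q n).
Proof.
  intros [N1 H1] [N2 H2]. exists (N1 + N2)%nat. intros n Hn Hm. split; [apply H1|apply H2]; auto; lia.
Qed.

Lemma eventually_mono (P Q : nat -> Prop) : (forall n, P n -> Q n) -> eventually_mod P -> eventually_mod Q.
Proof. intros H [N HN]. exists N. auto. Qed.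

Lemma eventually_ge K : eventually_mod (fun n => (K <= n)%nat).
Proof. exists K. auto. Qed.

Lemma eventually_Om K : eventually_mod (fun n => (K <= Om n)%nat).
Proof. destruct (proj1 HOm K) as [N HN]. exists N. auto. Qed.

Lemma eventually_positive : eventually_mod (fun n => (2 <= n)%nat /\ 0 < comp_sum w n (n - 1) (fun _ => 1)).
Proof.
  apply eventually_and; [apply eventually_ge|]. exact (comp_sum_pos w g HW HG).
Qed.

Lemma eventually_inv C e : 0 < e -> eventually_mod (fun n => C / INR n <= e).
Proof.
  intros He. destruct (archimed_cor1 (e / (Rabs C + 1))) as [N [HN HN0]].
  { pose proof (Rabs_pos C). apply Rdiv_lt_0_compat; lra. }
  exists N. intros n Hn _. pose proof (Rle_abs C). pose proof (Rabs_pos C).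
  assert (0 < INR N) by (now apply lt_0_INR).
  assert (H2 : / INR n <= / INR N) by (apply Rinv_le_contravar; auto; now apply le_INR).
  assert (0 < / INR n) by (apply Rinv_0_lt_compat, lt_0_INR; lia).
  apply Rle_trans with ((Rabs C + 1) * / INR n); [apply Rmult_le_compat_r; lra|].
  apply Rmult_le_reg_l with (/ (Rabs C + 1)); [apply Rinv_0_lt_compat; lra|].
  rewrite <- Rmult_assoc, Rinv_l, Rmult_1_l by lra. unfold Rdiv in HN. lra.
Qed.

Lemma eventually_sumf {A} (f : nat -> A -> R) l :
  (forall x, In x l -> forall e, 0 < e -> eventually_mod (fun n => f n x <= e)) ->
  forall e, 0 < e -> eventually_mod (fun n => sumf (f n) l <= e).
Proof.
  induction l as [|x l IH]; intros H e He.
  - exists O. intros. unfold sumf; simpl; lra.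
  - generalize (eventually_and _ _ (H x (or_introl eq_refl) (e / 2) ltac:(lra))
      (IH (fun y Hy => H y (or_intror Hy)) (e / 2) ltac:(lra))).
    apply eventually_mono. intros n [H1 H2]. rewrite sumf_cons. lra.
Qed.

Definition dev (n : nat) (l d : list nat) : R := Rabs (prodf n l d - ppi l).

Lemma dev_symm n l : symm (dev n l).
Proof. intros d e P. unfold dev. now rewrite (prodf_symm n l d e P). Qed.

(** Telescoping over the entries of [l], with all factors between [0] and [1]. *)
Lemma dev_limit l : forall e, 0 < e -> eventually_mod (fun n => expect w n (dev n l) <= e).
Proof.
  pose proof HW as [Hw _].
  induction l as [|a l IH]; intros e He.
  - generalize eventually_positive. apply eventually_mono. intros n [Hn HB].
    rewrite (expect_ext w n (dev n []) (fun _ => 0)).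
    + rewrite expect_const; auto; lra.
    + intros. unfold dev, ppi. simpl. rewrite Rminus_diag. apply Rabs_R0.
  - generalize (eventually_and _ _ eventually_positive (eventually_and _ _ (IH (e / 2) ltac:(lra))
      (concentration w g tau mu Om HW HG HT HOm a (e / 2) ltac:(lra)))).
    apply eventually_mono. intros n [[Hn HB] [H1 H2]].
    apply Rle_trans with (expect w n (fun d => Rabs (cnt a d / INR n - pik w tau a) + dev n l d)).
    + apply expect_le; auto. intros d Hd _ _. unfold dev, ppi. simpl.
      pose proof (freq_bounds n a d ltac:(lia) Hd) as B1.
      pose proof (ppi_bounds l) as B2. unfold ppi in B2.
      set (x := cnt a d / INR n) in *. set (y := pik w tau a) in *.
      set (u := prodf n l d) in *. set (v := wprod (pik w tau) l) in *.
      replace (x * u - y * v) with ((x - y) * v + x * (u - v)) by ring.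
      eapply Rle_trans; [apply Rabs_triang|]. rewrite !Rabs_mult.
      rewrite (Rabs_pos_eq v), (Rabs_pos_eq x) by lra.
      pose proof (Rabs_pos (x - y)). pose proof (Rabs_pos (u - v)). nra.
    + rewrite expect_plus by auto. lra.
Qed.

Lemma cpre_limit l : forall e, 0 < e -> eventually_mod (fun n => Rabs (ppi l - cpre w n l) <= e).
Proof.
  pose proof HW as [Hw _]. intros e He.
  generalize (eventually_and _ _ eventually_positive (eventually_and _ _ (dev_limit l (e / 2) ltac:(lra))
      (eventually_inv (INR (length l * length l)) (e / 2) ltac:(lra)))).
  apply eventually_mono. intros n [[Hn HB] [H1 H2]].
  pose proof (sampling_expect w n Hw ltac:(lia) HB l) as H3.
  pose proof (expect_abs w n Hw HB (fun d => prodf n l d - ppi l)) as H4.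
  rewrite expect_minus, expect_const in H4 by auto.
  change (expect w n (fun d => Rabs (prodf n l d - ppi l))) with (expect w n (dev n l)) in H4.
  change (expect w n (fun d => prodf n l d)) with (expect w n (prodf n l)) in H4.
  apply Rabs_le_inv in H3, H4. apply Rabs_le. lra.
Qed.

(** Splits the size-biased sum by the value [k] of the first entry. A sum over all [k] with weight
    [k] is thereby as small as one expectation, however large [k] may be. *)
Lemma size_biased_first n f : (1 <= n)%nat -> symm f ->
  INR n * sumf (fun k => INR k * prew w [k] n (n - 1) f) (seq 0 n) =
  INR (n - 1) * comp_sum w n (n - 1) f.
Proof.
  intros Hn Hf. rewrite size_bias_sum by auto. f_equal.
  destruct n as [|n]; [lia|]. simpl minus. rewrite Nat.sub_0_r, comp_sum_S. apply sumf_ext.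
  intros k Hk. apply in_seq in Hk. simpl hd. rewrite comp_sum_scal. unfold prew.
  cbn [length list_sum fold_right]. rewrite Nat.add_0_r. simpl Nat.leb.
  destruct (Nat.leb_spec k n); [|lia]. simpl. rewrite Nat.sub_0_r. ring.
Qed.

Lemma cpre_nonneg n l : 0 < comp_sum w n (n - 1) (fun _ => 1) -> 0 <= cpre w n l.
Proof.
  intros HB. apply Rmult_le_pos; [apply pre_nonneg; [apply HW|intros; lra]|].
  left. now apply Rinv_0_lt_compat.
Qed.

Lemma first_degree_mass n : (1 <= n)%nat -> 0 < comp_sum w n (n - 1) (fun _ => 1) ->
  sumf (fun k => INR k * cpre w n [k]) (seq 0 n) <= 1.
Proof.
  intros Hn HB. pose proof (size_biased_first n (fun _ => 1) Hn (fun _ _ _ => eq_refl)) as H.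
  assert (Hn' : 0 < INR n) by (apply lt_0_INR; lia).
  set (B := comp_sum w n (n - 1) (fun _ => 1)) in *.
  assert (E : sumf (fun k => INR k * cpre w n [k]) (seq 0 n) =
    / B * sumf (fun k => INR k * prew w [k] n (n - 1) (fun _ => 1)) (seq 0 n)).
  { rewrite <- sumf_scal. apply sumf_ext. intros. unfold cpre. fold B. unfold Rdiv. ring. }
  rewrite E. assert (INR (n - 1) <= INR n) by (apply le_INR; lia).
  apply Rmult_le_reg_l with (INR n * B); [now apply Rmult_lt_0_compat|].
  replace (INR n * B * (/ B * sumf (fun k => INR k * prew w [k] n (n - 1) (fun _ => 1)) (seq 0 n)))
   with (INR n * sumf (fun k => INR k * prew w [k] n (n - 1) (fun _ => 1)) (seq 0 n)) by (field; lra).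
  rewrite H. nra.
Qed.

(** Given the first outdegree, even a huge one, the next sampled outdegrees are i.i.d. in the limit. *)
Lemma decoupling l : forall e, 0 < e -> eventually_mod (fun n =>
  sumf (fun k => INR k * Rabs (cpre w n [k] * ppi l - cpre w n (k :: l))) (seq 0 n) <= e).
Proof.
  pose proof HW as [Hw _]. intros e He.
  set (C := INR ((1 + length l) * length l)).
  generalize (eventually_and _ _ eventually_positive (eventually_and _ _ (dev_limit l (e / 2) ltac:(lra))
      (eventually_inv C (e / 2) ltac:(lra)))).
  apply eventually_mono. intros n [[Hn HB] [H1 H2]].
  assert (Hn' : 0 < INR n) by (apply lt_0_INR; lia).
  unfold expect in H1. set (B := comp_sum w n (n - 1) (fun _ => 1)) in *.
  assert (HB' : 0 < / B) by (now apply Rinv_0_lt_compat).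
  apply Rle_trans with (sumf (fun k => C / INR n * (INR k * cpre w n [k]) +
     / B * (INR k * prew w [k] n (n - 1) (dev n l))) (seq 0 n)).
  (* For each [k] the error has two parts: sampling, of order [C / INR n], and the deviation
     restricted to sequences that begin with [k]. *)
  - apply sumf_le. intros k _. pose proof (pos_INR k) as Hk.
    pose proof (sampling w Hw l [k] n (n - 1) (fun _ => 1) ltac:(lia) (fun _ _ _ => eq_refl)
      ltac:(intros; lra)) as H3.
    change ([k] ++ l) with (k :: l) in H3. change (length [k]) with 1%nat in H3. fold C in H3.
    cbv beta in H3.
    rewrite (pre_ext w Hw [k] n (n - 1) (fun d => prodf n l d * 1) (prodf n l)) in H3 by (intros; ring).
    pose proof (pre_abs w Hw [k] n (n - 1) (fun d => prodf n l d - ppi l)) as H4.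
    rewrite pre_minus in H4.
    rewrite (pre_ext w Hw [k] n (n - 1) (fun _ => ppi l) (fun _ => ppi l * 1)) in H4 by (intros; ring).
    rewrite pre_scal in H4.
    change (prew w [k] n (n - 1) (fun d => Rabs (prodf n l d - ppi l))) with
      (prew w [k] n (n - 1) (dev n l)) in H4.
    change (prew w [k] n (n - 1) (fun d => prodf n l d)) with
      (prew w [k] n (n - 1) (prodf n l)) in H4.
    unfold cpre. fold B.
    set (P1 := prew w [k] n (n - 1) (fun _ => 1)) in *.
    set (P2 := prew w (k :: l) n (n - 1) (fun _ => 1)) in *.
    set (P3 := prew w [k] n (n - 1) (prodf n l)) in *.
    set (P4 := prew w [k] n (n - 1) (dev n l)) in *.
    replace (P1 / B * ppi l - P2 / B) with (/ B * (P1 * ppi l - P2)) by (field; lra).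
    rewrite Rabs_mult, (Rabs_pos_eq (/ B)) by lra.
    replace (C / INR n * (INR k * (P1 / B)) + / B * (INR k * P4)) with
      (INR k * (/ B * (C / INR n * P1 + P4))) by (field; lra).
    apply Rmult_le_compat_l; auto. apply Rmult_le_compat_l; [lra|].
    apply Rabs_le_inv in H3, H4. apply Rabs_le. lra.
  - rewrite sumf_plus, !sumf_scal.
    pose proof (first_degree_mass n ltac:(lia) HB) as H5.
    pose proof (size_biased_first n (dev n l) ltac:(lia) (dev_symm n l)) as H6.
    assert (HC : 0 <= C / INR n).
    { apply Rmult_le_pos; [apply pos_INR|]. left. now apply Rinv_0_lt_compat. }
    assert (Hd : 0 <= comp_sum w n (n - 1) (dev n l)) by (apply comp_sum_nonneg; auto; intros; apply Rabs_pos).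
    set (S1 := sumf (fun k => INR k * cpre w n [k]) (seq 0 n)) in *.
    set (S2 := sumf (fun k => INR k * prew w [k] n (n - 1) (dev n l)) (seq 0 n)) in *.
    assert (H7 : S2 <= comp_sum w n (n - 1) (dev n l)).
    { apply Rmult_le_reg_l with (INR n); auto. rewrite H6. apply Rmult_le_compat_r; auto.
      apply le_INR; lia. }
    assert (H8 : / B * S2 <= / B * comp_sum w n (n - 1) (dev n l)) by (apply Rmult_le_compat_l; lra).
    assert (H9 : C / INR n * S1 <= C / INR n * 1) by (apply Rmult_le_compat_l; lra).
    unfold Rdiv in H1. lra.
Qed.

(** By size biasing the sum is the expected normalised sum of the degrees above [Om n]. The
    hypothesis on [Om], taken at the sequence [Om] itself, gives its limit in probability, and
    boundedness by [1] gives the limit in mean. *)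
Lemma high_mean : forall e, 0 < e -> eventually_mod (fun n =>
  Rabs (sumf (fun k => INR k * cpre w n [k]) (seq (S (Om n)) (n - 1 - Om n)) - (1 - mu)) <= e).
Proof.
  pose proof HW as [Hw _]. intros e He.
  destruct (offspring_law w tau mu HW HT) as [_ [Hmu _]].
  assert (Hev : eventually_mod (fun n => Tprob w n (fun t =>
     Rltb (e / 2 * INR n) (Rabs (high_sum t (Om n) - (1 - mu) * INR n))) < e / 2)).
  { destruct HOm as [H1 [_ H3]]. destruct (H3 Om H1 (fun n => Nat.le_refl _)) as [_ H4].
    destruct (H4 (e / 2) (e / 2) ltac:(lra) ltac:(lra)) as [N HN]. exists N. exact HN. }
  generalize (eventually_and _ _ eventually_positive (eventually_and _ _ Hev
     (eventually_and _ _ (eventually_ge 1) (eventually_ge 1)))).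
  apply eventually_mono. intros n [[Hn HB] [H1 _]].
  assert (Hn' : 0 < INR n) by (apply lt_0_INR; lia).
  rewrite (Tprob_expect w n ltac:(lia) HB _
    (fun d => Rltb (e / 2 * INR n) (Rabs (highl (Om n) d - (1 - mu) * INR n)))) in H1.
  2: { intros t. now rewrite high_sum_degs. }
  2: { apply Rltb_symm, highl_symm. }
  assert (E : sumf (fun k => INR k * cpre w n [k]) (seq (S (Om n)) (n - 1 - Om n)) =
    expect w n (fun d => highl (Om n) d / INR n)).
  { set (h := fun k => if Nat.leb k (Om n) then 0 else INR k).
    assert (E1 : comp_sum w n (n - 1) (highl (Om n)) =
       INR n * sumf (fun k => h k * prew w [k] n (n - 1) (fun _ => 1)) (seq 0 n)).
    { rewrite (comp_sum_ext w n (n - 1) (highl (Om n)) (fun d => sumf h d * 1))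
        by (intros; unfold highl, h; ring).
      rewrite size_bias by (intros ? ? ?; reflexivity). f_equal.
      destruct n as [|n']; [lia|]. simpl minus. rewrite Nat.sub_0_r, comp_sum_S. apply sumf_ext.
      intros k Hk. apply in_seq in Hk. simpl hd. rewrite comp_sum_scal. unfold prew.
      cbn [length list_sum fold_right]. rewrite Nat.add_0_r. simpl Nat.leb.
      destruct (Nat.leb_spec k n'); [|lia]. simpl. rewrite Nat.sub_0_r. ring. }
    unfold expect. rewrite (comp_sum_ext w n (n - 1) (fun d => highl (Om n) d / INR n)
      (fun d => / INR n * highl (Om n) d)) by (intros; unfold Rdiv; ring).
    rewrite comp_sum_scal, E1, <- Rmult_assoc, Rinv_l, Rmult_1_l by lra.
    unfold cpre, Rdiv. rewrite Rmult_comm, <- sumf_scal.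
    destruct (Nat.le_gt_cases (S (Om n)) n) as [Hc|Hc].
    - rewrite (seq_split 0 n (S (Om n)) Hc), sumf_app.
      replace (n - S (Om n))%nat with (n - 1 - Om n)%nat by lia. simpl plus.
      rewrite (sumf_0 _ (seq 0 (S (Om n)))), Rplus_0_l.
      + apply sumf_ext. intros k Hk. apply in_seq in Hk. unfold h.
        destruct (Nat.leb_spec k (Om n)); [lia|]. ring.
      + intros k Hk. apply in_seq in Hk. unfold h.
        destruct (Nat.leb_spec k (Om n)); [ring|lia].
    - replace (n - 1 - Om n)%nat with O by lia. symmetry. apply sumf_0.
      intros k Hk. apply in_seq in Hk. unfold h.
      destruct (Nat.leb_spec k (Om n)); [ring|lia]. }
  rewrite E.
  pose proof (expect_deviation w n Hw ltac:(lia) HB (highl (Om n)) (1 - mu) (e / 2) 1 ltac:(lra)) as H2.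
  pose proof (expect_abs w n Hw HB (fun d => highl (Om n) d / INR n - (1 - mu))) as H3.
  rewrite expect_minus, expect_const in H3 by auto.
  eapply Rle_trans; [exact H3|]. eapply Rle_trans; [apply H2|].
  - intros d Hl Hs. assert (H4 : 0 <= highl (Om n) d <= INR n).
    { split.
      - apply sumf_nonneg. intros k _. destruct (Nat.leb k (Om n)); [lra|apply pos_INR].
      - apply Rle_trans with (INR (list_sum d)); [|apply le_INR; lia]. rewrite <- sumf_INR.
        apply sumf_le. intros k _. destruct (Nat.leb k (Om n)); [apply pos_INR|lra]. }
    assert (0 <= highl (Om n) d / INR n <= 1).
    { split.
      - apply Rmult_le_pos; [tauto|]. left. now apply Rinv_0_lt_compat.
      - apply Rmult_le_reg_r with (INR n); auto. unfold Rdiv. rewrite Rmult_assoc, Rinv_l; lra. }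
    apply Rabs_le. lra.
  - lra.
Qed.

Definition Dt (n k : nat) : R := fst (Dtilde_law w n (Om n) k).
(** All degrees above [Om n] that a tree with [n] vertices can have; empty when [Om n >= n - 1], by
    truncated subtraction. *)
Definition Dl (n : nat) : list nat := seq (S (Om n)) (n - 1 - Om n).

Lemma root_law n k : (2 <= n)%nat -> 0 < comp_sum w n (n - 1) (fun _ => 1) ->
  INR (n - 1) * Tprob w n (fun t => Nat.eqb (deg t []) k) = INR n * (INR k * cpre w n [k]).
Proof.
  intros Hn HB. rewrite Tprob_sumf. pose proof (root_degree w n k Hn) as H.
  pose proof (Zn_pos w n ltac:(lia) HB) as HZ. pose proof (Zn_comp_sum w n ltac:(lia)) as HZB.
  unfold cpre. rewrite <- HZB in *. assert (Hn' : 0 < INR n) by (apply lt_0_INR; lia).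
  set (X := sumf _ (trees_n n)) in *.
  replace (INR (n - 1) * (X / Zn w n)) with ((INR (n - 1) * X) / Zn w n) by (field; lra).
  rewrite H. field. lra.
Qed.

Lemma root_big n : (1 <= n)%nat ->
  Tprob w n (fun t => Nat.ltb (Om n) (deg t [])) =
  sumf (fun k => Tprob w n (fun t => Nat.eqb (deg t []) k)) (Dl n).
Proof.
  intros Hn. rewrite Tprob_sumf.
  rewrite (sumf_ext (fun k => Tprob w n (fun t => Nat.eqb (deg t []) k))
    (fun k => / Zn w n * sumf (fun t => tweight w t * indic (Nat.eqb (deg t []) k)) (trees_n n)))
    by (intros; rewrite Tprob_sumf; unfold Rdiv; ring).
  rewrite sumf_scal, sumf_exchange. unfold Rdiv. rewrite Rmult_comm. f_equal.
  apply sumf_ext. intros t Ht. rewrite sumf_scal. f_equal.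
  apply in_trees_n in Ht.
  assert (Hd : (deg t [] <= n - 1)%nat).
  { destruct t as [ts]. unfold deg. simpl. rewrite tsize_Node in Ht.
    pose proof (length_le_fsize ts). lia. }
  destruct (Nat.ltb_spec (Om n) (deg t [])).
  - rewrite (sumf_single _ (deg t [])); [now rewrite Nat.eqb_refl|apply seq_NoDup|apply in_seq; lia|].
    intros y _ Hy. replace (Nat.eqb (deg t []) y) with false; [reflexivity|].
    symmetry. apply Nat.eqb_neq. auto.
  - symmetry. apply sumf_0. intros y Hy. apply in_seq in Hy.
    replace (Nat.eqb (deg t []) y) with false; [reflexivity|].
    symmetry. apply Nat.eqb_neq. lia.
Qed.

Lemma Dt_eq n k : In k (Dl n) -> Dt n k =
  Tprob w n (fun t => Nat.eqb (deg t []) k) / Tprob w n (fun t => Nat.ltb (Om n) (deg t [])).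
Proof.
  intros Hk. apply in_seq in Hk. unfold Dt, Dtilde_law. simpl fst.
  destruct (Nat.ltb_spec (Om n) k); [reflexivity|lia].
Qed.

(** On big degrees [Dt n k] and [INR k * cpre w n [k]] are both proportional to the law of the root
    degree. Their distance after scaling is therefore a difference of total masses, which
    [high_mean] controls. *)
Lemma Dt_limit : forall e, 0 < e -> eventually_mod (fun n =>
  sumf (fun k => Rabs ((1 - mu) * Dt n k - INR k * cpre w n [k])) (Dl n) <= e /\
  sumf (Dt n) (Dl n) = 1 /\ forall k, In k (Dl n) -> 0 <= Dt n k).
Proof.
  pose proof HW as [Hw _]. intros e He.
  destruct (offspring_law w tau mu HW HT) as [_ [Hmu _]].
  (* The cap [(1 - mu) / 2] makes the probability of a big root positive, so that conditioning on it
     is meaningful. *)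
  set (e' := Rmin e ((1 - mu) / 2)).
  assert (He' : 0 < e') by (apply Rmin_pos; lra).
  generalize (eventually_and _ _ eventually_positive (high_mean e' He')).
  apply eventually_mono. intros n [[Hn HB] H].
  assert (e' <= e) by apply Rmin_l. assert (e' <= (1 - mu) / 2) by apply Rmin_r.
  fold (Dl n) in H.
  assert (Hn' : 0 < INR n) by (apply lt_0_INR; lia).
  assert (Hn1 : 0 < INR (n - 1)) by (apply lt_0_INR; lia).
  pose proof (root_big n ltac:(lia)) as HT1.
  set (Tb := Tprob w n (fun t => Nat.ltb (Om n) (deg t []))) in *.
  set (T := fun k => Tprob w n (fun t => Nat.eqb (deg t []) k)) in *.
  assert (HTk : forall k, INR k * cpre w n [k] = INR (n - 1) / INR n * T k).
  { intros k. pose proof (root_law n k Hn HB) as H2. fold (T k) in H2.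
    apply Rmult_eq_reg_l with (INR n); [|lra]. rewrite <- H2. field. lra. }
  assert (HS : sumf (fun k => INR k * cpre w n [k]) (Dl n) = INR (n - 1) / INR n * Tb).
  { rewrite HT1, <- sumf_scal. apply sumf_ext. intros; apply HTk. }
  rewrite HS in H. apply Rabs_le_inv in H.
  assert (Hr : 0 < INR (n - 1) / INR n) by (now apply Rdiv_lt_0_compat).
  assert (HTb : 0 < Tb).
  { apply Rnot_le_lt. intros Hle. assert (INR (n - 1) / INR n * Tb <= 0) by nra. lra. }
  assert (HTpos : forall k, 0 <= T k).
  { intros k. pose proof (HTk k) as H3. pose proof (cpre_nonneg n [k] HB). pose proof (pos_INR k).
    assert (0 <= INR k * cpre w n [k]) by (now apply Rmult_le_pos).
    apply Rmult_le_reg_l with (INR (n - 1) / INR n); auto. lra. }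
  split; [|split].
  - rewrite (sumf_ext _ (fun k => Rabs ((1 - mu) / Tb - INR (n - 1) / INR n) * T k)).
    + rewrite sumf_scal. change (sumf (fun k => T k) (Dl n)) with (sumf T (Dl n)).
      rewrite <- HT1. rewrite <- (Rabs_pos_eq Tb) at 2 by lra. rewrite <- Rabs_mult.
      replace (((1 - mu) / Tb - INR (n - 1) / INR n) * Tb) with
        ((1 - mu) - INR (n - 1) / INR n * Tb) by (field; lra).
      apply Rabs_le. lra.
    + intros k Hk. rewrite (Dt_eq n k Hk), HTk. fold (T k). fold Tb.
      rewrite <- (Rabs_pos_eq (T k)) at 3 by apply HTpos. rewrite <- Rabs_mult. f_equal. field. lra.
  - rewrite (sumf_ext _ (fun k => / Tb * T k)).
    + rewrite sumf_scal. change (sumf (fun k => T k) (Dl n)) with (sumf T (Dl n)).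
      rewrite <- HT1. field. lra.
    + intros k Hk. rewrite (Dt_eq n k Hk). fold (T k). fold Tb. unfold Rdiv. ring.
  - intros k Hk. rewrite (Dt_eq n k Hk). fold (T k). fold Tb.
    apply Rmult_le_pos; auto. left. now apply Rinv_0_lt_compat.
Qed.

(** [/ INR k] is the chance of one position among the [k] children; the weight [INR k] pays for all
    positions at once. *)
Lemma big_root l : forall e, 0 < e -> eventually_mod (fun n =>
  sumf (fun k => INR k * Rabs ((1 - mu) * Dt n k / INR k * ppi l - cpre w n (k :: l))) (Dl n) <= e).
Proof.
  pose proof HW as [Hw _]. intros e He.
  generalize (eventually_and _ _ eventually_positive (eventually_and _ _ (decoupling l (e / 2) ltac:(lra))
    (Dt_limit (e / 2) ltac:(lra)))).
  apply eventually_mono. intros n [[Hn HB] [H1 [H2 _]]].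
  assert (H3 : sumf (fun k => INR k * Rabs (cpre w n [k] * ppi l - cpre w n (k :: l))) (Dl n) <=
    sumf (fun k => INR k * Rabs (cpre w n [k] * ppi l - cpre w n (k :: l))) (seq 0 n)).
  { apply sumf_incl; [apply seq_NoDup| |].
    - intros k Hk. apply in_seq in Hk. apply in_seq. lia.
    - intros k _. apply Rmult_le_pos; [apply pos_INR|apply Rabs_pos]. }
  apply Rle_trans with (sumf (fun k => Rabs ((1 - mu) * Dt n k - INR k * cpre w n [k]) +
     INR k * Rabs (cpre w n [k] * ppi l - cpre w n (k :: l))) (Dl n)); [|rewrite sumf_plus; lra].
  apply sumf_le. intros k Hk. apply in_seq in Hk.
  assert (Hk' : 0 < INR k) by (apply lt_0_INR; lia).
  pose proof (ppi_bounds l) as Hp.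
  rewrite <- (Rabs_pos_eq (INR k)) at 1 4 by lra. rewrite <- !Rabs_mult.
  replace (INR k * ((1 - mu) * Dt n k / INR k * ppi l - cpre w n (k :: l))) with
    (((1 - mu) * Dt n k - INR k * cpre w n [k]) * ppi l +
     INR k * (cpre w n [k] * ppi l - cpre w n (k :: l))) by (field; lra).
  eapply Rle_trans; [apply Rabs_triang|]. apply Rplus_le_compat_r.
  rewrite Rabs_mult, (Rabs_pos_eq (ppi l)) by lra.
  pose proof (Rabs_pos ((1 - mu) * Dt n k - INR k * cpre w n [k])). nra.
Qed.

End Limits.

(** * Discrete laws and finite families of atoms *)

(** Cantor's formula for the diagonal enumeration; injectivity and bounds are read off from it. *)
Lemma unpair_spec k : let (i, j) := unpair k in (2 * k = (i + j) * (i + j + 1) + 2 * j)%nat.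
Proof.
  induction k as [|k IH]; [reflexivity|]. simpl unpair.
  destruct (unpair k) as [[|i] j]; nia.
Qed.

Lemma unpair_inj k k' : unpair k = unpair k' -> k = k'.
Proof.
  intros H. pose proof (unpair_spec k) as H1. pose proof (unpair_spec k') as H2.
  rewrite H in H1. destruct (unpair k'). lia.
Qed.

Lemma unpair_bound k : (fst (unpair k) <= k)%nat /\ (snd (unpair k) <= k)%nat.
Proof. pose proof (unpair_spec k) as H. destruct (unpair k) as [i j]. simpl. nia. Qed.

Lemma unpair_surj i j : exists k, unpair k = (i, j).
Proof.
  assert (H : forall s j, (j <= s)%nat -> exists k, unpair k = ((s - j)%nat, j)).
  { induction s as [|s IHs].
    - intros [|]; [exists O; reflexivity|lia].
    - induction j0 as [|j0 IHj]; intros Hj.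
      + destruct (IHs s (Nat.le_refl s)) as [k Hk]. rewrite Nat.sub_diag in Hk.
        exists (S k). simpl. now rewrite Hk.
      + destruct IHj as [k Hk]; [lia|]. exists (S k). simpl unpair. rewrite Hk.
        replace (S s - j0)%nat with (S (S s - S j0)) by lia. reflexivity. }
  destruct (H (i + j)%nat j ltac:(lia)) as [k Hk]. exists k. rewrite Hk. f_equal. lia.
Qed.

Lemma unpair_lift ps : exists ks, map unpair ks = ps.
Proof.
  induction ps as [|[i j] ps [ks IH]]; [now exists []|].
  destruct (unpair_surj i j) as [k Hk]. exists (k :: ks). simpl. now rewrite Hk, IH.
Qed.

(** Distinctness concerns indices, not outcomes: one outcome may sit at several atoms of [d]. *)
Definition subfamily {A} (l : list (R * A)) (d : Defs.dist A) : Prop :=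
  exists is, NoDup is /\ map d is = l.

(** An upper bound on mass that is stable under binding; together with a lower bound for a finite
    family it limits what lies outside the family. *)
Definition submass {A} (d : Defs.dist A) : Prop :=
  (forall i, 0 <= fst (d i)) /\ forall N, sumf (fun i => fst (d i)) (seq 0 N) <= 1.

Definition lbind {A B} (l : list (R * A)) (f : A -> list (R * B)) : list (R * B) :=
  flat_map (fun pa => map (fun qb => (fst pa * fst qb, snd qb)) (f (snd pa))) l.

Definition lret {A} (a : A) : list (R * A) := [(1, a)].

Definition lmap {A B} (f : A -> B) (l : list (R * A)) : list (R * B) :=
  map (fun pa => (fst pa, f (snd pa))) l.

Definition lmass {A} (l : list (R * A)) : R := sumf fst l.

Definition supp {A} (l : list (R * A)) : list A := map snd l.

Lemma supp_lbind {A B} (l : list (R * A)) (f : A -> list (R * B)) :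
  supp (lbind l f) = flat_map (fun a => supp (f a)) (supp l).
Proof.
  unfold supp, lbind. induction l as [|[p a] l IH]; [reflexivity|].
  simpl. rewrite map_app, IH, map_map. reflexivity.
Qed.

Lemma supp_lmap {A B} (f : A -> B) l : supp (lmap f l) = map f (supp l).
Proof. unfold supp, lmap. now rewrite !map_map. Qed.

Lemma sumf_lbind {A B} (h : R * B -> R) (l : list (R * A)) (f : A -> list (R * B)) :
  sumf h (lbind l f) =
  sumf (fun pa => sumf (fun qb => h (fst pa * fst qb, snd qb)) (f (snd pa))) l.
Proof. unfold lbind. rewrite sumf_flat_map. apply sumf_ext. intros. now rewrite sumf_map. Qed.

Lemma sumf_lmap {A B} (h : R * B -> R) (f : A -> B) l :
  sumf h (lmap f l) = sumf (fun pa => h (fst pa, f (snd pa))) l.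
Proof. unfold lmap. now rewrite sumf_map. Qed.

Lemma NoDup_supp_lbind {A B} (l : list (R * A)) (f : A -> list (R * B)) :
  NoDup (supp l) -> (forall a, In a (supp l) -> NoDup (supp (f a))) ->
  (forall a a' b, In a (supp l) -> In a' (supp l) -> In b (supp (f a)) -> In b (supp (f a')) -> a = a') ->
  NoDup (supp (lbind l f)).
Proof. intros. rewrite supp_lbind. now apply NoDup_flat_map. Qed.

Lemma sub_ret {A} (a : A) : subfamily (lret a) (dret a).
Proof. exists [O]. split; [repeat constructor; auto|reflexivity]. Qed.

Lemma sub_map {A B} (f : A -> B) l d : subfamily l d -> subfamily (lmap f l) (dmap f d).
Proof.
  intros [is [Hn <-]]. exists is. split; auto. unfold lmap. rewrite map_map. apply map_ext.
  intros i. unfold dmap. destruct (d i); reflexivity.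
Qed.

Lemma sub_bind {A B} l d (l2 : A -> list (R * B)) f :
  subfamily l d -> (forall a, In a (supp l) -> subfamily (l2 a) (f a)) -> subfamily (lbind l l2) (dbind d f).
Proof.
  intros [is [Hn <-]] H2.
  set (at_pair := fun p : nat * nat => let (i, j) := p in
      (fst (d i) * fst (f (snd (d i)) j), snd (f (snd (d i)) j))).
  assert (H : exists ps, NoDup ps /\ (forall p, In p ps -> In (fst p) is) /\
     map at_pair ps = lbind (map d is) l2).
  { clear - Hn H2. induction is as [|i is IH].
    - exists []. repeat split; [constructor|intros p []].
    - inversion_clear Hn as [|? ? Hi Hn']. destruct IH as [ps [H3 [H4 H5]]]; auto.
      { intros a Ha. apply H2. now right. }
      destruct (H2 (snd (d i))) as [js [Hj1 Hj2]]; [now left|].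
      exists (map (pair i) js ++ ps). repeat split.
      + apply NoDup_app; auto.
        * apply NoDup_map_inj; auto. intros; congruence.
        * intros p Hp Hp'. apply in_map_iff in Hp. destruct Hp as [j [<- _]].
          apply H4 in Hp'. contradiction.
      + intros p Hp. apply in_app_or in Hp. destruct Hp as [Hp|Hp].
        * apply in_map_iff in Hp. destruct Hp as [j [<- _]]. now left.
        * right. auto.
      + rewrite map_app, H5, map_map. unfold lbind at 2. simpl. f_equal.
        rewrite <- Hj2, map_map. reflexivity. }
  (* Pairs of indices become indices of [dbind], since [unpair] is onto. *)
  destruct H as [ps [H3 [_ H5]]]. destruct (unpair_lift ps) as [ks Hks]. exists ks. split.
  - apply NoDup_map_inv with (f := unpair). now rewrite Hks.
  - rewrite <- H5, <- Hks, map_map. apply map_ext. intros k. unfold dbind, at_pair.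
    destruct (unpair k) as [i j]. destruct (d i) as [p a]. simpl. destruct (f a j). reflexivity.
Qed.

Lemma submass_list {A} (d : Defs.dist A) is : submass d -> NoDup is -> sumf (fun i => fst (d i)) is <= 1.
Proof.
  intros [H1 H2] Hn. apply Rle_trans with (sumf (fun i => fst (d i)) (seq 0 (S (list_max is)))); auto.
  apply sumf_incl; auto. intros i Hi. apply in_seq.
  assert (i <= list_max is)%nat; [|lia].
  pose proof (proj1 (list_max_le is (list_max is)) (Nat.le_refl _)) as H.
  rewrite Forall_forall in H. auto.
Qed.

Lemma submass_ret {A} (a : A) : submass (dret a).
Proof.
  split.
  - intros [|i]; simpl; lra.
  - intros [|N]; [unfold sumf; simpl; lra|]. change (seq 0 (S N)) with (0%nat :: seq 1 N).
    rewrite sumf_cons, sumf_0; [simpl; lra|].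
    intros [|i] Hi; [apply in_seq in Hi; lia|reflexivity].
Qed.

Lemma submass_map {A B} (f : A -> B) d : submass d -> submass (dmap f d).
Proof.
  assert (E : forall i, fst (dmap f d i) = fst (d i)).
  { intros i. unfold dmap. destruct (d i); reflexivity. }
  intros [H1 H2]. split.
  - intros i. now rewrite E.
  - intros N. rewrite (sumf_ext _ (fun i => fst (d i))); auto.
Qed.

Lemma submass_bind {A B} (d : Defs.dist A) (f : A -> Defs.dist B) :
  submass d -> (forall a, submass (f a)) -> submass (dbind d f).
Proof.
  intros [H1 H2] Hf.
  set (q := fun p : nat * nat => fst (d (fst p)) * fst (f (snd (d (fst p))) (snd p))).
  assert (E : forall k, fst (dbind d f k) = q (unpair k)).
  { intros k. unfold dbind, q. destruct (unpair k) as [i j]. simpl. destruct (d i) as [p a]. simpl.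
    destruct (f a j). reflexivity. }
  assert (Hq : forall p, 0 <= q p).
  { intros p. apply Rmult_le_pos; auto. apply Hf. }
  split; [intros k; now rewrite E|]. intros N.
  rewrite (sumf_ext _ (fun k => q (unpair k))) by auto. rewrite <- (sumf_map q unpair).
  (* The first [N] indices decode into the square of side [N], over which the mass is a double
     sum. *)
  apply Rle_trans with (sumf q (flat_map (fun i => map (pair i) (seq 0 N)) (seq 0 N))).
  - apply sumf_incl; auto.
    + apply NoDup_map_inj; [apply seq_NoDup|]. intros; now apply unpair_inj.
    + intros p Hp. apply in_map_iff in Hp. destruct Hp as [k [<- Hk]]. apply in_seq in Hk.
      pose proof (unpair_bound k). apply in_flat_map. exists (fst (unpair k)).
      split; [apply in_seq; lia|]. destruct (unpair k) as [i j]. simpl in *.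
      apply in_map, in_seq. lia.
  - rewrite sumf_flat_map. apply Rle_trans with (sumf (fun i => fst (d i)) (seq 0 N)); auto.
    apply sumf_le. intros i _. rewrite sumf_map. unfold q. simpl. rewrite sumf_scal.
    rewrite <- (Rmult_1_r (fst (d i))) at 2. apply Rmult_le_compat_l; auto. apply Hf.
Qed.

Lemma submass_uniform k : submass (uniform k).
Proof.
  split.
  - intros i. unfold uniform. destruct (Nat.ltb_spec i k); simpl; [|lra].
    left. apply Rinv_0_lt_compat, lt_0_INR. lia.
  - intros N. apply Rle_trans with (sumf (fun i => fst (uniform k i)) (seq 0 k)).
    + destruct (Nat.le_gt_cases N k).
      * apply sumf_incl; [apply seq_NoDup| |].
        -- intros i Hi. apply in_seq in Hi. apply in_seq. lia.
        -- intros i Hi. apply in_seq in Hi. unfold uniform. destruct (Nat.ltb_spec i k); simpl; [|lra].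
           left. apply Rinv_0_lt_compat, lt_0_INR. lia.
      * right. apply sumf_seq_cut; [lia|]. intros i Hi. unfold uniform.
        destruct (Nat.ltb_spec i k); [lia|reflexivity].
    + destruct (Nat.eq_dec k 0) as [->|Hk]; [unfold sumf; simpl; lra|].
      rewrite (sumf_ext _ (fun _ => / INR k)).
      * rewrite sumf_const, length_seq, Rinv_r; [lra|]. now apply not_0_INR.
      * intros i Hi. apply in_seq in Hi. unfold uniform. destruct (Nat.ltb_spec i k); [reflexivity|lia].
Qed.

(** Atoms outside the finite family carry mass at most [e], since the total is at most [1]. *)
Lemma law_sandwich {A} (d : Defs.dist A) l e E p : submass d -> subfamily l d -> 1 - e <= lmass l ->
  dprob_is d E p ->
  sumf (fun qa => fst qa * indic (E (snd qa))) l <= p <=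
  sumf (fun qa => fst qa * indic (E (snd qa))) l + e.
Proof.
  intros Hd [is [Hn <-]] Hm Hp. unfold lmass in Hm. rewrite sumf_map in Hm. rewrite sumf_map.
  set (m := fun i => fst (d i)) in *. set (b := fun i => indic (E (snd (d i)))) in *.
  change (sumf (fun x => fst (d x)) is) with (sumf m is) in Hm.
  change (sumf (fun x => fst (d x) * indic (E (snd (d x)))) is) with (sumf (fun i => m i * b i) is).
  assert (Hm0 : forall i, 0 <= m i) by (intros; apply Hd).
  assert (Hb : forall i, 0 <= b i <= 1) by (intros; apply indic_bounds).
  assert (Hmb : forall i, 0 <= m i * b i) by (intros; apply Rmult_le_pos; auto; apply Hb).
  assert (HP : infinite_sum (fun i => m i * b i) p).
  { eapply infinite_sum_ext; [|exact Hp]. intros i. unfold m, b. simpl.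
    destruct (d i) as [q a]. simpl. destruct (E a); simpl; ring. }
  split.
  - apply Rle_trans with (psum (fun i => m i * b i) (list_max is)).
    + apply sumf_incl; auto. intros i Hi. apply in_seq.
      pose proof (proj1 (list_max_le is (list_max is)) (Nat.le_refl _)) as H.
      rewrite Forall_forall in H. specialize (H i Hi). lia.
    + apply psum_le_infinite; auto.
  - apply (infinite_sum_le_bound _ _ _ HP). intros K.
    set (out := filter (fun i => if in_dec Nat.eq_dec i is then false else true) (seq 0 (S K))).
    assert (Hout : forall i, In i out -> ~ In i is).
    { intros i Hi. apply filter_In in Hi. destruct Hi as [_ Hi].
      destruct (in_dec Nat.eq_dec i is); [discriminate|auto]. }
    assert (Hno : NoDup (is ++ out)).
    { apply NoDup_app; auto; [apply NoDup_filter, seq_NoDup|]. intros i Hi Hi'. now apply (Hout i). }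
    pose proof (submass_list d _ Hd Hno) as H1. rewrite sumf_app in H1.
    change (sumf (fun i => fst (d i)) is) with (sumf m is) in H1.
    change (sumf (fun i => fst (d i)) out) with (sumf m out) in H1.
    apply Rle_trans with (sumf (fun i => m i * b i) (is ++ out)).
    + apply sumf_incl; [apply seq_NoDup| |auto]. intros i Hi. apply in_or_app.
      destruct (in_dec Nat.eq_dec i is) as [H|H]; auto. right. apply filter_In. split; auto.
      destruct (in_dec Nat.eq_dec i is); [contradiction|reflexivity].
    + rewrite sumf_app. apply Rplus_le_compat_l. apply Rle_trans with (sumf m out); [|lra].
      apply sumf_le. intros i _. specialize (Hb i). specialize (Hm0 i). nra.
Qed.

Definition lnonneg {A} (l : list (R * A)) : Prop := forall pa, In pa l -> 0 <= fst pa.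

Lemma lnonneg_bind {A B} (l : list (R * A)) (f : A -> list (R * B)) :
  lnonneg l -> (forall a, In a (supp l) -> lnonneg (f a)) -> lnonneg (lbind l f).
Proof.
  intros Hl Hf pb Hpb. apply in_flat_map in Hpb. destruct Hpb as [pa [Hpa Hpb]].
  apply in_map_iff in Hpb. destruct Hpb as [qb [<- Hqb]]. simpl. apply Rmult_le_pos; auto.
  apply (Hf (snd pa)); auto. now apply in_map.
Qed.

Lemma lnonneg_sub {A} (l : list (R * A)) d : submass d -> subfamily l d -> lnonneg l.
Proof.
  intros [H _] [is [_ <-]] pa Hpa. apply in_map_iff in Hpa. destruct Hpa as [i [<- _]]. auto.
Qed.

Lemma lmass_nonneg {A} (l : list (R * A)) : lnonneg l -> 0 <= lmass l.
Proof. intros H. now apply sumf_nonneg. Qed.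

Lemma lmass_lret {A} (a : A) : lmass (lret a) = 1.
Proof. unfold lmass, lret, sumf. simpl. lra. Qed.

Lemma lmass_lmap {A B} (f : A -> B) l : lmass (lmap f l) = lmass l.
Proof. unfold lmass. now rewrite sumf_lmap. Qed.

Lemma lmass_bind {A B} (l : list (R * A)) (f : A -> list (R * B)) x y :
  0 <= x -> 0 <= y -> lnonneg l -> (forall a, In a (supp l) -> lnonneg (f a)) ->
  1 - x <= lmass l -> (forall a, In a (supp l) -> 1 - y <= lmass (f a)) ->
  1 - (x + y) <= lmass (lbind l f).
Proof.
  intros Hx Hy Hl Hf Hlx Hfy.
  (* If [1 - (x + y)] is positive then so is [1 - y], and the two bounds can be multiplied;
     otherwise nonnegativity suffices. *)
  destruct (Rle_or_lt (1 - (x + y)) 0) as [H|H].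
  { apply Rle_trans with 0; auto. apply lmass_nonneg. now apply lnonneg_bind. }
  apply Rle_trans with ((1 - y) * lmass l); [nra|].
  unfold lmass. rewrite sumf_lbind, <- sumf_scal. apply sumf_le. intros pa Hpa.
  simpl. rewrite sumf_scal, Rmult_comm. apply Rmult_le_compat_l; auto.
  apply Hfy. now apply in_map.
Qed.

(** * Windows of pointed trees *)

(** Children that were not observed become [Any]: the pattern fixes each observed outdegree and
    nothing else. *)
Fixpoint topat (t : ptree) : pat :=
  match t with PNode k kids => PN (map topat kids ++ repeat Any (k - length kids)) end.

Definition opat (o : option ptree) : pat := match o with Some c => topat c | None => Any end.

Definition odegs (o : option ptree) : list nat := pdegs (opat o).

(** What [gw] observes, read off from a given tree. *)
Fixpoint pwin (M d : nat) (t : tree) : ptree :=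
  match t with Node ts =>
    PNode (length ts) (match d with O => [] | S d' => map (pwin M d') (firstn M ts) end) end.

Lemma flat_map_pdegs_repeat j : flat_map pdegs (repeat Any j) = [].
Proof. induction j; auto. Qed.

Lemma pdegs_topat k kids : (length kids <= k)%nat ->
  pdegs (topat (PNode k kids)) = k :: flat_map (fun c => pdegs (topat c)) kids.
Proof.
  intros H. cbn [topat pdegs]. rewrite length_app, length_map, repeat_length.
  f_equal; [lia|]. rewrite flat_map_app, flat_map_pdegs_repeat, app_nil_r.
  rewrite !flat_map_concat_map, map_map. reflexivity.
Qed.

Lemma fpm_nth ps ts j p : fpm ps ts = true -> nth_error ps j = Some p ->
  exists t, nth_error ts j = Some t /\ pm p t = true.
Proof.
  revert ts j. induction ps as [|q ps IH]; intros [|t ts] [|j] H Hj; simpl in *; try discriminate;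
    apply andb_prop in H; destruct H as [H1 H2].
  - injection Hj as <-. exists t. auto.
  - now apply IH.
Qed.

Lemma deg_Some t a s : subtree t a = Some s -> forall u, deg t (a ++ u) = deg s u.
Proof. intros H u. unfold deg. now rewrite subtree_app, H. Qed.

Lemma deg_None t a : subtree t a = None -> forall u, deg t (a ++ u) = O.
Proof. intros H u. unfold deg. now rewrite subtree_app, H. Qed.

Lemma pdeg_pwin M d : forall t u, (length u <= d)%nat -> Forall (fun j => (j < M)%nat) u ->
  pdeg (pwin M d t) u = deg t u.
Proof.
  induction d as [|d IH]; intros [ts] [|j u] Hl HM; simpl in Hl; try lia; try reflexivity.
  inversion_clear HM as [|? ? Hj HM']. simpl. unfold deg. simpl.
  rewrite nth_error_map, nth_error_firstn.
  destruct (Nat.ltb_spec j M); [|lia].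
  destruct (Nat.ltb_spec j (length ts)) as [H1|H1].
  - destruct (nth_error ts j) as [c|] eqn:E; simpl.
    + rewrite IH; auto. lia.
    + reflexivity.
  - apply nth_error_None in H1. now rewrite H1.
Qed.

(** Pattern of [u_i] when [u_(i-1)] has pattern [P]. *)
Definition lvelt (P : pat) (p : nat) (ls rs : list (option ptree)) (j : nat) : pat :=
  if Nat.ltb j p then opat (nth (p - 1 - j) ls None)
  else if Nat.eqb j p then P else opat (nth (j - p - 1) rs None).

Definition lvpat (P : pat) (k p : nat) (ls rs : list (option ptree)) : pat :=
  PN (map (lvelt P p ls rs) (seq 0 k)).

Lemma flat_map_nth {A B} (F : option A -> list B) os p : F None = [] ->
  (forall z, (p <= z)%nat -> nth z os None = None) ->
  flat_map (fun z => F (nth z os None)) (seq 0 p) = flat_map F os.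
Proof.
  intros HF. revert p. induction os as [|o os IH]; intros p Hp.
  - simpl. induction (seq 0 p) as [|z l IHl]; simpl; auto. rewrite IHl.
    destruct z; simpl; now rewrite HF.
  - destruct p as [|p].
    + simpl. rewrite <- (IH O); [|intros z _; apply (Hp (S z)); lia].
      specialize (Hp O (Nat.le_refl _)). simpl in Hp. subst. now rewrite HF.
    + simpl. f_equal. rewrite <- seq_shift, flat_map_concat_map, map_map, <- flat_map_concat_map.
      apply IH. intros z Hz. apply (Hp (S z)). lia.
Qed.

(** Only a permutation: left siblings are stored from the nearest outwards, against their order in
    the tree, and [P] stands between the two sides. Probabilities of prefixes ignore the order. *)
Lemma pdegs_lvpat P k p ls rs : (p < k)%nat ->
  (forall z, (p <= z)%nat -> nth z ls None = None) ->
  (forall z, (k <= p + S z)%nat -> nth z rs None = None) ->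
  Permutation (pdegs (lvpat P k p ls rs))
    (k :: pdegs P ++ flat_map odegs ls ++ flat_map odegs rs).
Proof.
  intros Hp Hls Hrs. unfold lvpat. cbn [pdegs]. rewrite length_map, length_seq. constructor.
  rewrite flat_map_concat_map, map_map, <- flat_map_concat_map.
  rewrite (seq_split 0 k p) by lia. simpl plus.
  replace (k - p)%nat with (S (k - p - 1)) by lia. cbn [seq].
  rewrite flat_map_app. cbn [flat_map].
  assert (E2 : pdegs (lvelt P p ls rs p) = pdegs P).
  { unfold lvelt. rewrite Nat.ltb_irrefl, Nat.eqb_refl. reflexivity. }
  assert (E3 : flat_map (fun x => pdegs (lvelt P p ls rs x)) (seq (S p) (k - p - 1)) =
    flat_map odegs rs).
  { rewrite <- (flat_map_nth odegs rs (k - p - 1)); [|reflexivity|intros z Hz; apply Hrs; lia].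
    replace (seq (S p) (k - p - 1)) with (map (fun z => (S p + z)%nat) (seq 0 (k - p - 1))).
    - rewrite flat_map_concat_map, map_map, <- flat_map_concat_map. apply flat_map_ext.
      intros z. unfold lvelt, odegs. destruct (Nat.ltb_spec (S p + z) p); [lia|].
      destruct (Nat.eqb_spec (S p + z) p); [lia|]. do 2 f_equal. f_equal. lia.
    - clear. generalize (k - p - 1)%nat as m. intros m. generalize (S p) as a. intros a.
      induction m as [|m IH] using nat_ind; [reflexivity|].
      rewrite !seq_S, map_app, IH. reflexivity. }
  assert (E1 : Permutation (flat_map (fun x => pdegs (lvelt P p ls rs x)) (seq 0 p))
    (flat_map odegs ls)).
  { rewrite <- (flat_map_nth odegs ls p) by auto.
    transitivity (flat_map (fun z => odegs (nth z ls None)) (map (fun j => (p - 1 - j)%nat) (seq 0 p))).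
    - rewrite flat_map_concat_map with (l := map _ _), map_map, <- flat_map_concat_map.
      rewrite !flat_map_concat_map. apply Permutation_refl'. f_equal. apply map_ext_in. intros j Hj. apply in_seq in Hj.
      unfold lvelt, odegs. destruct (Nat.ltb_spec j p); [reflexivity|lia].
    - apply Permutation_flat_map, NoDup_Permutation_bis.
      + apply NoDup_map_inj; [apply seq_NoDup|]. intros x y Hx Hy. apply in_seq in Hx, Hy. lia.
      + now rewrite length_map.
      + intros z Hz. apply in_map_iff in Hz. destruct Hz as [j [<- Hj]]. apply in_seq in Hj.
        apply in_seq. lia. }
  rewrite E2, E3. rewrite E1. rewrite !app_assoc. apply Permutation_app_tail, Permutation_app_comm.
Qed.

(** Built from [u_0] upwards; the first [Absent] level ends the spine, and the result is rooted at
    its top vertex. *)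
Fixpoint wrap (P : pat) (sp : list level) : pat :=
  match sp with
  | Present k p ls rs :: sp' => wrap (lvpat P k p ls rs) sp'
  | _ => P
  end.

(** Address of [u_0] below the top of the spine. *)
Fixpoint spos (sp : list level) : list nat :=
  match sp with
  | Present k p ls rs :: sp' => spos sp' ++ [p]
  | _ => []
  end.

Definition owin (M : nat) (t : tree) (b : list nat) : option ptree :=
  match subtree t b with Some s => Some (pwin M M s) | None => None end.

(** Index [i] stands for the ancestor [u_(i+1)], hence the shift [S i]. *)
Definition levl (M : nat) (t : tree) (a : list nat) (i : nat) : level :=
  let anc := firstn (length a - S i) a in
  let p := nth (length a - S i) a O in
  Present (deg t anc) p
    (map (fun z => if Nat.leb (S z) p then owin M t (anc ++ [(p - S z)%nat]) else None) (seq 0 M))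
    (map (fun z => owin M t (anc ++ [(p + S z)%nat])) (seq 0 M)).

(** The ancestors up to the first big one, which is included; without a big ancestor the whole
    ancestral line. *)
Definition inH (Om : nat) (t : tree) (a : list nat) (i : nat) : bool :=
  (Nat.ltb i (length a) &&
   match H_k Om t a with Some k => Nat.ltb i k | None => true end)%bool.

Definition levels (M Om : nat) (t : tree) (a : list nat) (L : nat) : list level :=
  map (fun i => if inH Om t a i then levl M t a i else Absent) (seq 0 L).

Definition conf (M L Om : nat) (t : tree) (a : list nat) : ptree * list level :=
  (match subtree t a with Some s => pwin M M s | None => PNode O [] end, levels M Om t a L).

Lemma find_map {A B} (f : B -> bool) (h : A -> B) l :
  find f (map h l) = option_map h (find (fun x => f (h x)) l).
Proof. induction l as [|x l IH]; simpl; auto. destruct (f (h x)); auto. Qed.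

Lemma find_ext_in {A} (f f' : A -> bool) l :
  (forall x, In x l -> f x = f' x) -> find f l = find f' l.
Proof.
  induction l as [|x l IH]; intros H; simpl; auto. rewrite (H x) by now left.
  destruct (f' x); auto. apply IH. intros; apply H; now right.
Qed.

(** Seen from a child of [a] the search first tests [a] and then repeats the search from [a], one
    generation further. *)
Lemma H_k_snoc Om t a p : H_k Om t (a ++ [p]) =
  if Nat.ltb Om (deg t a) then Some 1%nat else option_map S (H_k Om t a).
Proof.
  unfold H_k. rewrite length_app. simpl length. rewrite Nat.add_1_r. cbn [seq find].
  replace (S (length a) - 1)%nat with (length a) by lia.
  rewrite firstn_app, Nat.sub_diag, firstn_all. cbn [firstn]. rewrite app_nil_r.
  destruct (Nat.ltb Om (deg t a)); [reflexivity|].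
  rewrite <- seq_shift, find_map. f_equal. apply find_ext_in. intros i Hi. apply in_seq in Hi.
  simpl minus. rewrite firstn_app.
  replace (length a - i - length a)%nat with O by lia. cbn [firstn]. now rewrite app_nil_r.
Qed.

Lemma H_k_bound Om t a k : H_k Om t a = Some k -> (1 <= k <= length a)%nat.
Proof. intros H. apply find_some in H. destruct H as [H _]. apply in_seq in H. lia. Qed.

Lemma levl_snoc M t a p i : (i < length a)%nat -> levl M t (a ++ [p]) (S i) = levl M t a i.
Proof.
  intros Hi. unfold levl. rewrite length_app. simpl length.
  replace (length a + 1 - S (S i))%nat with (length a - S i)%nat by lia.
  rewrite firstn_app, app_nth1 by lia.
  replace (length a - S i - length a)%nat with O by lia. cbn [firstn]. now rewrite app_nil_r.
Qed.

Lemma levels_snoc M Om t a p L : levels M Om t (a ++ [p]) (S L) =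
  levl M t (a ++ [p]) 0 ::
  (if Nat.ltb Om (deg t a) then repeat Absent L else levels M Om t a L).
Proof.
  unfold levels. cbn [seq map]. f_equal.
  - unfold inH. rewrite H_k_snoc, length_app. simpl length.
    destruct (Nat.ltb_spec 0 (length a + 1)); [|lia].
    destruct (Nat.ltb Om (deg t a)); [reflexivity|]. destruct (H_k Om t a); reflexivity.
  - rewrite <- seq_shift, map_map. unfold inH. rewrite H_k_snoc, length_app. simpl length.
    destruct (Nat.ltb Om (deg t a)).
    + clear. rewrite <- (length_seq L 0) at 2.
      induction (seq 0 L) as [|s l IH]; [reflexivity|].
      cbn [map length repeat]. change (Nat.ltb (S s) 1) with false.
      rewrite Bool.andb_false_r. f_equal. apply IH.
    + apply map_ext. intros i.
      replace (Nat.ltb (S i) (length a + 1)) with (Nat.ltb i (length a))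
        by (rewrite Nat.add_1_r; reflexivity).
      destruct (Nat.ltb_spec i (length a)) as [Hi|Hi]; [|reflexivity]. rewrite levl_snoc by auto.
      destruct (H_k Om t a); reflexivity.
Qed.

(** * Recovering a configuration from a match of its pattern *)

(** A match with the pattern of [c] leaves no freedom in the window; this makes distinct
    configurations exclusive. *)
Definition wshape (M : nat) (c : ptree) : Prop :=
  forall s, pm (topat c) s = true -> pwin M M s = c.

Definition oshape (M : nat) (b : nat -> bool) (os : list (option ptree)) : Prop :=
  length os = M /\ forall z, (z < M)%nat ->
    match nth z os None with Some c => b z = true /\ wshape M c | None => b z = false end.

Definition lshape (M k p : nat) (ls rs : list (option ptree)) : Prop :=
  (p < k)%nat /\ oshape M (fun z => Nat.leb (S z) p) ls /\
  oshape M (fun z => Nat.ltb (p + S z) k) rs.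

(** Outdegrees stay at most [Om] up to the first big vertex, where the spine stops; [L] small levels
    without a big vertex are allowed as well. *)
Inductive vspine (M Om : nat) : nat -> list level -> Prop :=
| vs_nil : vspine M Om O []
| vs_stop L k p ls rs : lshape M k p ls rs -> (Om < k)%nat ->
    vspine M Om (S L) (Present k p ls rs :: repeat Absent L)
| vs_step L k p ls rs sp : lshape M k p ls rs -> (k <= Om)%nat -> vspine M Om L sp ->
    vspine M Om (S L) (Present k p ls rs :: sp).

Lemma oshape_None M b os z : oshape M b os -> b z = false -> nth z os None = None.
Proof.
  intros [Hl H] Hb. destruct (Nat.le_gt_cases M z) as [Hz|Hz].
  - apply nth_overflow. lia.
  - specialize (H z Hz). destruct (nth z os None); [destruct H; congruence|reflexivity].
Qed.

Lemma list_as_map {A} (x : A) l M : length l = M -> l = map (fun z => nth z l x) (seq 0 M).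
Proof.
  intros <-. induction l as [|y l IH]; [reflexivity|]. cbn [length seq map nth]. f_equal.
  rewrite <- seq_shift, map_map. exact IH.
Qed.

Lemma pm_at_subtree P t b : pm_at P t b = true -> exists s, subtree t b = Some s /\ pm P s = true.
Proof. unfold pm_at. destruct (subtree t b) as [s|]; [eauto|discriminate]. Qed.

Lemma subtree_snoc t a ts j : subtree t a = Some (Node ts) -> subtree t (a ++ [j]) = nth_error ts j.
Proof. intros H. rewrite subtree_app, H. simpl. destruct (nth_error ts j); reflexivity. Qed.

Lemma level_match M P t a k p ls rs : lshape M k p ls rs ->
  pm_at (lvpat P k p ls rs) t a = true ->
  pm_at P t (a ++ [p]) = true /\ deg t a = k /\ levl M t (a ++ [p]) 0 = Present k p ls rs.
Proof.
  intros [Hp [Hls Hrs]] H. apply pm_at_subtree in H. destruct H as [[ts] [Hs Hm]].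
  unfold lvpat in Hm. rewrite pm_PN in Hm.
  pose proof (fpm_length _ _ Hm) as Hl. rewrite length_map, length_seq in Hl.
  assert (Helt : forall j, (j < k)%nat -> exists s, subtree t (a ++ [j]) = Some s /\
     pm (lvelt P p ls rs j) s = true).
  { intros j Hj. destruct (fpm_nth _ _ j (lvelt P p ls rs j) Hm) as [s [H1 H2]].
    - rewrite nth_error_map, nth_error_seq. destruct (Nat.ltb_spec j k); [reflexivity|lia].
    - exists s. rewrite (subtree_snoc t a ts j Hs). auto. }
  assert (Hd : deg t a = k).
  { unfold deg. rewrite Hs. auto. }
  split; [|split; auto].
  - destruct (Helt p Hp) as [s [H1 H2]]. unfold pm_at. rewrite H1.
    unfold lvelt in H2. rewrite Nat.ltb_irrefl, Nat.eqb_refl in H2. auto.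
  - unfold levl. rewrite length_app. simpl length.
    replace (length a + 1 - 1)%nat with (length a) by lia.
    rewrite firstn_app, Nat.sub_diag, firstn_all. cbn [firstn]. rewrite app_nil_r.
    rewrite app_nth2, Nat.sub_diag by lia. cbn [nth]. rewrite Hd. f_equal.
    + rewrite (list_as_map None ls M) by apply Hls. apply map_ext_in. intros z Hz.
      apply in_seq in Hz. destruct Hls as [_ Hls]. specialize (Hls z ltac:(lia)).
      destruct (nth z ls None) as [c|] eqn:E.
      * destruct Hls as [Hb Hc]. rewrite Hb. apply Nat.leb_le in Hb.
        destruct (Helt (p - S z)%nat ltac:(lia)) as [s [H1 H2]].
        unfold owin. rewrite H1. f_equal. apply Hc. unfold lvelt in H2.
        destruct (Nat.ltb_spec (p - S z) p); [|lia].
        replace (p - 1 - (p - S z))%nat with z in H2 by lia. now rewrite E in H2.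
      * now rewrite Hls.
    + rewrite (list_as_map None rs M) by apply Hrs. apply map_ext_in. intros z Hz.
      apply in_seq in Hz. destruct Hrs as [_ Hrs]. specialize (Hrs z ltac:(lia)).
      destruct (nth z rs None) as [c|] eqn:E.
      * destruct Hrs as [Hb Hc]. apply Nat.ltb_lt in Hb.
        destruct (Helt (p + S z)%nat Hb) as [s [H1 H2]].
        unfold owin. rewrite H1. f_equal. apply Hc. unfold lvelt in H2.
        destruct (Nat.ltb_spec (p + S z) p); [lia|].
        destruct (Nat.eqb_spec (p + S z) p); [lia|].
        replace (p + S z - p - 1)%nat with z in H2 by lia. now rewrite E in H2.
      * apply Nat.ltb_ge in Hrs. unfold owin. rewrite (subtree_snoc t a ts _ Hs).
        replace (nth_error ts (p + S z)) with (@None tree); auto.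
        symmetry. apply nth_error_None. lia.
Qed.

(** The match takes place at the top of the spine, from where [spos sp] leads down to the pointed
    vertex. The upper levels are recovered first, and what then matches below them is the pattern of
    the lowest level. *)
Lemma wrap_match M Om L sp : vspine M Om L sp -> forall P t b,
  pm_at (wrap P sp) t b = true ->
  pm_at P t (b ++ spos sp) = true /\ levels M Om t (b ++ spos sp) L = sp.
Proof.
  induction 1 as [|L k p ls rs Hsh Hk|L k p ls rs sp Hsh Hk _ IH]; intros P t b H.
  - simpl in *. rewrite app_nil_r. auto.
  - assert (E : forall Q, wrap Q (repeat Absent L) = Q /\ spos (repeat Absent L) = [])
      by (intros; destruct L; auto).
    simpl in *. rewrite (proj1 (E _)) in H. rewrite (proj2 (E P)). simpl app.
    destruct (level_match M P t b k p ls rs Hsh H) as [H1 [H2 H3]]. split; auto.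
    rewrite levels_snoc, H3, H2. destruct (Nat.ltb_spec Om k); [reflexivity|lia].
  - simpl in *. destruct (IH _ _ _ H) as [H1 H2]. rewrite app_assoc.
    destruct (level_match M P t (b ++ spos sp) k p ls rs Hsh H1) as [H3 [H4 H5]]. split; auto.
    rewrite levels_snoc, H5, H4, H2. destruct (Nat.ltb_spec Om k); [lia|reflexivity].
Qed.

(** The pattern of the configuration [c] occurs around the pointed vertex [a]. *)
Definition matches_at (c : ptree * list level) (t : tree) (a : list nat) : bool :=
  let q := spos (snd c) in
  let b := firstn (length a - length q) a in
  ((if list_eq_dec Nat.eq_dec a (b ++ q) then true else false) &&
   pm_at (wrap (topat (fst c)) (snd c)) t b)%bool.

Lemma matches_at_conf M L Om c t a : wshape M (fst c) -> vspine M Om L (snd c) ->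
  matches_at c t a = true -> conf M L Om t a = c.
Proof.
  destruct c as [t0 sp]. unfold matches_at, conf. simpl. intros H1 H2 H.
  apply andb_prop in H. destruct H as [Ha H].
  destruct (list_eq_dec Nat.eq_dec a _) as [E|]; [|discriminate]. clear Ha.
  destruct (wrap_match M Om L sp H2 _ _ _ H) as [H3 H4]. rewrite <- E in H3, H4.
  f_equal; auto. apply pm_at_subtree in H3. destruct H3 as [s [-> H3]]. now apply H1.
Qed.

(** Appending [spos] injects occurrences at the top into pointed vertices. An inequality is enough,
    because only lower bounds are transferred to the tree. *)
Lemma matches_at_count M L Om c t : vspine M Om L (snd c) ->
  occ (wrap (topat (fst c)) (snd c)) t <= sumf (fun a => indic (matches_at c t a)) (verts t).
Proof.
  intros H2. destruct c as [t0 sp]. simpl in *. unfold occ.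
  set (P := wrap (topat t0) sp). set (q := spos sp).
  assert (E1 : sumf (fun a => indic (pm_at P t a)) (verts t) =
    sumf (fun _ => 1) (filter (pm_at P t) (verts t))) by (rewrite sumf_filter; reflexivity).
  assert (E2 : sumf (fun a => indic (matches_at (t0, sp) t a)) (verts t) =
    sumf (fun _ => 1) (filter (matches_at (t0, sp) t) (verts t))) by (rewrite sumf_filter; reflexivity).
  rewrite E1, E2.
  rewrite <- (sumf_map (fun _ => 1) (fun b => b ++ q)). apply sumf_incl.
  - apply NoDup_map_inj; [apply NoDup_filter, NoDup_verts|]. intros x y _ _ H.
    now apply app_inv_tail in H.
  - intros a Ha. apply in_map_iff in Ha. destruct Ha as [b [<- Hb]]. apply filter_In in Hb.
    destruct Hb as [_ Hb]. apply filter_In. split.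
    + apply in_verts. destruct (wrap_match M Om L sp H2 _ _ _ Hb) as [H3 _].
      apply pm_at_subtree in H3. destruct H3 as [s [H3 _]]. fold q in H3. congruence.
    + unfold matches_at. simpl. fold q. rewrite length_app.
      replace (length b + length q - length q)%nat with (length b) by lia.
      rewrite firstn_app, Nat.sub_diag, firstn_all. cbn [firstn]. rewrite app_nil_r.
      destruct (list_eq_dec Nat.eq_dec (b ++ q) (b ++ q)); [|congruence]. exact Hb.
  - intros; lra.
Qed.

Lemma Forall_list_max u M : (list_max u < M)%nat -> Forall (fun j => (j < M)%nat) u.
Proof.
  intros H. pose proof (proj1 (list_max_le u (list_max u)) (Nat.le_refl _)) as H1.
  eapply Forall_impl; [|exact H1]. simpl. intros; lia.
Qed.

Lemma nth_map_seq {A} (f : nat -> A) L i x : (i < L)%nat -> nth i (map f (seq 0 L)) x = f i.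
Proof.
  intros H. rewrite (nth_indep _ x (f O)) by (rewrite length_map, length_seq; auto).
  rewrite map_nth, seq_nth; auto.
Qed.

(** [ubound x < M] places [x] inside the window, where it is seen with its true outdegree or as
    missing. *)
Lemma conf_deg M Om t a k x : H_k Om t a = Some k -> subtree t a <> None -> (ubound x < M)%nat ->
  star_deg (fst (conf M M Om t a)) (snd (conf M M Om t a)) x = H_deg t a k x.
Proof.
  intros Hk Ha Hx. pose proof (H_k_bound Om t a k Hk) as Hkb.
  destruct (subtree t a) as [s|] eqn:Hs; [|congruence]. unfold conf. rewrite Hs. simpl fst. simpl snd.
  assert (Hlev : forall i, (i < M)%nat -> nth i (levels M Om t a M) Absent =
    if Nat.leb (S i) k then levl M t a i else Absent).
  { intros i Hi. unfold levels. rewrite nth_map_seq by auto. unfold inH. rewrite Hk.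
    change (Nat.ltb i k) with (Nat.leb (S i) k).
    destruct (Nat.leb_spec (S i) k); [|now rewrite Bool.andb_false_r].
    destruct (Nat.ltb_spec i (length a)); [reflexivity|lia]. }
  assert (Hwin : forall b u, (length u <= M)%nat -> (list_max u < M)%nat ->
    match owin M t b with Some c => DNum (Some (pdeg c u)) | None => DNum (Some O) end =
    DNum (Some (deg t (b ++ u)))).
  { intros b u H1 H2. unfold owin. destruct (subtree t b) as [r|] eqn:Hb.
    - rewrite pdeg_pwin by (auto; now apply Forall_list_max). now rewrite (deg_Some t b r Hb).
    - now rewrite (deg_None t b Hb). }
  destruct x as [u|i|i b z u]; simpl in Hx; unfold star_deg, H_deg.
  - rewrite pdeg_pwin by (try (apply Forall_list_max); lia). now rewrite (deg_Some t a s Hs).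
  - rewrite Hlev by lia. destruct (Nat.leb (S i) k); reflexivity.
  - rewrite Hlev by lia. destruct (Nat.leb (S i) k); [|reflexivity]. unfold levl.
    set (anc := firstn (length a - S i) a). set (p := nth (length a - S i) a O).
    destruct b.
    + rewrite nth_map_seq by lia. destruct (Nat.leb_spec (S z) p); [|reflexivity].
      rewrite Hwin by lia. rewrite <- app_assoc. reflexivity.
    + rewrite nth_map_seq by lia. rewrite Hwin by lia. rewrite <- app_assoc. reflexivity.
Qed.

Definition reaches_big (Om : nat) (sp : list level) : bool :=
  existsb (fun lv => match lv with Present k _ _ _ => Nat.ltb Om k | Absent => false end) sp.

Lemma reaches_big_H_k M L Om t a : reaches_big Om (snd (conf M L Om t a)) = true -> H_k Om t a <> None.
Proof.
  simpl. unfold reaches_big. intros H Hn. apply existsb_exists in H. destruct H as [lv [Hin Hlv]].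
  apply in_map_iff in Hin. destruct Hin as [i [<- Hi]].
  unfold inH in Hlv. rewrite Hn, Bool.andb_true_r in Hlv.
  destruct (Nat.ltb_spec i (length a)) as [Hi'|]; [|discriminate].
  unfold levl in Hlv. apply find_none with (x := S i) in Hn; [|apply in_seq; lia].
  congruence.
Qed.

(** * Finite families of windows of the limit tree *)

(** The list versions copy the probabilistic constructions clause by clause, so each is a subfamily
    of its law while supports and masses stay accessible to induction. *)
Fixpoint ldl {A} (n : nat) (l : list (R * A)) : list (R * list A) :=
  match n with
  | O => lret []
  | S n' => lbind l (fun a => lbind (ldl n' l) (fun r => lret (a :: r)))
  end.

Fixpoint lgw (lx : list (R * nat)) (M d : nat) : list (R * ptree) :=
  match d with
  | O => lbind lx (fun k => lret (PNode k []))
  | S d' => lbind lx (fun k => lbind (ldl (Nat.min k M) (lgw lx M d'))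
                                     (fun kids => lret (PNode k kids)))
  end.

Fixpoint lopts (G : list (R * ptree)) (bs : list bool) : list (R * list (option ptree)) :=
  match bs with
  | [] => lret []
  | b :: r => lbind (if b then lmap Some G else lret None)
                    (fun o => lbind (lopts G r) (fun l => lret (o :: l)))
  end.

Definition lunif (k : nat) : list (R * nat) := map (uniform k) (seq 0 k).

Definition llevel (G : list (R * ptree)) (M k : nat) : list (R * level) :=
  lbind (lunif k) (fun p =>
  lbind (lopts G (map (fun z => Nat.leb (S z) p) (seq O M))) (fun ls =>
  lbind (lopts G (map (fun z => Nat.ltb (p + S z) k) (seq O M))) (fun rs =>
  lret (Present k p ls rs)))).

Fixpoint lspine (lh : list (R * natbar)) (lD : list (R * nat)) (G : list (R * ptree))
  (M L : nat) (stopped : bool) : list (R * list level) :=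
  match L with
  | O => lret []
  | S L' =>
      if stopped then lmap (cons Absent) (lspine lh lD G M L' true)
      else lbind lh (fun h =>
             match h with
             | Some k => lbind (llevel G M k) (fun lv => lmap (cons lv) (lspine lh lD G M L' false))
             | None => lbind lD (fun d => lbind (llevel G M d) (fun lv =>
                           lmap (cons lv) (lspine lh lD G M L' true)))
             end)
  end.

Lemma sub_ldl {A} n l (d : Defs.dist A) : subfamily l d -> subfamily (ldl n l) (dlist n d).
Proof.
  intros H. induction n as [|n IH]; simpl; [apply sub_ret|].
  apply sub_bind; auto. intros a _. apply sub_bind; auto. intros r _. apply sub_ret.
Qed.

Lemma sub_gw lx xi M d : subfamily lx xi -> subfamily (lgw lx M d) (gw xi M d).
Proof.
  intros H. induction d as [|d IH]; simpl; apply sub_bind; auto; intros k _; [apply sub_ret|].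
  apply sub_bind; [now apply sub_ldl|]. intros kids _. apply sub_ret.
Qed.

Lemma sub_opts G g bs : subfamily G g -> subfamily (lopts G bs) (dopts g bs).
Proof.
  intros H. induction bs as [|b bs IH]; simpl; [apply sub_ret|].
  apply sub_bind.
  - destruct b; [now apply sub_map|apply sub_ret].
  - intros o _. apply sub_bind; auto. intros l _. apply sub_ret.
Qed.

Lemma sub_level G g M k : subfamily G g -> subfamily (llevel G M k) (level_law g M k).
Proof.
  intros H. unfold llevel, level_law. apply sub_bind.
  - exists (seq 0 k). split; [apply seq_NoDup|reflexivity].
  - intros p _. apply sub_bind; [now apply sub_opts|]. intros ls _.
    apply sub_bind; [now apply sub_opts|]. intros rs _. apply sub_ret.
Qed.

Lemma sub_spine lh xh lD D G g M L st : subfamily lh xh -> subfamily lD D -> subfamily G g ->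
  subfamily (lspine lh lD G M L st) (spine xh D g M L st).
Proof.
  intros H1 H2 H3. revert st. induction L as [|L IH]; intros st; simpl; [apply sub_ret|].
  destruct st; [apply sub_map, IH|]. apply sub_bind; auto. intros [k|] _.
  - apply sub_bind; [now apply sub_level|]. intros lv _. apply sub_map, IH.
  - apply sub_bind; auto. intros d _. apply sub_bind; [now apply sub_level|].
    intros lv _. apply sub_map, IH.
Qed.

Lemma submass_dlist {A} n (d : Defs.dist A) : submass d -> submass (dlist n d).
Proof.
  intros H. induction n as [|n IH]; simpl; [apply submass_ret|].
  apply submass_bind; auto. intros a. apply submass_bind; auto. intros r. apply submass_ret.
Qed.

Lemma submass_gw xi M d : submass xi -> submass (gw xi M d).
Proof.
  intros H. induction d as [|d IH]; simpl; apply submass_bind; auto; intros k; [apply submass_ret|].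
  apply submass_bind; [now apply submass_dlist|]. intros kids. apply submass_ret.
Qed.

Lemma submass_opts g bs : submass g -> submass (dopts g bs).
Proof.
  intros H. induction bs as [|b bs IH]; simpl; [apply submass_ret|]. apply submass_bind.
  - destruct b; [now apply submass_map|apply submass_ret].
  - intros o. apply submass_bind; auto. intros l. apply submass_ret.
Qed.

Lemma submass_level g M k : submass g -> submass (level_law g M k).
Proof.
  intros H. apply submass_bind; [apply submass_uniform|]. intros p.
  apply submass_bind; [now apply submass_opts|]. intros ls.
  apply submass_bind; [now apply submass_opts|]. intros rs. apply submass_ret.
Qed.

Lemma submass_spine xh D g M L st : submass xh -> submass D -> submass g ->
  submass (spine xh D g M L st).
Proof.
  intros H1 H2 H3. revert st. induction L as [|L IH]; intros st; simpl; [apply submass_ret|].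
  destruct st; [apply submass_map, IH|]. apply submass_bind; auto. intros [k|].
  - apply submass_bind; [now apply submass_level|]. intros lv. apply submass_map, IH.
  - apply submass_bind; auto. intros d. apply submass_bind; [now apply submass_level|].
    intros lv. apply submass_map, IH.
Qed.

(** * Supports: distinct outcomes of the right shape *)

Lemma in_supp_lbind {A B} (l : list (R * A)) (f : A -> list (R * B)) b :
  In b (supp (lbind l f)) <-> exists a, In a (supp l) /\ In b (supp (f a)).
Proof. rewrite supp_lbind. apply in_flat_map. Qed.

Lemma in_lbind {A B} (l : list (R * A)) (f : A -> list (R * B)) q b :
  In (q, b) (lbind l f) -> exists p a q', In (p, a) l /\ In (q', b) (f a) /\ q = p * q'.
Proof.
  intros H. apply in_flat_map in H. destruct H as [[p a] [H1 H2]].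
  apply in_map_iff in H2. destruct H2 as [[q' b'] [H2 H3]]. simpl in *.
  injection H2 as <- <-. eauto 6.
Qed.

Lemma supp_ldl {A} n (l : list (R * A)) r : In r (supp (ldl n l)) ->
  length r = n /\ Forall (fun a => In a (supp l)) r.
Proof.
  revert r. induction n as [|n IH]; intros r H; simpl in H.
  - destruct H as [<-|[]]. auto.
  - apply in_supp_lbind in H. destruct H as [a [Ha H]].
    apply in_supp_lbind in H. destruct H as [r' [Hr' [<-|[]]]].
    destruct (IH r' Hr'). simpl. auto.
Qed.

Lemma NoDup_ldl {A} n (l : list (R * A)) : NoDup (supp l) -> NoDup (supp (ldl n l)).
Proof.
  intros H. induction n as [|n IH]; simpl; [repeat constructor; auto|].
  apply NoDup_supp_lbind; auto.
  - intros a _. apply NoDup_supp_lbind; auto.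
    + intros r _. repeat constructor; auto.
    + intros r r' b _ _ [<-|[]] [E|[]]; simpl in E; congruence.
  - intros a a' b _ _ H1 H2. apply in_supp_lbind in H1, H2.
    destruct H1 as [r [_ [<-|[]]]], H2 as [r' [_ [E|[]]]]; simpl in E; congruence.
Qed.

Lemma NoDup_lgw lx M d : NoDup (supp lx) -> NoDup (supp (lgw lx M d)).
Proof.
  intros H. induction d as [|d IH]; simpl; apply NoDup_supp_lbind; auto.
  - intros k _. repeat constructor; auto.
  - intros k k' b _ _ [<-|[]] [E|[]]; simpl in E; congruence.
  - intros k _. apply NoDup_supp_lbind; [now apply NoDup_ldl| |].
    + intros r _. repeat constructor; auto.
    + intros r r' b _ _ [<-|[]] [E|[]]; simpl in E; congruence.
  - intros k k' b _ _ H1 H2. apply in_supp_lbind in H1, H2.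
    destruct H1 as [r [_ [<-|[]]]], H2 as [r' [_ [E|[]]]]; simpl in E; congruence.
Qed.

Lemma NoDup_lopts G bs : NoDup (supp G) -> NoDup (supp (lopts G bs)).
Proof.
  intros H. induction bs as [|b bs IH]; simpl; [repeat constructor; auto|].
  apply NoDup_supp_lbind; auto.
  - destruct b; [rewrite supp_lmap; apply NoDup_map_inj; auto; intros; congruence|].
    repeat constructor; auto.
  - intros a _. apply NoDup_supp_lbind; auto.
    + intros r _. repeat constructor; auto.
    + intros r r' c _ _ [<-|[]] [E|[]]; simpl in E; congruence.
  - intros a a' c _ _ H1 H2. apply in_supp_lbind in H1, H2.
    destruct H1 as [r [_ [<-|[]]]], H2 as [r' [_ [E|[]]]]; simpl in E; congruence.
Qed.

Lemma supp_lunif k : supp (lunif k) = seq 0 k.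
Proof.
  unfold supp, lunif. rewrite map_map. rewrite <- map_id. apply map_ext_in. intros i Hi.
  apply in_seq in Hi. unfold uniform. destruct (Nat.ltb_spec i k); [reflexivity|lia].
Qed.

Lemma supp_llevel G M k lv : In lv (supp (llevel G M k)) -> exists p ls rs,
  lv = Present k p ls rs /\ (p < k)%nat /\
  In ls (supp (lopts G (map (fun z => Nat.leb (S z) p) (seq O M)))) /\
  In rs (supp (lopts G (map (fun z => Nat.ltb (p + S z) k) (seq O M)))).
Proof.
  intros H. apply in_supp_lbind in H. destruct H as [p [Hp H]].
  rewrite supp_lunif in Hp. apply in_seq in Hp.
  apply in_supp_lbind in H. destruct H as [ls [Hls H]].
  apply in_supp_lbind in H. destruct H as [rs [Hrs [<-|[]]]].
  exists p, ls, rs. repeat split; auto. lia.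
Qed.

Lemma NoDup_llevel G M k : NoDup (supp G) -> NoDup (supp (llevel G M k)).
Proof.
  intros H. unfold llevel. apply NoDup_supp_lbind.
  - rewrite supp_lunif. apply seq_NoDup.
  - intros p _. apply NoDup_supp_lbind; [now apply NoDup_lopts| |].
    + intros ls _. apply NoDup_supp_lbind; [now apply NoDup_lopts| |].
      * intros rs _. repeat constructor; auto.
      * intros r r' c _ _ [<-|[]] [E|[]]; simpl in E; congruence.
    + intros ls ls' c _ _ H1 H2. apply in_supp_lbind in H1, H2.
      destruct H1 as [r [_ [<-|[]]]], H2 as [r' [_ [E|[]]]]; simpl in E; congruence.
  - intros p p' c _ _ H1 H2. apply in_supp_lbind in H1, H2.
    destruct H1 as [ls [_ H1]], H2 as [ls' [_ H2]]. apply in_supp_lbind in H1, H2.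
    destruct H1 as [r [_ [<-|[]]]], H2 as [r' [_ [E|[]]]]; simpl in E; congruence.
Qed.

Lemma lspine_true lh lD G M L : lspine lh lD G M L true = [(1, repeat Absent L)].
Proof. induction L as [|L IH]; [reflexivity|]. simpl. now rewrite IH. Qed.

Lemma supp_lspine_true lh lD G M L : supp (lspine lh lD G M L true) = [repeat Absent L].
Proof. now rewrite lspine_true. Qed.

(** An outcome determines how it was produced: ordinary spine degrees are at most [Om] and those
    from [lD] exceed [Om], so the first level shows which branch was taken. *)
Lemma NoDup_lspine lh lD G M L Om : NoDup (supp G) -> NoDup (supp lh) -> NoDup (supp lD) ->
  (forall k, In (Some k) (supp lh) -> (k <= Om)%nat) ->
  (forall d, In d (supp lD) -> (Om < d)%nat) ->
  NoDup (supp (lspine lh lD G M L false)).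
Proof.
  intros HG Hh HD Hk Hd. induction L as [|L IH]; [repeat constructor; auto|].
  cbn [lspine]. apply NoDup_supp_lbind; auto.
  - intros [k|] _.
    + apply NoDup_supp_lbind; [now apply NoDup_llevel| |].
      * intros lv _. rewrite supp_lmap. apply NoDup_map_inj; auto. intros; congruence.
      * intros lv lv' sp _ _ H1 H2. rewrite supp_lmap in H1, H2. apply in_map_iff in H1, H2.
        destruct H1 as [? [<- _]], H2 as [? [E _]]. congruence.
    + apply NoDup_supp_lbind; auto.
      * intros d _. apply NoDup_supp_lbind; [now apply NoDup_llevel| |].
        -- intros lv _. rewrite supp_lmap, supp_lspine_true. repeat constructor; auto.
        -- intros lv lv' sp _ _ H1 H2. rewrite supp_lmap in H1, H2. apply in_map_iff in H1, H2.
           destruct H1 as [? [<- _]], H2 as [? [E _]]. congruence.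
      * intros d d' sp _ _ H1 H2. apply in_supp_lbind in H1, H2.
        destruct H1 as [lv [Hlv H1]], H2 as [lv' [Hlv' H2]]. rewrite supp_lmap in H1, H2.
        apply in_map_iff in H1, H2. destruct H1 as [? [<- _]], H2 as [? [E _]].
        apply supp_llevel in Hlv, Hlv'.
        destruct Hlv as [p [ls [rs [-> _]]]], Hlv' as [p' [ls' [rs' [-> _]]]]. congruence.
  - assert (Hhead : forall h sp, In h (supp lh) -> In sp (supp (match h with
         | Some k => lbind (llevel G M k) (fun lv => lmap (cons lv) (lspine lh lD G M L false))
         | None => lbind lD (fun d => lbind (llevel G M d) (fun lv =>
                       lmap (cons lv) (lspine lh lD G M L true)))
         end)) -> exists k p ls rs sp', sp = Present k p ls rs :: sp' /\
            match h with Some k' => k = k' | None => (Om < k)%nat end).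
    { intros [k|] sp Hin H.
      - apply in_supp_lbind in H. destruct H as [lv [Hlv H]]. rewrite supp_lmap in H.
        apply in_map_iff in H. destruct H as [sp' [<- _]].
        apply supp_llevel in Hlv. destruct Hlv as [p [ls [rs [-> _]]]].
        exists k, p, ls, rs, sp'. auto.
      - apply in_supp_lbind in H. destruct H as [d [Hdd H]].
        apply in_supp_lbind in H. destruct H as [lv [Hlv H]]. rewrite supp_lmap in H.
        apply in_map_iff in H. destruct H as [sp' [<- _]].
        apply supp_llevel in Hlv. destruct Hlv as [p [ls [rs [-> _]]]].
        exists d, p, ls, rs, sp'. auto. }
    intros h h' sp Hin Hin' H1 H2.
    destruct (Hhead h sp Hin H1) as [k1 [? [? [? [? [E1 M1]]]]]].
    destruct (Hhead h' sp Hin' H2) as [k2 [? [? [? [? [E2 M2]]]]]].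
    assert (k1 = k2) by congruence. subst k2.
    destruct h as [k|], h' as [k'|]; auto.
    + congruence.
    + subst k1. apply Hk in Hin. lia.
    + subst k1. apply Hk in Hin'. lia.
Qed.

Lemma supp_lopts G bs os : In os (supp (lopts G bs)) ->
  length os = length bs /\ forall z, (z < length bs)%nat ->
    match nth z os None with
    | Some c => nth z bs false = true /\ In c (supp G)
    | None => nth z bs false = false
    end.
Proof.
  revert os. induction bs as [|b bs IH]; intros os H; simpl in H.
  - destruct H as [<-|[]]. split; [reflexivity|]. simpl; lia.
  - apply in_supp_lbind in H. destruct H as [o [Ho H]].
    apply in_supp_lbind in H. destruct H as [os' [Hos [<-|[]]]].
    destruct (IH os' Hos) as [H1 H2]. split; [simpl; auto|]. intros [|z] Hz; simpl.
    + destruct b.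
      * rewrite supp_lmap in Ho. apply in_map_iff in Ho. destruct Ho as [c [<- Hc]]. auto.
      * destruct Ho as [<-|[]]. reflexivity.
    + apply H2. simpl in Hz. lia.
Qed.

(** The recorded kids are the first [min k M] children, exactly those at which [pwin] looks. *)
Lemma lgw_wshape lx M d : forall c, In c (supp (lgw lx M d)) ->
  forall s, pm (topat c) s = true -> pwin M d s = c.
Proof.
  induction d as [|d IH]; intros c H [ts] Hm; simpl in H.
  - apply in_supp_lbind in H. destruct H as [k [_ [<-|[]]]].
    change (fpm (repeat Any (k - 0)) ts = true) in Hm.
    apply fpm_length in Hm. rewrite repeat_length in Hm. simpl. f_equal. lia.
  - apply in_supp_lbind in H. destruct H as [k [_ H]].
    apply in_supp_lbind in H. destruct H as [kids [Hk [<-|[]]]].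
    apply supp_ldl in Hk. destruct Hk as [Hl Hk].
    change (fpm (map topat kids ++ repeat Any (k - length kids)) ts = true) in Hm.
    pose proof (fpm_length _ _ Hm) as Hlt. rewrite length_app, length_map, repeat_length in Hlt.
    simpl. f_equal; [lia|].
    assert (Hf : firstn M ts = firstn (length kids) ts).
    { destruct (Nat.le_gt_cases M k).
      - f_equal. lia.
      - rewrite !firstn_all2 by lia. reflexivity. }
    rewrite Hf. clear Hf.
    assert (Hm' : fpm (map topat kids) (firstn (length kids) ts) = true).
    { rewrite <- (firstn_skipn (length kids) ts) in Hm. rewrite fpm_app in Hm.
      - apply andb_prop in Hm. tauto.
      - rewrite length_map, length_firstn. lia. }
    clear - IH Hk Hm'. revert Hm'. generalize (firstn (length kids) ts) as us.
    induction Hk as [|c kids Hc _ IHk]; intros [|u us] H; simpl in *; try discriminate; auto.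
    apply andb_prop in H. destruct H as [H1 H2]. f_equal; auto.
Qed.

Lemma lopts_oshape lx M b os :
  In os (supp (lopts (lgw lx M M) (map b (seq 0 M)))) -> oshape M b os.
Proof.
  intros H. apply supp_lopts in H. rewrite length_map, length_seq in H.
  destruct H as [H1 H2]. split; auto. intros z Hz. specialize (H2 z Hz).
  rewrite (nth_map_seq b M z false Hz) in H2.
  destruct (nth z os None) as [c|]; auto. destruct H2 as [H2 H3]. split; auto.
  intros s Hs. now apply lgw_wshape with (lx := lx).
Qed.

Lemma llevel_lshape lx M k p ls rs :
  In (Present k p ls rs) (supp (llevel (lgw lx M M) M k)) -> lshape M k p ls rs.
Proof.
  intros H. apply supp_llevel in H. destruct H as [p' [ls' [rs' [E [H1 [H2 H3]]]]]].
  injection E as <- <- <-.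
  split; [exact H1|]. split; eapply lopts_oshape; eassumption.
Qed.

Lemma lspine_vspine lh lD lx M L Om : 
  (forall k, In (Some k) (supp lh) -> (k <= Om)%nat) ->
  (forall d, In d (supp lD) -> (Om < d)%nat) ->
  forall sp, In sp (supp (lspine lh lD (lgw lx M M) M L false)) -> vspine M Om L sp.
Proof.
  intros Hk Hd. induction L as [|L IH]; intros sp H.
  - destruct H as [<-|[]]. constructor.
  - cbn [lspine] in H. apply in_supp_lbind in H. destruct H as [[k|] [Hh H]].
    + apply in_supp_lbind in H. destruct H as [lv [Hlv H]]. rewrite supp_lmap in H.
      apply in_map_iff in H. destruct H as [sp' [<- Hsp']].
      pose proof (supp_llevel _ _ _ _ Hlv) as [p [ls [rs [-> _]]]].
      apply vs_step; auto. now apply llevel_lshape in Hlv.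
    + apply in_supp_lbind in H. destruct H as [d [Hdd H]].
      apply in_supp_lbind in H. destruct H as [lv [Hlv H]].
      rewrite supp_lmap, supp_lspine_true in H. destruct H as [<-|[]].
      pose proof (supp_llevel _ _ _ _ Hlv) as [p [ls [rs [-> _]]]].
      apply vs_stop; auto. now apply llevel_lshape in Hlv.
Qed.

(** ** Masses *)

Lemma lmass_ldl {A} n (l : list (R * A)) x : 0 <= x -> lnonneg l -> 1 - x <= lmass l ->
  lnonneg (ldl n l) /\ 1 - INR n * x <= lmass (ldl n l).
Proof.
  intros Hx Hl Hm. induction n as [|n [IH1 IH2]].
  - cbn [ldl]. split; [|rewrite lmass_lret; simpl; lra]. intros pa [<-|[]]. simpl. lra.
  - assert (Hr : forall a : A, lnonneg (lbind (ldl n l) (fun r => lret (a :: r)))).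
    { intros a. apply lnonneg_bind; auto. intros r _ pa [<-|[]]. simpl; lra. }
    split; [cbn [ldl]; apply lnonneg_bind; auto|].
    cbn [ldl]. rewrite S_INR. replace ((INR n + 1) * x) with (x + INR n * x) by ring.
    apply lmass_bind; auto.
    + apply Rmult_le_pos; auto. apply pos_INR.
    + intros a _. replace (INR n * x) with (INR n * x + 0) by ring.
      apply lmass_bind; auto; try lra.
      * apply Rmult_le_pos; auto. apply pos_INR.
      * intros r _ pa [<-|[]]. simpl; lra.
      * intros r _. rewrite lmass_lret. lra.
Qed.

(** The sum [1 + M + ... + M ^ d], a bound for the number of offspring draws in a window; each draw
    loses mass at most [x]. *)
Fixpoint gwc (M d : nat) : R := match d with O => 1 | S d' => 1 + INR M * gwc M d' end.

Lemma gwc_nonneg M d : 0 <= gwc M d.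
Proof. induction d; simpl; [lra|]. pose proof (pos_INR M). nra. Qed.

Lemma lmass_lgw lx M d x : 0 <= x -> lnonneg lx -> 1 - x <= lmass lx ->
  lnonneg (lgw lx M d) /\ 1 - gwc M d * x <= lmass (lgw lx M d).
Proof.
  intros Hx Hl Hm.
  assert (Hret : forall c : ptree, lnonneg (lret c)) by (intros c pa [<-|[]]; simpl; lra).
  induction d as [|d [IH1 IH2]]; cbn [lgw gwc].
  - split; [apply lnonneg_bind; auto|]. replace (1 * x) with (x + 0) by ring.
    apply lmass_bind; auto; try lra. intros k _. rewrite lmass_lret. lra.
  - pose proof (gwc_nonneg M d) as Hc.
    assert (H0 : 0 <= gwc M d * x) by (now apply Rmult_le_pos).
    assert (H1 : forall k, lnonneg (ldl (Nat.min k M) (lgw lx M d)) /\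
       1 - INR M * (gwc M d * x) <= lmass (ldl (Nat.min k M) (lgw lx M d))).
    { intros k. destruct (lmass_ldl (Nat.min k M) _ (gwc M d * x) H0 IH1 IH2) as [H2 H3].
      split; auto. assert (INR (Nat.min k M) <= INR M) by (apply le_INR; lia). nra. }
    split.
    + apply lnonneg_bind; auto. intros k _. apply lnonneg_bind; auto. apply H1.
    + replace ((1 + INR M * gwc M d) * x) with (x + (INR M * (gwc M d * x) + 0)) by ring.
      pose proof (pos_INR M). assert (0 <= INR M * (gwc M d * x)) by (now apply Rmult_le_pos).
      apply lmass_bind; auto; try lra.
      * intros k _. apply lnonneg_bind; auto. apply H1.
      * intros k _. apply lmass_bind; auto; try lra; try apply H1.
        intros r _. rewrite lmass_lret. lra.
Qed.

Lemma lmass_lopts G bs x : 0 <= x -> lnonneg G -> 1 - x <= lmass G ->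
  lnonneg (lopts G bs) /\ 1 - INR (length bs) * x <= lmass (lopts G bs).
Proof.
  intros Hx Hl Hm.
  assert (Hret : forall c : list (option ptree), lnonneg (lret c)) by (intros c pa [<-|[]]; simpl; lra).
  induction bs as [|b bs [IH1 IH2]]; cbn [lopts length].
  - split; auto. rewrite lmass_lret. simpl; lra.
  - assert (Hb : lnonneg (if b then lmap Some G else lret None)).
    { destruct b; [|intros pa [<-|[]]; simpl; lra].
      intros pa Hpa. apply in_map_iff in Hpa. destruct Hpa as [qa [<- Hqa]]. simpl. auto. }
    assert (Hb' : 1 - x <= lmass (if b then lmap Some G else lret None)).
    { destruct b; [rewrite lmass_lmap; auto|rewrite lmass_lret; lra]. }
    split.
    + apply lnonneg_bind; auto. intros o _. apply lnonneg_bind; auto.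
    + rewrite S_INR. replace ((INR (length bs) + 1) * x) with (x + (INR (length bs) * x + 0)) by ring.
      pose proof (pos_INR (length bs)).
      assert (0 <= INR (length bs) * x) by (now apply Rmult_le_pos).
      apply lmass_bind; auto; try lra.
      * intros o _. apply lnonneg_bind; auto.
      * intros o _. apply lmass_bind; auto; try lra. intros l _. rewrite lmass_lret. lra.
Qed.

Lemma lunif_nonneg k : lnonneg (lunif k).
Proof.
  apply (lnonneg_sub _ (uniform k)); [apply submass_uniform|].
  exists (seq 0 k). split; [apply seq_NoDup|reflexivity].
Qed.

Lemma sumf_lunif h k : sumf h (lunif k) = sumf (fun p => h (/ INR k, p)) (seq 0 k).
Proof.
  unfold lunif. rewrite sumf_map. apply sumf_ext. intros i Hi. apply in_seq in Hi.
  unfold uniform. destruct (Nat.ltb_spec i k); [reflexivity|lia].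
Qed.

Lemma lmass_lunif k : (1 <= k)%nat -> lmass (lunif k) = 1.
Proof.
  intros H. unfold lmass. rewrite sumf_lunif. simpl. rewrite sumf_const, length_seq.
  apply Rinv_r. apply not_0_INR. lia.
Qed.

(** The position costs nothing, as all [k] values are listed; there are at most [2 M] sibling
    trees. *)
Lemma lmass_llevel G M k x : (1 <= k)%nat -> 0 <= x -> lnonneg G -> 1 - x <= lmass G ->
  lnonneg (llevel G M k) /\ 1 - 2 * INR M * x <= lmass (llevel G M k).
Proof.
  intros Hk Hx Hl Hm.
  assert (Hret : forall c : level, lnonneg (lret c)) by (intros c pa [<-|[]]; simpl; lra).
  assert (Ho : forall b, lnonneg (lopts G (map b (seq 0 M))) /\
     1 - INR M * x <= lmass (lopts G (map b (seq 0 M)))).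
  { intros b. pose proof (lmass_lopts G (map b (seq 0 M)) x Hx Hl Hm) as H.
    rewrite length_map, length_seq in H. exact H. }
  pose proof (lunif_nonneg k) as Hu. pose proof (pos_INR M) as HM.
  assert (H0 : 0 <= INR M * x) by (now apply Rmult_le_pos).
  unfold llevel. split.
  - apply lnonneg_bind; auto. intros p _. apply lnonneg_bind; [apply Ho|]. intros ls _.
    apply lnonneg_bind; auto. apply Ho.
  - replace (2 * INR M * x) with (0 + (INR M * x + (INR M * x + 0))) by ring.
    apply lmass_bind; auto; try lra.
    + intros p _. apply lnonneg_bind; [apply Ho|]. intros ls _. apply lnonneg_bind; auto. apply Ho.
    + rewrite lmass_lunif by auto. lra.
    + intros p _. apply lmass_bind; try lra; try apply Ho.
      * intros ls _. apply lnonneg_bind; auto. apply Ho.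
      * intros ls _. apply lmass_bind; auto; try lra; try apply Ho.
        intros rs _. rewrite lmass_lret. lra.
Qed.

Lemma lnonneg_lmap {A B} (f : A -> B) l : lnonneg l -> lnonneg (lmap f l).
Proof.
  intros H pa Hpa. apply in_map_iff in Hpa. destruct Hpa as [qa [<- Hqa]]. simpl. auto.
Qed.

(** Union bound: per level one draw with loss [y] and at most [2 M] trees with loss [x] each. *)
Lemma lmass_lspine lh lD G M L x y : 0 <= x -> 0 <= y ->
  lnonneg lh -> lnonneg lD -> lnonneg G ->
  1 - y <= lmass lh -> lmass lD = 1 -> 1 - x <= lmass G ->
  (forall k, In (Some k) (supp lh) -> (1 <= k)%nat) -> (forall d, In d (supp lD) -> (1 <= d)%nat) ->
  lnonneg (lspine lh lD G M L false) /\
  1 - INR L * (y + 2 * INR M * x) <= lmass (lspine lh lD G M L false).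
Proof.
  intros Hx Hy H1 H2 H3 H4 H5 H6 Hh HD.
  pose proof (pos_INR M) as HM. assert (H0 : 0 <= INR M * x) by (now apply Rmult_le_pos).
  induction L as [|L [IH1 IH2]].
  - split; [intros pa [<-|[]]; simpl; lra|]. cbn [lspine]. rewrite lmass_lret. simpl. lra.
  - assert (Ht : lnonneg (lspine lh lD G M L true)).
    { rewrite lspine_true. intros pa [<-|[]]. simpl. lra. }
    pose proof (pos_INR L) as HL.
    assert (HLx : 0 <= INR L * (y + 2 * INR M * x)) by (apply Rmult_le_pos; lra).
    assert (Hnn : forall h, In h (supp lh) -> lnonneg (match h with
         | Some k => lbind (llevel G M k) (fun lv => lmap (cons lv) (lspine lh lD G M L false))
         | None => lbind lD (fun d => lbind (llevel G M d) (fun lv =>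
                       lmap (cons lv) (lspine lh lD G M L true)))
         end)).
    { intros [k|] Hin.
      - apply lnonneg_bind; [apply (lmass_llevel G M k x); auto|]. intros. now apply lnonneg_lmap.
      - apply lnonneg_bind; auto. intros d Hd.
        apply lnonneg_bind; [apply (lmass_llevel G M d x); auto|]. intros. now apply lnonneg_lmap. }
    cbn [lspine]. split; [apply lnonneg_bind; auto|].
    rewrite S_INR.
    replace ((INR L + 1) * (y + 2 * INR M * x)) with
      (y + (2 * INR M * x + INR L * (y + 2 * INR M * x))) by ring.
    apply lmass_bind; auto; try lra. intros [k|] Hin.
    + apply lmass_bind; try lra; try apply (lmass_llevel G M k x); auto.
      * intros. now apply lnonneg_lmap.
      * intros. now rewrite lmass_lmap.
    + apply Rle_trans with (1 - (0 + (2 * INR M * x + 0))); [lra|].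
      apply lmass_bind; auto; try lra.
      * intros d Hd. apply lnonneg_bind; [apply (lmass_llevel G M d x); auto|].
        intros. now apply lnonneg_lmap.
      * intros d Hd. apply lmass_bind; try lra; try apply (lmass_llevel G M d x); auto.
        -- intros. now apply lnonneg_lmap.
        -- intros. rewrite lmass_lmap, lspine_true. unfold lmass, sumf. simpl. lra.
Qed.

(** * Approximation of the law of the limit tree *)

(** Which of the [M] nearest siblings exist depends on the degree and the position; listing all
    possibilities gives bounds independent of both. *)
Fixpoint allb (M : nat) : list (list bool) :=
  match M with
  | O => [[]]
  | S M' => flat_map (fun r => [true :: r; false :: r]) (allb M')
  end.

Lemma in_allb bs : In bs (allb (length bs)).
Proof.
  induction bs as [|b bs IH]; simpl; [auto|]. apply in_flat_map. exists bs. split; auto.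
  destruct b; simpl; auto.
Qed.

Lemma in_allb_map b M : In (map b (seq 0 M)) (allb M).
Proof.
  pose proof (in_allb (map b (seq 0 M))) as H. now rewrite length_map, length_seq in H.
Qed.

Lemma sumf_flat_map_ge {A B} (F : B -> R) (f : A -> list B) l x :
  (forall y, 0 <= F y) -> In x l -> sumf F (f x) <= sumf F (flat_map f l).
Proof.
  intros HF Hx. rewrite sumf_flat_map. destruct (in_split x l Hx) as [l1 [l2 ->]].
  rewrite sumf_app, sumf_cons.
  pose proof (sumf_nonneg (fun x => sumf F (f x)) l1 ltac:(intros; apply sumf_nonneg; auto)).
  pose proof (sumf_nonneg (fun x => sumf F (f x)) l2 ltac:(intros; apply sumf_nonneg; auto)).
  lra.
Qed.

Lemma cpre_perm w n l l' : Permutation l l' -> cpre w n l = cpre w n l'.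
Proof. intros P. unfold cpre. f_equal. apply pre_perm; auto. intros ? ? ?; reflexivity. Qed.

Lemma wrap_repeat P L : wrap P (repeat Absent L) = P.
Proof. destruct L; reflexivity. Qed.

Section Approx.
Context (w : nat -> R) (g : nat) (tau mu : R) (Om : nat -> nat).
Context (HW : weight_seq w) (HG : is_gcd_support w g) (HT : type_II_III w tau mu).
Context (HOm : Omega_ok w g mu Om).

Local Notation pp := (ppi w tau).
Local Notation pk := (pik w tau).
Local Notation ev := (eventually_mod g).

(** Ordinary offspring values are truncated at a fixed [B]; the big degrees in [lDn] are all kept,
    since they move off with [n]. *)
Definition lxn (B : nat) : list (R * nat) := map (xi_law w tau) (seq 0 (S B)).
Definition lh (B : nat) : list (R * natbar) := map (xihat_law w tau mu) (seq 0 (S B)).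
Definition lDn (n : nat) : list (R * nat) := map (Dtilde_law w n (Om n)) (Dl Om n).
Definition lG (B M : nat) : list (R * ptree) := lgw (lxn B) M M.

Lemma sumf_lh h B : sumf h (lh B) =
  h (1 - mu, None) + sumf (fun k => h (INR k * pk k, Some k)) (seq 1 B).
Proof.
  unfold lh. rewrite sumf_map. cbn [seq]. rewrite sumf_cons. f_equal.
  apply sumf_ext. intros [|k] Hk; [apply in_seq in Hk; lia|reflexivity].
Qed.

Lemma sumf_lDn h n : sumf h (lDn n) = sumf (fun d => h (Dt w Om n d, d)) (Dl Om n).
Proof. unfold lDn. rewrite sumf_map. reflexivity. Qed.

Lemma supp_lxn B : supp (lxn B) = seq 0 (S B).
Proof.
  unfold supp, lxn. rewrite map_map. rewrite <- map_id. reflexivity.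
Qed.

Lemma supp_lDn n : supp (lDn n) = Dl Om n.
Proof. unfold supp, lDn. rewrite map_map. rewrite <- map_id. reflexivity. Qed.

Lemma supp_lh B h : In h (supp (lh B)) -> match h with Some k => (1 <= k <= B)%nat | None => True end.
Proof.
  unfold supp, lh. rewrite map_map. intros H. apply in_map_iff in H.
  destruct H as [[|k] [<- Hk]]; simpl; auto. apply in_seq in Hk. lia.
Qed.

Lemma NoDup_lh B : NoDup (supp (lh B)).
Proof.
  unfold supp, lh. rewrite map_map. apply NoDup_map_inj; [apply seq_NoDup|].
  intros [|x] [|y] _ _; simpl; congruence.
Qed.

Lemma ppi_app l l' : pp (l ++ l') = pp l * pp l'.
Proof. apply wprod_app. Qed.

Lemma ppi_perm l l' : Permutation l l' -> pp l = pp l'.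
Proof. apply wprod_perm. Qed.

(** Mass of an atom as a product over the outdegrees it prescribes, the form in which [cpre_limit]
    gives the limit. *)
Definition product_mass (G : list (R * ptree)) : Prop :=
  forall q c, In (q, c) G -> q = pp (pdegs (topat c)).

Lemma ldl_mass G n q r : product_mass G -> In (q, r) (ldl n G) ->
  q = pp (flat_map (fun c => pdegs (topat c)) r).
Proof.
  intros HGm. revert q r. induction n as [|n IH]; intros q r H; cbn [ldl] in H.
  - destruct H as [H|[]]. injection H as <- <-. reflexivity.
  - apply in_lbind in H. destruct H as [p [c [q' [Hc [H ->]]]]].
    apply in_lbind in H. destruct H as [p' [r' [q'' [Hr [[H|[]] ->]]]]]. injection H as <- <-.
    simpl. rewrite ppi_app, <- (IH _ _ Hr), <- (HGm _ _ Hc). ring.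
Qed.

Lemma lgw_mass B M d : product_mass (lgw (lxn B) M d).
Proof.
  assert (Hx : forall q k, In (q, k) (lxn B) -> q = pk k).
  { intros q k H. apply in_map_iff in H. destruct H as [j [H _]].
    unfold xi_law in H. injection H as <- <-. reflexivity. }
  induction d as [|d IH]; intros q c H; cbn [lgw] in H.
  - apply in_lbind in H. destruct H as [p [k [q' [Hk [[H|[]] ->]]]]]. injection H as <- <-.
    rewrite pdegs_topat by (simpl; lia). simpl. unfold ppi. simpl. now rewrite (Hx _ _ Hk).
  - apply in_lbind in H. destruct H as [p [k [q' [Hk [H ->]]]]].
    apply in_lbind in H. destruct H as [p' [r [q'' [Hr [[H|[]] ->]]]]]. injection H as <- <-.
    rewrite pdegs_topat.
    + unfold ppi. cbn [wprod fold_right]. fold (wprod pk (flat_map (fun c => pdegs (topat c)) r)).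
      fold (pp (flat_map (fun c => pdegs (topat c)) r)).
      rewrite (Hx _ _ Hk), (ldl_mass _ _ _ _ IH Hr). ring.
    + apply (in_map snd), supp_ldl in Hr. simpl in Hr. lia.
Qed.

Lemma lopts_mass G bs q os : product_mass G -> In (q, os) (lopts G bs) ->
  q = pp (flat_map odegs os).
Proof.
  intros HGm. revert q os. induction bs as [|b bs IH]; intros q os H; cbn [lopts] in H.
  - destruct H as [H|[]]. injection H as <- <-. reflexivity.
  - apply in_lbind in H. destruct H as [p [o [q' [Ho [H ->]]]]].
    apply in_lbind in H. destruct H as [p' [r' [q'' [Hr [[H|[]] ->]]]]]. injection H as <- <-.
    simpl. rewrite ppi_app, <- (IH _ _ Hr).
    assert (E : p = pp (odegs o)); [|rewrite E; ring].
    destruct b.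
    + apply in_map_iff in Ho. destruct Ho as [[q c] [H Hc]]. injection H as <- <-.
      now apply HGm.
    + destruct Ho as [H|[]]. injection H as <- <-. reflexivity.
Qed.

Lemma llevel_mass G M k y p ls rs : product_mass G -> In (y, Present k p ls rs) (llevel G M k) ->
  y = / INR k * (pp (flat_map odegs ls) * pp (flat_map odegs rs)).
Proof.
  intros HGm H. apply in_lbind in H. destruct H as [q1 [p' [q2 [Hp [H ->]]]]].
  apply in_lbind in H. destruct H as [q3 [ls' [q4 [Hls [H ->]]]]].
  apply in_lbind in H. destruct H as [q5 [rs' [q6 [Hrs [[H|[]] ->]]]]].
  injection H as <- <- <- <-.
  rewrite (lopts_mass _ _ _ _ HGm Hls), (lopts_mass _ _ _ _ HGm Hrs).
  apply in_map_iff in Hp. destruct Hp as [i [Hi Hin]]. apply in_seq in Hin.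
  unfold uniform in Hi. destruct (Nat.ltb_spec i k); [|lia]. injection Hi as <- _. ring.
Qed.

Lemma lvpat_perm M P k p ls rs : lshape M k p ls rs ->
  Permutation (pdegs (lvpat P k p ls rs)) (k :: pdegs P ++ flat_map odegs ls ++ flat_map odegs rs).
Proof.
  intros [H1 [H2 H3]]. apply pdegs_lvpat; auto.
  - intros z Hz. apply (oshape_None _ _ _ z H2). apply Nat.leb_gt. lia.
  - intros z Hz. apply (oshape_None _ _ _ z H3). apply Nat.ltb_ge. lia.
Qed.

(** The sum over the position of [u_(i-1)] among the [d] children of the big root is
    controlled by the factor [d] in [big_root]. *)
Lemma root_err B M P e : 0 < e -> ev (fun n =>
  sumf (fun d => sumf (fun yl => Rabs (pp (pdegs P) * ((1 - mu) * (Dt w Om n d * (fst yl * 1))) -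
     cpre w n (pdegs (wrap P [snd yl])))) (llevel (lG B M) M d)) (Dl Om n) <= e).
Proof.
  intros He.
  set (G := lG B M). assert (HGm : product_mass G) by apply lgw_mass.
  (* A finite set of sibling lists that depends neither on the degree [d] nor on the position. *)
  set (OO := flat_map (lopts G) (allb M)).
  set (rest := fun x y : R * list (option ptree) =>
    pdegs P ++ flat_map odegs (snd x) ++ flat_map odegs (snd y)).
  set (er := fun n d x y => Rabs ((1 - mu) * Dt w Om n d / INR d * pp (rest x y) -
     cpre w n (d :: rest x y))).
  assert (Hev : ev (fun n => sumf (fun x => sumf (fun y =>
     sumf (fun d => INR d * er n d x y) (Dl Om n)) OO) OO <= e)).
  { apply (eventually_sumf g (fun n x => sumf (fun y =>
     sumf (fun d => INR d * er n d x y) (Dl Om n)) OO)); auto. intros x _ e1 He1.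
    apply (eventually_sumf g (fun n y => sumf (fun d => INR d * er n d x y) (Dl Om n))); auto.
    intros y _ e2 He2. apply (big_root w g tau mu Om HW HG HT HOm); auto. }
  revert Hev. apply eventually_mono. intros n Hn. eapply Rle_trans; [|exact Hn].
  assert (Hpos : forall d x y, 0 <= er n d x y) by (intros; apply Rabs_pos).
  apply Rle_trans with (sumf (fun d => INR d * sumf (fun x => sumf (fun y => er n d x y) OO) OO) (Dl Om n)).
  (* Each of the [d] positions has the same bound, which produces the factor [INR d]. *)
  - apply sumf_le. intros d Hd.
    replace (INR d * _) with (sumf (fun _ => sumf (fun x => sumf (fun y => er n d x y) OO) OO) (seq 0 d))
      by (rewrite sumf_const, length_seq; reflexivity).
    unfold llevel. rewrite sumf_lbind, sumf_lunif. apply sumf_le. intros p Hp. simpl fst. simpl snd.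
    rewrite sumf_lbind.
    apply Rle_trans with (sumf (fun x => sumf (fun y => er n d x y) OO)
      (lopts G (map (fun z => Nat.leb (S z) p) (seq 0 M)))).
    + apply sumf_le. intros [q1 ls] Hls. rewrite sumf_lbind. simpl fst. simpl snd.
      apply Rle_trans with (sumf (fun y => er n d (q1, ls) y)
        (lopts G (map (fun z => Nat.ltb (p + S z) d) (seq 0 M)))).
      * right. apply sumf_ext. intros [q2 rs] Hrs. unfold lret, sumf at 1.
        cbn [map lsum fold_right fst snd wrap]. rewrite Rplus_0_r. unfold er.
        assert (Hsh : lshape M d p ls rs).
        { apply in_seq in Hp. split; [lia|].
          split; eapply lopts_oshape; apply (in_map snd) in Hls, Hrs; eassumption. }
        rewrite (cpre_perm w n _ _ (lvpat_perm M P d p ls rs Hsh)).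
        rewrite (lopts_mass _ _ _ _ HGm Hls), (lopts_mass _ _ _ _ HGm Hrs).
        unfold rest. simpl snd. rewrite !ppi_app. f_equal. unfold Rdiv. ring.
      * apply sumf_flat_map_ge; auto. apply in_allb_map.
    + apply sumf_flat_map_ge.
      * intros x. apply sumf_nonneg. auto.
      * apply in_allb_map.
  - right.
    rewrite (sumf_ext _ (fun d => sumf (fun x => sumf (fun y => INR d * er n d x y) OO) OO)).
    + rewrite sumf_exchange. apply sumf_ext. intros x _. now rewrite sumf_exchange.
    + intros d _. rewrite <- sumf_scal. apply sumf_ext. intros. now rewrite sumf_scal.
Qed.

(** The lowest level is absorbed into the pattern, which is why [P] is arbitrary. The size-biased
    weight [INR k * pk k] and the position probability [/ INR k] combine to [pk k]; the branch that
    stops is [root_err]. *)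
Lemma spine_err B M L : forall P e, 0 < e -> ev (fun n =>
  sumf (fun qs => Rabs (pp (pdegs P) * fst qs - cpre w n (pdegs (wrap P (snd qs)))))
    (lspine (lh B) (lDn n) (lG B M) M L false) <= e).
Proof.
  assert (HGm : product_mass (lG B M)) by apply lgw_mass.
  induction L as [|L IH]; intros P e He.
  - generalize (cpre_limit w g tau mu Om HW HG HT HOm (pdegs P) e He). apply eventually_mono.
    intros n Hn. cbn [lspine]. unfold lret, sumf. simpl. rewrite Rmult_1_r. lra.
  - assert (H1 : ev (fun n => sumf (fun k => sumf (fun yl =>
       sumf (fun qs => Rabs (pp (pdegs P) * (INR k * pk k * (fst yl * fst qs)) -
          cpre w n (pdegs (wrap P (snd yl :: snd qs)))))
         (lspine (lh B) (lDn n) (lG B M) M L false)) (llevel (lG B M) M k)) (seq 1 B) <= e / 2)).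
    { apply (eventually_sumf g (fun n k => sumf (fun yl =>
       sumf (fun qs => Rabs (pp (pdegs P) * (INR k * pk k * (fst yl * fst qs)) -
          cpre w n (pdegs (wrap P (snd yl :: snd qs)))))
         (lspine (lh B) (lDn n) (lG B M) M L false)) (llevel (lG B M) M k))); [|lra].
      intros k Hk e1 He1. apply in_seq in Hk.
      apply (eventually_sumf g (fun n yl =>
       sumf (fun qs => Rabs (pp (pdegs P) * (INR k * pk k * (fst yl * fst qs)) -
          cpre w n (pdegs (wrap P (snd yl :: snd qs)))))
         (lspine (lh B) (lDn n) (lG B M) M L false))); auto.
      intros [y lv] Hy e2 He2.
      pose proof (in_map snd _ _ Hy) as Hlv.
      destruct (supp_llevel _ _ _ _ Hlv) as [p [ls [rs [E _]]]]. simpl in E. subst lv.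
      pose proof (llevel_lshape _ _ _ _ _ _ Hlv) as Hsh.
      pose proof (llevel_mass _ _ _ _ _ _ _ HGm Hy) as Hmass.
      generalize (IH (lvpat P k p ls rs) e2 He2). apply eventually_mono. intros n Hn.
      eapply Rle_trans; [|exact Hn]. right. apply sumf_ext. intros [q sp] _. simpl fst. simpl snd.
      f_equal. cbn [wrap]. f_equal. rewrite (ppi_perm _ _ (lvpat_perm M P k p ls rs Hsh)).
      change (pp (k :: pdegs P ++ flat_map odegs ls ++ flat_map odegs rs)) with
        (pk k * pp (pdegs P ++ flat_map odegs ls ++ flat_map odegs rs)).
      rewrite !ppi_app, Hmass. field. apply not_0_INR. lia. }
    generalize (eventually_and g _ _ H1 (root_err B M P (e / 2) ltac:(lra))).
    apply eventually_mono. intros n [H2 H3].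
    cbn [lspine]. rewrite sumf_lbind, sumf_lh. simpl fst. simpl snd.
    match goal with |- ?x + ?y <= _ => assert (Hx : x <= e / 2); [|assert (Hy : y <= e / 2); [|lra]] end.
    + rewrite sumf_lbind, sumf_lDn. eapply Rle_trans; [|exact H3]. right. apply sumf_ext. intros d _.
      simpl fst. simpl snd. rewrite sumf_lbind. apply sumf_ext. intros [y lv] Hy.
      pose proof (in_map snd _ _ Hy) as Hlv.
      destruct (supp_llevel _ _ _ _ Hlv) as [p [ls [rs [E _]]]]. simpl in E. subst lv.
      rewrite sumf_lmap, lspine_true. unfold sumf. simpl fst. simpl snd. simpl map.
      cbn [lsum fold_right map wrap fst snd]. rewrite wrap_repeat, Rplus_0_r. reflexivity.
    + eapply Rle_trans; [|exact H2]. right. apply sumf_ext. intros k _. rewrite sumf_lbind.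
      apply sumf_ext. intros yl _. now rewrite sumf_lmap.
Qed.

Definition lconf (n B M L : nat) : list (R * (ptree * list level)) :=
  lbind (lG B M) (fun t0 => lbind (lspine (lh B) (lDn n) (lG B M) M L false)
    (fun sp => lret (t0, sp))).

Definition cpat (c : ptree * list level) : pat := wrap (topat (fst c)) (snd c).

Lemma sumf_lconf h n B M L : sumf h (lconf n B M L) =
  sumf (fun qt => sumf (fun qs => h (fst qt * fst qs, (snd qt, snd qs)))
    (lspine (lh B) (lDn n) (lG B M) M L false)) (lG B M).
Proof.
  unfold lconf. rewrite sumf_lbind. apply sumf_ext. intros [q t0] _. rewrite sumf_lbind.
  apply sumf_ext. intros [q' sp] _. unfold lret, sumf. simpl. rewrite Rmult_1_r. lra.
Qed.

Lemma conf_err B M L e : 0 < e -> ev (fun n =>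
  sumf (fun qc => Rabs (fst qc - cpre w n (pdegs (cpat (snd qc))))) (lconf n B M L) <= e).
Proof.
  intros He.
  assert (H : ev (fun n => sumf (fun qt => sumf (fun qs => Rabs (fst qt * fst qs -
     cpre w n (pdegs (wrap (topat (snd qt)) (snd qs)))))
     (lspine (lh B) (lDn n) (lG B M) M L false)) (lG B M) <= e)).
  { apply (eventually_sumf g (fun n qt => sumf (fun qs => Rabs (fst qt * fst qs -
     cpre w n (pdegs (wrap (topat (snd qt)) (snd qs)))))
     (lspine (lh B) (lDn n) (lG B M) M L false))); auto.
    intros [q t0] Hq e1 He1. generalize (spine_err B M L (topat t0) e1 He1). apply eventually_mono.
    intros n Hn. simpl fst. simpl snd. rewrite (lgw_mass B M M q t0 Hq). exact Hn. }
  revert H. apply eventually_mono. intros n Hn. rewrite sumf_lconf. exact Hn.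
Qed.

Lemma lD_big n d : In d (supp (lDn n)) -> (Om n < d)%nat.
Proof. rewrite supp_lDn. intros H. apply in_seq in H. lia. Qed.

Lemma NoDup_lconf n B M L : (B <= Om n)%nat -> NoDup (supp (lconf n B M L)).
Proof.
  intros HB.
  assert (HGn : NoDup (supp (lG B M))) by (apply NoDup_lgw; rewrite supp_lxn; apply seq_NoDup).
  apply NoDup_supp_lbind; auto.
  - intros t0 _. apply NoDup_supp_lbind.
    + apply NoDup_lspine with (Om := Om n); auto.
      * apply NoDup_lh.
      * rewrite supp_lDn. apply seq_NoDup.
      * intros k Hk. apply supp_lh in Hk. lia.
      * apply lD_big.
    + intros sp _. repeat constructor; auto.
    + intros sp sp' c _ _ [<-|[]] [E|[]]; simpl in E; congruence.
  - intros t t' c _ _ H1 H2. apply in_supp_lbind in H1, H2.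
    destruct H1 as [r [_ [<-|[]]]], H2 as [r' [_ [E|[]]]]; simpl in E; congruence.
Qed.

Lemma lconf_valid n B M L c : (B <= Om n)%nat -> In c (supp (lconf n B M L)) ->
  wshape M (fst c) /\ vspine M (Om n) L (snd c).
Proof.
  intros HB H. apply in_supp_lbind in H. destruct H as [t0 [Ht H]].
  apply in_supp_lbind in H. destruct H as [sp [Hsp [<-|[]]]]. simpl. split.
  - intros s Hs. now apply lgw_wshape with (lx := lxn B).
  - eapply lspine_vspine; [| |exact Hsp].
    + intros k Hk. apply supp_lh in Hk. lia.
    + apply lD_big.
Qed.

Lemma cpat_PN c : exists qs, cpat c = PN qs.
Proof.
  destruct c as [[k kids] sp]. unfold cpat. simpl fst. simpl snd.
  assert (H : forall P, (exists qs, P = PN qs) -> exists qs, wrap P sp = PN qs).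
  { induction sp as [|[|k' p ls rs] sp IH]; intros P HP; simpl; auto. apply IH. unfold lvpat. eauto. }
  apply H. simpl. eauto.
Qed.

(** ** Vertices of the random tree *)

Lemma TV_sumf n E : TVprob w n E =
  sumf (fun t => tweight w t * sumf (fun a => indic (E t a)) (verts t)) (trees_n n) / (Zn w n * INR n).
Proof.
  unfold TVprob. f_equal. apply sumf_ext. intros t _. rewrite <- sumf_scal.
  apply sumf_ext. intros a _. destruct (E t a); simpl; ring.
Qed.

Section FixedSize.
Context (n : nat) (Hn : (0 < n)%nat) (HB : 0 < comp_sum w n (n - 1) (fun _ => 1)).

Lemma ZnN_pos : 0 < Zn w n * INR n.
Proof. apply Rmult_lt_0_compat; [now apply Zn_pos|now apply lt_0_INR]. Qed.

Lemma TV_le E E1 E2 :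
  (forall t a, In a (verts t) -> indic (E t a) <= indic (E1 t a) + indic (E2 t a)) ->
  TVprob w n E <= TVprob w n E1 + TVprob w n E2.
Proof.
  intros H. rewrite !TV_sumf. pose proof ZnN_pos as HZ.
  unfold Rdiv. rewrite <- Rmult_plus_distr_r, <- sumf_plus.
  apply Rmult_le_compat_r; [left; now apply Rinv_0_lt_compat|]. apply sumf_le. intros t _.
  rewrite <- Rmult_plus_distr_l, <- sumf_plus.
  apply Rmult_le_compat_l; [apply tweight_nonneg, HW|]. apply sumf_le. intros a Ha. auto.
Qed.

Lemma TV_compl E : TVprob w n E + TVprob w n (fun t a => negb (E t a)) = 1.
Proof.
  rewrite !TV_sumf. pose proof ZnN_pos as HZ. unfold Rdiv.
  rewrite <- Rmult_plus_distr_r, <- sumf_plus.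
  rewrite (sumf_ext _ (fun t => INR n * tweight w t)).
  - rewrite sumf_scal.
    change (sumf (tweight w) (trees_n n)) with (Zn w n).
    field. split; [apply not_0_INR; lia|]. pose proof (Zn_pos w n Hn HB). lra.
  - intros t Ht. apply in_trees_n in Ht. rewrite <- Rmult_plus_distr_l, <- sumf_plus.
    rewrite (sumf_ext _ (fun _ => 1)).
    + rewrite sumf_const. unfold tsize in Ht. rewrite Ht. ring.
    + intros a _. destruct (E t a); simpl; ring.
Qed.

(** Distinct configurations match disjoint sets of vertices. *)
Lemma TV_family M L cs (Q : ptree * list level -> bool) E : NoDup cs ->
  (forall c, In c cs -> wshape M (fst c) /\ vspine M (Om n) L (snd c)) ->
  (forall c t a, In c cs -> Q c = true -> In a (verts t) -> conf M L (Om n) t a = c -> E t a = true) ->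
  sumf (fun c => indic (Q c) * cpre w n (pdegs (cpat c))) cs <= TVprob w n E.
Proof.
  intros Hcs Hv HE. rewrite TV_sumf. pose proof ZnN_pos as HZ.
  assert (H1 : forall c, In c cs -> cpre w n (pdegs (cpat c)) <=
    sumf (fun t => tweight w t * sumf (fun a => indic (matches_at c t a)) (verts t)) (trees_n n) / (Zn w n * INR n)).
  { intros c Hc. destruct (cpat_PN c) as [qs Hqs]. unfold cpre. rewrite Hqs, <- occ_trees by auto.
    rewrite <- (Zn_comp_sum w n Hn). rewrite (Rmult_comm (INR n)).
    apply Rmult_le_compat_r; [left; now apply Rinv_0_lt_compat|]. apply sumf_le. intros t _.
    apply Rmult_le_compat_l; [apply tweight_nonneg, HW|]. rewrite <- Hqs.
    apply (matches_at_count M L (Om n)). now apply Hv. }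
  apply Rle_trans with (sumf (fun c => indic (Q c) *
    (sumf (fun t => tweight w t * sumf (fun a => indic (matches_at c t a)) (verts t)) (trees_n n) / (Zn w n * INR n))) cs).
  { apply sumf_le. intros c Hc. apply Rmult_le_compat_l; [apply indic_bounds|auto]. }
  rewrite (sumf_ext _ (fun c => / (Zn w n * INR n) * sumf (fun t => sumf (fun a =>
     tweight w t * (indic (Q c) * indic (matches_at c t a))) (verts t)) (trees_n n))).
  2: { intros c _. unfold Rdiv. rewrite (Rmult_comm _ (/ _)), <- Rmult_assoc, (Rmult_comm (indic _)), Rmult_assoc.
       f_equal. rewrite <- sumf_scal. apply sumf_ext. intros t _.
       rewrite <- !sumf_scal. apply sumf_ext. intros; ring. }
  rewrite sumf_scal. unfold Rdiv. rewrite (Rmult_comm _ (/ _)).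
  apply Rmult_le_compat_l; [left; now apply Rinv_0_lt_compat|].
  rewrite sumf_exchange. apply sumf_le. intros t _. rewrite sumf_exchange, <- sumf_scal.
  apply sumf_le. intros a Ha. rewrite sumf_scal.
  apply Rmult_le_compat_l; [apply tweight_nonneg, HW|].
  (* At most one configuration can match around [a], namely [conf M L (Om n) t a]. *)
  destruct (classic (exists c, In c cs /\ Q c = true /\ matches_at c t a = true)) as [[c [Hc [HQ Hcm]]]|Hno].
  - rewrite (sumf_single _ c); auto.
    + rewrite (HE c t a); auto; [pose proof (indic_bounds (Q c)); pose proof (indic_bounds (matches_at c t a)); simpl; nra|].
      apply matches_at_conf; auto; now apply Hv.
    + intros c' Hc' Hne. destruct (matches_at c' t a) eqn:E'; [|simpl; ring]. exfalso. apply Hne.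
      rewrite <- (matches_at_conf M L (Om n) c' t a), <- (matches_at_conf M L (Om n) c t a); auto; now apply Hv.
  - rewrite sumf_0; [apply indic_bounds|]. intros c Hc.
    destruct (Q c) eqn:E1; [|simpl; ring]. destruct (matches_at c t a) eqn:E2; [|simpl; ring].
    exfalso. eauto.
Qed.

End FixedSize.

(** ** Masses of the base laws *)

Lemma pik_sums : infinite_sum pk 1 /\ infinite_sum (fun k => INR k * pk k) mu.
Proof.
  destruct (offspring_law w tau mu HW HT) as [Htau [Hmu [HP [HM _]]]]. destruct HW as [Hw [Hw0 _]].
  assert (Hp : 0 < phi w tau) by (apply (Phi_pos w tau); auto).
  split.
  - apply infinite_sum_ext with (fun k => / phi w tau * (w k * tau ^ k)).
    + intros k. unfold pik. unfold Rdiv. ring.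
    + replace 1 with (/ phi w tau * phi w tau) by (field; lra). now apply infinite_sum_scal.
  - apply infinite_sum_ext with (fun k => / phi w tau * (INR k * (w k * tau ^ k))).
    + intros k. unfold pik. unfold Rdiv. ring.
    + replace mu with (/ phi w tau * (mu * phi w tau)) by (field; lra). now apply infinite_sum_scal.
Qed.

Lemma pik_nonneg k : 0 <= pk k.
Proof. now apply (pik_bounds w tau mu HW HT). Qed.

Lemma submass_xi : submass (xi_law w tau).
Proof.
  split; [intros i; apply pik_nonneg|]. intros [|N]; [unfold sumf; simpl; lra|].
  apply (psum_le_infinite pk 1 N); [intros; apply pik_nonneg|apply pik_sums].
Qed.

Lemma sumf_xihat B : sumf (fun i => fst (xihat_law w tau mu i)) (seq 0 (S B)) =
  1 - mu + psum (fun k => INR k * pk k) B.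
Proof.
  unfold psum. cbn [seq]. rewrite !sumf_cons. simpl fst. simpl INR.
  rewrite (sumf_ext (fun i => fst (xihat_law w tau mu i)) (fun k => INR k * pk k) (seq 1 B)).
  - lra.
  - intros [|k] Hk; [apply in_seq in Hk; lia|reflexivity].
Qed.

Lemma submass_xihat : submass (xihat_law w tau mu).
Proof.
  destruct (offspring_law w tau mu HW HT) as [_ [Hmu _]]. split.
  - intros [|i]; [simpl; lra|]. apply Rmult_le_pos; [apply pos_INR|apply (pik_nonneg (S i))].
  - intros [|N]; [unfold sumf; simpl; lra|]. rewrite sumf_xihat.
    assert (psum (fun k => INR k * pk k) N <= mu); [|lra].
    apply psum_le_infinite; [|apply pik_sums]. intros.
    apply Rmult_le_pos; [apply pos_INR|apply pik_nonneg].
Qed.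

Lemma base_mass y : 0 < y -> exists B, 1 - y <= lmass (lxn B) /\ 1 - y <= lmass (lh B).
Proof.
  intros Hy. destruct pik_sums as [H1 H2].
  destruct (infinite_sum_tail _ _ y Hy H1) as [B1 HB1].
  destruct (infinite_sum_tail _ _ y Hy H2) as [B2 HB2].
  exists (B1 + B2)%nat. specialize (HB1 (B1 + B2)%nat ltac:(lia)). specialize (HB2 (B1 + B2)%nat ltac:(lia)).
  apply Rabs_def2 in HB1, HB2. unfold lmass, lxn, lh. rewrite !sumf_map. split.
  - unfold psum in HB1. change (fun x => fst (xi_law w tau x)) with pk. lra.
  - rewrite sumf_xihat. lra.
Qed.

Lemma sub_seq {A} (d : Defs.dist A) is : NoDup is -> subfamily (map d is) d.
Proof. intros H. exists is. auto. Qed.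

Lemma lxn_nonneg B : lnonneg (lxn B).
Proof. apply (lnonneg_sub _ (xi_law w tau)); [apply submass_xi|apply sub_seq, seq_NoDup]. Qed.

Lemma lh_nonneg B : lnonneg (lh B).
Proof. apply (lnonneg_sub _ (xihat_law w tau mu)); [apply submass_xihat|apply sub_seq, seq_NoDup]. Qed.

(** Eventual, because the probability of a root degree above [Om n] must first be positive. *)
Lemma eventually_D : ev (fun n => submass (Dtilde_law w n (Om n)) /\ lmass (lDn n) = 1).
Proof.
  generalize (eventually_and g _ _ (eventually_positive w g HW HG)
    (Dt_limit w g tau mu Om HW HG HT HOm 1 Rlt_0_1)).
  apply eventually_mono. intros n [[Hn HB] [_ [H1 H2]]].
  (* Degrees outside [Dl Om n] are at most [Om n] or impossible in a tree with [n] vertices. *)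
  assert (Hz : forall k, ~ In k (Dl Om n) -> fst (Dtilde_law w n (Om n) k) = 0).
  { intros k Hk. unfold Dtilde_law. simpl. destruct (Nat.ltb_spec (Om n) k); [|reflexivity].
    assert (E : Tprob w n (fun t => Nat.eqb (deg t []) k) = 0); [|rewrite E; unfold Rdiv; ring].
    rewrite Tprob_sumf. rewrite sumf_0; [unfold Rdiv; ring|]. intros t Ht. apply in_trees_n in Ht.
    destruct (Nat.eqb_spec (deg t []) k) as [E|]; [|simpl; ring]. exfalso. apply Hk.
    apply in_seq. destruct t as [ts]. rewrite tsize_Node in Ht. pose proof (length_le_fsize ts).
    unfold deg in E. simpl in E. lia. }
  assert (Hpos : forall k, 0 <= fst (Dtilde_law w n (Om n) k)).
  { intros k. destruct (in_dec Nat.eq_dec k (Dl Om n)) as [H|H].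
    - now apply H2.
    - rewrite Hz; auto; lra. }
  split; [split; auto|].
  - intros N.
    rewrite (sumf_ext _ (fun k => if (if in_dec Nat.eq_dec k (Dl Om n) then true else false)
      then fst (Dtilde_law w n (Om n) k) else 0)).
    + rewrite <- sumf_filter, <- H1. apply sumf_incl; auto.
      * apply NoDup_filter, seq_NoDup.
      * intros k Hk. apply filter_In in Hk. destruct Hk as [_ Hk].
        destruct (in_dec Nat.eq_dec k (Dl Om n)); [auto|discriminate].
    + intros k _. destruct (in_dec Nat.eq_dec k (Dl Om n)); auto.
  - unfold lmass. rewrite sumf_lDn. exact H1.
Qed.

Lemma lDn_nonneg n : submass (Dtilde_law w n (Om n)) -> lnonneg (lDn n).
Proof.
  intros H. apply (lnonneg_sub _ (Dtilde_law w n (Om n))); auto. apply sub_seq, seq_NoDup.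
Qed.

(** [mu ^ L] is the probability that the limiting spine is still alive after [L] levels. *)
Lemma stopped_mass n B L y : 0 <= y -> 1 - y <= lmass (lh B) ->
  submass (Dtilde_law w n (Om n)) -> lmass (lDn n) = 1 ->
  1 - (mu ^ L + INR L * y) <=
  sumf (fun qs => fst qs * indic (reaches_big (Om n) (snd qs))) (lspine (lh B) (lDn n) (lG B 0) 0 L false).
Proof.
  intros Hy Hlh Hsub HD.
  destruct (offspring_law w tau mu HW HT) as [_ [Hmu _]].
  (* Truncated probability that the spine continues, equal to [mu] up to [y]. *)
  set (S := psum (fun k => INR k * pk k) B).
  assert (HS : mu - y <= S <= mu).
  { split.
    - unfold lmass, lh in Hlh. rewrite sumf_map, sumf_xihat in Hlh. fold S in Hlh. lra.
    - apply psum_le_infinite; [|apply pik_sums]. intros.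
      apply Rmult_le_pos; [apply pos_INR|apply pik_nonneg]. }
  assert (HS0 : 0 <= S).
  { apply sumf_nonneg. intros. apply Rmult_le_pos; [apply pos_INR|apply pik_nonneg]. }
  assert (HGn : lnonneg (lG B 0)).
  { apply (lnonneg_sub _ (gw (xi_law w tau) 0 0)); [apply submass_gw, submass_xi|].
    apply sub_gw, sub_seq, seq_NoDup. }
  assert (HGm : 1 - 1 <= lmass (lG B 0)) by (pose proof (lmass_nonneg _ HGn); lra).
  assert (Hlev : forall k, (1 <= k)%nat -> lnonneg (llevel (lG B 0) 0 k) /\ 1 <= lmass (llevel (lG B 0) 0 k)).
  { intros k Hk. destruct (lmass_llevel (lG B 0) 0 k 1 Hk Rle_0_1 HGn HGm) as [H1 H2].
    simpl INR in H2. split; auto. lra. }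
  pose proof (lDn_nonneg n Hsub) as HDn.
  induction L as [|L IH].
  - simpl. cbn [lspine]. unfold lret, sumf. simpl. lra.
  - cbn [lspine]. rewrite sumf_lbind, sumf_lh. simpl fst. simpl snd.
    set (sig := sumf (fun qs => fst qs * indic (reaches_big (Om n) (snd qs)))
       (lspine (lh B) (lDn n) (lG B 0) 0 L false)) in *.
    assert (Hnn : forall qs, In qs (lspine (lh B) (lDn n) (lG B 0) 0 L false) -> 0 <= fst qs).
    { apply (lmass_lspine (lh B) (lDn n) (lG B 0) 0 L 1 y); auto; try lra.
      - apply lh_nonneg.
      - intros k Hk. apply supp_lh in Hk. lia.
      - intros d Hd. apply lD_big in Hd. lia. }
    assert (Hsig : 0 <= sig).
    { apply sumf_nonneg. intros qs Hqs. apply Rmult_le_pos; auto. apply indic_bounds. }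
    (* First step: stop with mass [1 - mu], or continue with mass [S] and start afresh. *)
    match goal with |- _ <= ?u + ?v => assert (Hu : 1 - mu <= u); [|assert (Hv : S * sig <= v)] end.
    + rewrite sumf_lbind, sumf_lDn. simpl fst. simpl snd.
      apply Rle_trans with (sumf (fun d => (1 - mu) * Dt w Om n d) (Dl Om n)).
      * rewrite sumf_scal. unfold lmass in HD. rewrite sumf_lDn in HD. simpl in HD.
        change (sumf (fun x => Dt w Om n x) (Dl Om n)) with (sumf (Dt w Om n) (Dl Om n)) in HD.
        change (sumf (fun x => Dt w Om n x) (Dl Om n)) with (sumf (Dt w Om n) (Dl Om n)).
        rewrite HD. lra.
      * apply sumf_le. intros d Hd.
        assert (Hd1 : (Om n < d)%nat) by (apply lD_big; now rewrite supp_lDn).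
        assert (HDd : 0 <= Dt w Om n d) by apply Hsub.
        destruct (Hlev d ltac:(lia)) as [H1 H2].
        rewrite sumf_lbind.
        apply Rle_trans with ((1 - mu) * Dt w Om n d * lmass (llevel (lG B 0) 0 d)).
        { rewrite <- (Rmult_1_r ((1 - mu) * Dt w Om n d)) at 1. apply Rmult_le_compat_l; auto.
          apply Rmult_le_pos; lra. }
        unfold lmass. rewrite <- sumf_scal. right. apply sumf_ext. intros [q lv] Hq.
        pose proof (in_map snd _ _ Hq) as Hlv.
        destruct (supp_llevel _ _ _ _ Hlv) as [p [ls [rs [E _]]]]. simpl in E. subst lv.
        rewrite sumf_lmap, lspine_true. unfold sumf. cbn [map lsum fold_right fst snd].
        unfold reaches_big. cbn [existsb]. destruct (Nat.ltb_spec (Om n) d); [|lia]. simpl. ring.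
    + assert (ES : S = sumf (fun k => INR k * pk k) (seq 1 B)).
      { unfold S, psum. cbn [seq]. rewrite sumf_cons. simpl INR. lra. }
      rewrite ES, Rmult_comm, <- sumf_scal. apply sumf_le. intros k Hk. apply in_seq in Hk.
      destruct (Hlev k ltac:(lia)) as [H1 H2].
      assert (Hkp : 0 <= INR k * pk k) by (apply Rmult_le_pos; [apply pos_INR|apply pik_nonneg]).
      rewrite sumf_lbind.
      apply Rle_trans with (sig * (INR k * pk k) * lmass (llevel (lG B 0) 0 k)).
      { rewrite <- (Rmult_1_r (sig * (INR k * pk k))) at 1. apply Rmult_le_compat_l; auto.
        now apply Rmult_le_pos. }
      unfold lmass. rewrite <- sumf_scal. apply sumf_le. intros [q lv] Hq. rewrite sumf_lmap.
      simpl fst. simpl snd. unfold sig.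
      rewrite (Rmult_comm (sumf _ _)), Rmult_assoc, (Rmult_comm (sumf _ _)), <- Rmult_assoc, <- sumf_scal.
      apply sumf_le. intros [m sp] Hm. specialize (Hnn _ Hm). specialize (H1 _ Hq). cbn [fst snd] in *.
      replace (INR k * pk k * (q * m) * indic (reaches_big (Om n) (lv :: sp))) with
        ((INR k * pk k * q) * (m * indic (reaches_big (Om n) (lv :: sp)))) by ring.
      apply Rmult_le_compat_l; [now apply Rmult_le_pos|]. apply Rmult_le_compat_l; auto.
      unfold reaches_big. simpl. destruct lv as [|k' p ls rs]; [simpl; lra|].
      destruct (Nat.ltb (Om n) k'); simpl; [apply indic_bounds|lra].
    + rewrite S_INR. pose proof (pos_INR L). simpl pow.
      assert (0 <= mu ^ L) by (apply pow_le; lra).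
      assert (0 <= INR L * y) by (now apply Rmult_le_pos).
      set (aL := mu ^ L + INR L * y) in *. assert (HaL : 0 <= aL) by (unfold aL; lra).
      assert (H3 : S * (1 - aL) <= S * sig) by (apply Rmult_le_compat_l; lra).
      assert (H4 : S * aL <= mu * aL) by (apply Rmult_le_compat_r; lra).
      assert (H5 : mu * aL <= mu * mu ^ L + INR L * y) by (unfold aL; nra).
      lra.
Qed.

(** Replacing the limiting masses by the probabilities of the patterns costs [e]; [TV_family] then
    counts disjoint sets of vertices. *)
Lemma family_lower n B M L e (Q : ptree * list level -> bool) E :
  (0 < n)%nat -> 0 < comp_sum w n (n - 1) (fun _ => 1) -> (B <= Om n)%nat ->
  sumf (fun qc => Rabs (fst qc - cpre w n (pdegs (cpat (snd qc))))) (lconf n B M L) <= e ->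
  (forall t a, In a (verts t) -> Q (conf M L (Om n) t a) = true -> E t a = true) ->
  sumf (fun qc => fst qc * indic (Q (snd qc))) (lconf n B M L) - e <= TVprob w n E.
Proof.
  intros Hn HBs HB Herr HE.
  apply Rle_trans with (sumf (fun c => indic (Q c) * cpre w n (pdegs (cpat c))) (supp (lconf n B M L))).
  - unfold supp. rewrite sumf_map.
    assert (H : sumf (fun qc => fst qc * indic (Q (snd qc)) -
        indic (Q (snd qc)) * cpre w n (pdegs (cpat (snd qc)))) (lconf n B M L) <= e).
    { eapply Rle_trans; [|exact Herr]. apply sumf_le. intros [q c] _. simpl.
      pose proof (Rle_abs (q - cpre w n (pdegs (cpat c)))).
      pose proof (Rabs_pos (q - cpre w n (pdegs (cpat c)))). pose proof (indic_bounds (Q c)). nra. }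
    rewrite sumf_minus in H. lra.
  - apply (TV_family n Hn HBs M L); [now apply NoDup_lconf|intros; now apply (lconf_valid n B)|].
    intros c t a _ HQ Ha <-. now apply HE.
Qed.

Definition no_big (n : nat) (t : tree) (a : list nat) : bool :=
  match H_k (Om n) t a with None => true | Some _ => false end.

(** Spines that reach a big vertex within [L] levels carry mass near [1 - mu ^ L], and this passes
    to the tree as a lower bound for the complement. Sibling trees are irrelevant here, so the width
    is [0]. *)
Lemma no_big_ancestor e : 0 < e -> ev (fun n => TVprob w n (no_big n) <= e).
Proof.
  intros He. destruct (offspring_law w tau mu HW HT) as [_ [Hmu _]].
  destruct (pow_lt_1_zero mu ltac:(rewrite Rabs_pos_eq; lra) (e / 4) ltac:(lra)) as [L HL].
  specialize (HL L (Nat.le_refl _)). rewrite Rabs_pos_eq in HL by (apply pow_le; lra).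
  (* Total loss: [y] for the tree at the pointed vertex and [INR L * y] along the spine. *)
  set (y := e / 4 / (INR L + 1)).
  assert (HLp : 0 < INR L + 1) by (pose proof (pos_INR L); lra).
  assert (Hy : 0 < y) by (apply Rdiv_lt_0_compat; lra).
  assert (HLy : INR L * y + y = e / 4) by (unfold y; field; lra).
  destruct (base_mass y Hy) as [B [HB1 HB2]].
  generalize (eventually_and g _ _ (eventually_positive w g HW HG) (eventually_and g _ _ (eventually_Om w g mu Om HOm B)
    (eventually_and g _ _ eventually_D (conf_err B 0 L (e / 4) ltac:(lra))))).
  apply eventually_mono. intros n [[Hn HBs] [HBO [[Hsub HD] Herr]]].
  pose proof (TV_compl n ltac:(lia) HBs (fun t a => negb (no_big n t a))) as Hc.
  cbv beta in Hc.
  assert (E : TVprob w n (fun t a => negb (negb (no_big n t a))) = TVprob w n (no_big n)).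
  { rewrite !TV_sumf. f_equal. apply sumf_ext. intros t _. f_equal. apply sumf_ext.
    intros. now rewrite Bool.negb_involutive. }
  rewrite E in Hc.
  pose proof (family_lower n B 0 L (e / 4) (fun c => reaches_big (Om n) (snd c))
    (fun t a => negb (no_big n t a)) ltac:(lia) HBs HBO Herr) as Hlow.
  assert (Hs : forall t a, In a (verts t) -> reaches_big (Om n) (snd (conf 0 L (Om n) t a)) = true ->
    negb (no_big n t a) = true).
  { intros t a _ H. apply reaches_big_H_k in H. unfold no_big. destruct (H_k (Om n) t a); [reflexivity|congruence]. }
  specialize (Hlow Hs). rewrite sumf_lconf in Hlow.
  pose proof (stopped_mass n B L y ltac:(lra) HB2 Hsub HD) as Hst.
  set (sig := sumf (fun qs => fst qs * indic (reaches_big (Om n) (snd qs))) (lspine (lh B) (lDn n) (lG B 0) 0 L false)) in *.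
  assert (HGmass : lnonneg (lG B 0) /\ 1 - gwc 0 0 * y <= lmass (lG B 0)).
  { apply lmass_lgw; auto; [lra|apply lxn_nonneg]. }
  destruct HGmass as [HG0 HG1]. simpl gwc in HG1.
  assert (Hprod : lmass (lG B 0) * sig <= TVprob w n (fun t a => negb (no_big n t a)) + e / 4).
  { eapply Rle_trans; [|apply Rplus_le_compat_r, Hlow].
    unfold lmass. rewrite Rmult_comm, <- sumf_scal. 
    match goal with |- _ <= ?s - _ + _ => apply Rle_trans with s; [|lra] end.
    right. apply sumf_ext. intros [q t0] _. simpl. rewrite Rmult_comm. unfold sig. rewrite <- sumf_scal.
    apply sumf_ext. intros; ring. }
  pose proof (lmass_nonneg _ HG0) as HG2.
  assert (Hmx : lmass (lG B 0) <= 1).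
  { unfold lG, lgw. pose proof (submass_gw (xi_law w tau) 0 0 submass_xi) as Hg.
    destruct (sub_gw (lxn B) (xi_law w tau) 0 0 (sub_seq _ _ (seq_NoDup _ _))) as [is [Hi1 Hi2]].
    cbn [lgw] in Hi2. rewrite <- Hi2. unfold lmass. rewrite sumf_map. now apply submass_list. }
  assert (H5 : lmass (lG B 0) * (1 - (mu ^ L + INR L * y)) <= lmass (lG B 0) * sig)
    by (now apply Rmult_le_compat_l).
  assert (H6 : 0 <= mu ^ L) by (apply pow_le; lra).
  assert (H7 : 0 <= INR L * y) by (apply Rmult_le_pos; [apply pos_INR|lra]).
  nra.
Qed.

End Approx.

(** * Comparison of the two laws on all events *)

Lemma ubound_list_max x xs : In x xs -> (ubound x < S (list_max (map ubound xs)))%nat.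
Proof.
  intros H. pose proof (proj1 (list_max_le (map ubound xs) _) (Nat.le_refl _)) as HF.
  rewrite Forall_forall in HF. specialize (HF (ubound x) (in_map _ _ _ H)). lia.
Qed.

(** The configurations, their masses and all errors are chosen without reference to [E], so the
    estimates for an event and for its complement hold from the same [N] on; this is the uniformity
    in total variation. *)
Theorem theorem5p7 (w : nat -> R) (g : nat) (tau mu : R) (Om : nat -> nat)
  (Hw : weight_seq w) (Hg : is_gcd_support w g) (Htype : type_II_III w tau mu)
  (HOm : Omega_ok w g mu Om) :
  forall (xs : list Uvert) (eps : R), 0 < eps ->
  exists N : nat, forall n : nat, (N <= n)%nat -> n mod g = 1 mod g ->
    forall (E : option (list degval) -> bool) (p : R),
      dprob_is (Tstar_law w tau mu Om n xs) E p ->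
      Rabs (H_prob w Om n xs E - p) < eps.
Proof.
  intros xs eps Heps.
  (* The window of [Tstar_law], strictly larger than each [ubound x], as [conf_deg] requires. *)
  set (M := S (list_max (map ubound xs))).
  (* Bound for the number of truncated draws in a configuration: the tree at [u_0], and [M] levels
     with one draw and [2 M] trees each. *)
  set (C := gwc M M + INR M * (1 + 2 * INR M * gwc M M)).
  pose proof (gwc_nonneg M M) as Hgc. pose proof (pos_INR M) as HM.
  assert (HC : 0 <= C).
  { unfold C. assert (0 <= INR M * gwc M M) by (now apply Rmult_le_pos).
    assert (0 <= INR M * (1 + 2 * INR M * gwc M M)); [|lra]. apply Rmult_le_pos; lra. }
  set (y := eps / 8 / (C + 1)). assert (Hy : 0 < y) by (apply Rdiv_lt_0_compat; lra).
  assert (HCy : C * y <= eps / 8).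
  { assert (E : C * y + y = eps / 8) by (unfold y; field; lra). lra. }
  destruct (base_mass w tau mu Hw Htype y Hy) as [B [HB1 HB2]].
  destruct (eventually_and g _ _ (eventually_positive w g Hw Hg)
    (eventually_and g _ _ (eventually_Om w g mu Om HOm B)
    (eventually_and g _ _ (eventually_D w g tau mu Om Hw Hg Htype HOm)
    (eventually_and g _ _ (conf_err w g tau mu Om Hw Hg Htype HOm B M M (eps / 8) ltac:(lra))
      (no_big_ancestor w g tau mu Om Hw Hg Htype HOm (eps / 8) ltac:(lra)))))) as [N HN].
  exists N. intros n Hn Hmod E p Hp.
  destruct (HN n Hn Hmod) as [[Hn2 HBs] [HBO [[Hsub HD] [Herr Hno]]]]. clear HN.
  set (LC := lconf w tau mu Om n B M M).
  set (lout := lbind (lG w tau B M) (fun t0 =>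
     lbind (lspine (lh w tau mu B) (lDn w Om n) (lG w tau B M) M M false) (fun sp =>
     lret (Some (map (star_deg t0 sp) xs))))).
  assert (Hsubm : submass (Tstar_law w tau mu Om n xs)).
  { unfold Tstar_law. fold M.
    assert (Hgw : submass (gw (xi_law w tau) M M)) by (apply submass_gw, (submass_xi w tau mu); auto).
    apply submass_bind; auto. intros t0. apply submass_bind; [|intros; apply submass_ret].
    apply submass_spine; auto. now apply submass_xihat. }
  assert (Hsubl : subfamily lout (Tstar_law w tau mu Om n xs)).
  { unfold Tstar_law, lout. fold M.
    assert (Hgw : subfamily (lG w tau B M) (gw (xi_law w tau) M M)) by (apply sub_gw, sub_seq, seq_NoDup).
    apply sub_bind; auto. intros t0 _. apply sub_bind; [|intros; apply sub_ret].
    apply sub_spine; auto; apply sub_seq, seq_NoDup. }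
  assert (Hout : forall h : option (list degval) -> R,
    sumf (fun qa => fst qa * h (snd qa)) lout =
    sumf (fun qc => fst qc * h (Some (map (star_deg (fst (snd qc)) (snd (snd qc))) xs))) LC).
  { intros h. unfold lout, LC. rewrite sumf_lconf, sumf_lbind. apply sumf_ext. intros [q t0] _.
    rewrite sumf_lbind. apply sumf_ext. intros [q' sp] _. unfold lret, sumf. simpl.
    rewrite Rmult_1_r. ring. }
  destruct (lmass_lgw (lxn w tau B) M M y ltac:(lra) (lxn_nonneg w tau mu Hw Htype B) HB1) as [HG1 HG2].
  fold (lG w tau B M) in HG1, HG2.
  destruct (lmass_lspine (lh w tau mu B) (lDn w Om n) (lG w tau B M) M M (gwc M M * y) y
    ltac:(nra) ltac:(lra) (lh_nonneg w tau mu Hw Htype B) (lDn_nonneg w Om n Hsub) HG1 HB2 HD HG2)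
    as [HS1 HS2].
  { intros k Hk. apply supp_lh in Hk. lia. }
  { intros d Hd. apply lD_big in Hd. lia. }
  assert (Hmass : 1 - eps / 8 <= lmass lout).
  { apply Rle_trans with (1 - (gwc M M * y + (INR M * (y + 2 * INR M * (gwc M M * y)) + 0))).
    - unfold C in HCy. lra.
    - assert (Hgy : 0 <= gwc M M * y) by (apply Rmult_le_pos; lra).
      assert (HMgy : 0 <= INR M * (gwc M M * y)) by (now apply Rmult_le_pos).
      assert (Hret : forall c : option (list degval), lnonneg (lret c))
        by (intros c pa [<-|[]]; simpl; lra).
      assert (Hin : 0 <= INR M * (y + 2 * INR M * (gwc M M * y))) by (apply Rmult_le_pos; lra).
      apply lmass_bind; auto; try lra.
      + intros t0 _. apply lnonneg_bind; auto.
      + intros t0 _. apply lmass_bind; auto; try lra. intros sp _. rewrite lmass_lret. lra. }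
  pose proof (law_sandwich _ lout (eps / 8) E p Hsubm Hsubl Hmass Hp) as Hsand.
  rewrite (Hout (fun o => indic (E o))) in Hsand.
  (* A one-sided estimate for arbitrary events, to be applied to [E] and to its complement; the
     second [eps / 8] is the cost of the vertices without a big ancestor. *)
  assert (Hlow : forall Q' : option (list degval) -> bool,
    sumf (fun qc => fst qc * indic (Q' (Some (map (star_deg (fst (snd qc)) (snd (snd qc))) xs)))) LC
      - eps / 8 <= TVprob w n (fun t a => Q' (H_vec (Om n) xs t a)) + eps / 8).
  { intros Q'.
    apply Rle_trans with (TVprob w n (fun t a => (Q' (H_vec (Om n) xs t a) || no_big Om n t a)%bool)).
    - apply (family_lower w tau mu Om Hw n B M M (eps / 8)
        (fun c => Q' (Some (map (star_deg (fst c) (snd c)) xs)))); auto; [lia|].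
      intros t a Ha HQ. unfold no_big, H_vec. destruct (H_k (Om n) t a) as [k|] eqn:Hk;
        [|now rewrite Bool.orb_true_r].
      rewrite Bool.orb_false_r, <- HQ. do 2 f_equal. apply map_ext_in. intros x Hx. symmetry.
      apply conf_deg; auto; [now apply in_verts|now apply ubound_list_max].
    - apply Rle_trans with (TVprob w n (fun t a => Q' (H_vec (Om n) xs t a)) + TVprob w n (no_big Om n));
        [|lra].
      apply (TV_le w Hw n ltac:(lia) HBs). intros t a _.
      destruct (Q' (H_vec (Om n) xs t a)), (no_big Om n t a); simpl; lra. }
  pose proof (Hlow E) as H1. pose proof (Hlow (fun o => negb (E o))) as H2.
  pose proof (TV_compl w n ltac:(lia) HBs (fun t a => E (H_vec (Om n) xs t a))) as H3.
  assert (H4 : lmass lout = sumf (fun qc => fst qc * indic (E (Some (map (star_deg (fst (snd qc)) (snd (snd qc))) xs)))) LC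
    + sumf (fun qc => fst qc * indic (negb (E (Some (map (star_deg (fst (snd qc)) (snd (snd qc))) xs))))) LC).
  { rewrite <- sumf_plus. transitivity (sumf (fun qa => fst qa * (fun _ => 1) (snd qa)) lout).
    - unfold lmass. apply sumf_ext. intros; ring.
    - rewrite (Hout (fun _ => 1)). apply sumf_ext. intros qc _. destruct (E _); simpl; ring. }
  cbv beta in H1, H2, H3. unfold H_prob. apply Rabs_def1; lra.
Qed.
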